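(* Let $X$ be the $\mathbb R^N$-valued process constructed in the context, and assume that, as $t\to\infty$, $\sqrt t\,(X(t)/t-\mathbf K)$ converges in law to the centred Gaussian law with variance-covariance matrix $\frac{1}{1+\Gamma}D_0$. Then, as $t\to\infty$, $X(t)/t$ converges almost surely towards $$\mathbf K=\frac{\lambda_\infty\mathbb E(Z_\infty)}{1-\lambda_\infty\mathbb E(\Theta_\infty)},$$ where the couple $(\Theta_\infty,Z_\infty)$ has law $\alpha_\infty(\theta)Q(d\theta,dz)/\lambda_\infty$.
   Context: $N\ge1$ is an integer, $S=[-1,0]\times\mathbb R^N$, $Q$ is a Borel probability measure on $S$. Standing assumptions: (i) $\alpha:[0,\infty)\times[-1,0]\to(0,\infty)$ is bounded and continuous, and there exist $M>0$, $\beta>0$ and a continuous function $\alpha_\infty:[-1,0]\to(0,\infty)$ with $|\alpha(t,\theta)-\alpha_\infty(\theta)|\le Me^{-\beta t}$ for all $t\ge0$, $\theta\in[-1,0]$; (ii) $\int_S|x|^2Q(d\theta,dx)<\infty$. Also $u^0\in C([-1,0];\mathcal P(\mathbb R^N))$, where $\mathcal P(\mathbb R^N)$ is the set of Borel probability measures with the narrow topology. Notation: $\lambda(t)=\int_S\alpha(t,\theta)Q(d\theta,dz)$, $\lambda_\infty=\int_S\alpha_\infty(\theta)Q(d\theta,dz)>0$, and $$\mathbf K=\frac{1}{1+\Gamma}\int_S\alpha_\infty(\theta)zQ(d\theta,dz),\quad\Gamma=\int_S(-\theta)\alpha_\infty(\theta)Q(d\theta,dz),\quad D_0=\int_S\alpha_\infty(\theta)[z+\theta\mathbf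 K][z+\theta\mathbf K]^TQ(d\theta,dz).$$ Construction of $X$: on a probability space, let $(N(t))_{t\ge0}$ be a nonhomogeneous Poisson process with intensity function $\lambda(t)$, $T_0=0$ and $T_n=\inf\{t\ge0:N(t)\ge n\}$ for $n\ge1$. Let $(\Theta_n,Z_n)_{n\ge1}$ be $S$-valued random variables which, conditionally on $(T_n)_{n}$, are independent with $(\Theta_n,Z_n)$ having law $q_{T_n}(d\theta,dz)$, where $q_t(d\theta,dz)=\frac{1}{\lambda(t)}\alpha(t,\theta)Q(d\theta,dz)$. Let $(U(\theta))_{\theta\in[-1,0]}$ be an $\mathbb R^N$-valued càdlàg process such that $U(\theta)$ has law $u^0(\theta,dx)$ for each $\theta$, independent of $(T_n)_n$ and $(\Theta_n,Z_n)_n$. Set $X(\theta)=U(\theta)$ for $\theta\in[-1,0]$; and recursively, for $n\ge0$, $X(t)=X(T_n)$ for $t\in[T_n,T_{n+1})$ and $X(T_{n+1})=X(T_{n+1}^-+\Theta_{n+1})+Z_{n+1}$, where $X(T_{n+1}^-+\Theta_{n+1})$ denotes the left limit of $X$ at time $T_{n+1}+\Theta_{n+1}$. *)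

(* Defs.v *)
From HB Require Import structures.
From mathcomp Require Import all_boot all_order all_algebra.
From mathcomp Require Import all_classical all_reals all_analysis.

Set Implicit Arguments.
Unset Strict Implicit.
Unset Printing Implicit Defensive.

Import Order.TTheory GRing.Theory Num.Theory.
Import numFieldNormedType.Exports.

Local Open Scope classical_set_scope.
Local Open Scope ring_scope.

(* Borel sigma-algebra on matrices, in particular on R^N = 'cV[R]_N. *)
HB.instance Definition _ (R : realType) (m n : nat) :=
  Measurable.copy 'M[R]_(m, n) (g_sigma_algebraType (@open 'M[R]_(m, n))).

(* A probability measure on S is encoded as a probability measure on
   R * R^N giving mass 1 to S. *)
Definition stateS (R : realType) (N : nat) : set (R * 'cV[R]_N) :=
  `[-1, 0] `*` setT.
Arguments stateS {R N}.

Section coefficients.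
Context {R : realType} {N : nat} (Q : probability (R * 'cV[R]_N)%type R).

Definition lambda (alpha : R -> R -> R) (t : R) : R :=
  \int[Q]_(y in stateS) alpha t y.1.

Definition lambda_inf (alpha_inf : R -> R) : R :=
  \int[Q]_(y in stateS) alpha_inf y.1.

Definition Gamma (alpha_inf : R -> R) : R :=
  \int[Q]_(y in stateS) (- y.1 * alpha_inf y.1).

Definition Kvec (alpha_inf : R -> R) : 'cV[R]_N :=
  (1 + Gamma alpha_inf)^-1 *:
    \col_i \int[Q]_(y in stateS) (alpha_inf y.1 * y.2 i 0).

Definition D0 (alpha_inf : R -> R) : 'M[R]_N :=
  \matrix_(i, j) \int[Q]_(y in stateS)
    (alpha_inf y.1 * ((y.2 + y.1 *: Kvec alpha_inf) *m
                      (y.2 + y.1 *: Kvec alpha_inf)^T) i j).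

Definition qlaw (alpha : R -> R -> R) (t : R) (B : set (R * 'cV[R]_N)) : R :=
  (lambda alpha t)^-1 * \int[Q]_(y in stateS `&` B) alpha t y.1.

Definition qlaw_inf (alpha_inf : R -> R) (B : set (R * 'cV[R]_N)) : R :=
  (lambda_inf alpha_inf)^-1 * \int[Q]_(y in stateS `&` B) alpha_inf y.1.

End coefficients.

Section narrow.
Context {R : realType} {N : nat}.

Definition bounded_continuous (f : 'cV[R]_N -> R) : Prop :=
  continuous f /\ exists M : R, forall x, `|f x| <= M.

(* The narrow topology is initial for the maps mu |-> \int f dmu with f
   bounded and continuous. *)
Definition narrow_continuous (u : R -> probability 'cV[R]_N R) : Prop :=
  forall f, bounded_continuous f ->
    {within `[-1, 0], continuous (fun th => \int[u th]_x f x)}.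

Definition cvg_in_law d (Om : measurableType d) (P : probability Om R)
    (Y : R -> Om -> 'cV[R]_N) (G : probability 'cV[R]_N R) : Prop :=
  forall f, bounded_continuous f ->
    (\int[P]_w f (Y t w)) @[t --> +oo] --> \int[G]_x f x.

(* The degenerate case is separated because [normal_prob 0 0] is not the
   Dirac mass. *)
Definition centred_normal (v : R) (B : set R) : \bar R :=
  if v == 0 then \d_(0 : R) B else normal_prob 0 (Num.sqrt v) B.

(* Sigma may be singular: G is Gaussian iff all its one-dimensional marginals
   are, with variance a^T Sigma a in the direction a. *)
Definition centred_gaussian (Sigma : 'M[R]_N) (G : probability 'cV[R]_N R) :
    Prop :=
  forall (a : 'cV[R]_N) (B : set R), measurable B ->
    G [set x | B ((a^T *m x) 0 0)] =
      centred_normal ((a^T *m Sigma *m a) 0 0) B.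

End narrow.

Definition sigma_fam (Om I : Type) d (T : measurableType d) (D : set I)
    (X : I -> Om -> T) : set (set Om) :=
  <<s \bigcup_(i in D) preimage_set_system setT (X i) measurable >>.

Section probability_notions.
Context {d} {Om : measurableType d} {R : realType} (P : probability Om R).

Definition independent_sigma (F G : set (set Om)) : Prop :=
  forall A B, F A -> G B -> P (A `&` B) = (P A * P B)%E.

(* f is a version of the conditional probability of A given F. *)
Definition cond_prob (F : set (set Om)) (A : set Om) (f : Om -> R) : Prop :=
  (forall B : set R, measurable B -> F (f @^-1` B)) /\
  (forall E, F E -> P (A `&` E) = (\int[P]_(w in E) (f w)%:E)%E).

(* Second argument of [poisson_prob] is a dummy. *)
Definition poisson_process (lam : R -> R) (Nt : R -> {RV P >-> nat}) : Prop :=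
  [/\ forall w, Nt 0 w = 0%N,
      forall w s t, 0 <= s -> s <= t -> (Nt s w <= Nt t w)%N,
      forall w t, 0 <= t -> \forall s \near t^'+, Nt s w = Nt t w,
      forall (k : nat) (t : nat -> R) (B : nat -> set nat),
        0 <= t 0%N -> (forall i, t i <= t i.+1) ->
        P (\bigcap_(i in `I_k) [set w | B i (Nt (t i.+1) w - Nt (t i) w)%N]) =
        (\prod_(i < k) P [set w | B i (Nt (t i.+1) w - Nt (t i) w)%N])%E
    & forall (s t : R) (B : set nat), 0 <= s -> s <= t ->
        P [set w | B (Nt t w - Nt s w)%N] =
        poisson_prob (\int[lebesgue_measure]_(r in `[s, t]) lam r) 0 B].

End probability_notions.

Section construction.
Context {d} {Om : measurableType d} {R : realType} {N : nat}.

(* [inf] is the real infimum: on the null event where the set is empty, its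
   value is 0 instead of +oo. *)
Definition arrival (Nt : R -> Om -> nat) (n : nat) (w : Om) : R :=
  if n is 0%N then 0 else inf [set t | 0 <= t /\ (n <= Nt t w)%N].

(* Conditionally on (T_n), n >= 1, the variables Y_n, n >= 1, are independent
   and Y_n has law q_{T_n}; the index 0 of Y is not used.  Taking some of the
   B i equal to setT gives the product rule for all finite subfamilies. *)
Definition cond_independent_marks (P : probability Om R)
    (q : R -> set (R * 'cV[R]_N) -> R) (T : nat -> Om -> R)
    (Y : nat -> Om -> R * 'cV[R]_N) : Prop :=
  forall (m : nat) (B : nat -> set (R * 'cV[R]_N)),
    (forall i, measurable (B i)) ->
    cond_prob P (sigma_fam [set n | (0 < n)%N] T)
      (\bigcap_(i in `I_m) (Y i.+1 @^-1` B i))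
      (fun w => \prod_(i < m) q (T i.+1 w) (B i)).

Definition cadlag (f : R -> 'cV[R]_N) : Prop :=
  (forall th, -1 <= th -> th < 0 -> f s @[s --> th^'+] --> f th) /\
  (forall th, -1 < th -> th <= 0 -> cvg (f s @[s --> th^'-])).

Definition delayed_path (U : R -> 'cV[R]_N) (T : nat -> R)
    (Y : nat -> R * 'cV[R]_N) (x : R -> 'cV[R]_N) : Prop :=
  [/\ forall th, -1 <= th -> th <= 0 -> x th = U th,
      forall n t, T n <= t -> t < T n.+1 -> x t = x (T n)
    & forall n, x (T n.+1) =
        lim (x s @[s --> (T n.+1 + (Y n.+1).1)^'-]) + (Y n.+1).2].

(* The path recursion is imposed almost surely: it is meaningful only on the
   almost sure event 0 < T_1 < T_2 < ... -> +oo. *)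
Definition delayed_process (P : probability Om R)
    (Q : probability (R * 'cV[R]_N)%type R) (alpha : R -> R -> R)
    (u0 : R -> probability 'cV[R]_N R)
    (Nt : R -> {RV P >-> nat}) (Y : nat -> {RV P >-> (R * 'cV[R]_N)%type})
    (U X : R -> {RV P >-> 'cV[R]_N}) : Prop :=
  let T := arrival Nt in
  [/\ poisson_process (lambda Q alpha) Nt,
      (forall n w, (0 < n)%N -> stateS (Y n w)) /\
        cond_independent_marks P (qlaw Q alpha) T Y,
      (forall w, cadlag (U ^~ w)) /\
        (forall th B, -1 <= th -> th <= 0 -> measurable B ->
           distribution P (U th) B = u0 th B),
      independent_sigma P (sigma_fam `[-1, 0] U)
        (sigma_fam [set n | (0 < n)%N] (fun n w => (T n w, Y n w)))
    & {ae P, forall w, delayed_path (U ^~ w) (T ^~ w) (Y ^~ w) (X ^~ w)}].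

End construction.

(* Main.v *)
(* After an interval of length 1 without arrivals the delays no longer reach back
   beyond that interval, so that X differs by a constant from the process
   restarted from 0 at any earlier time. Cut [0, n^3] into n^2 blocks of length
   n. Almost surely, for n large every block contains such an interval, and X(n^3)
   is, up to a constant and two boundary blocks, a sum of n^2 increments, each of
   which is a function of the points in two adjacent blocks. These increments are
   1-dependent with second moments O(n^2), hence the variance of their sum
   divided by n^3 is O(n^-2), which is summable: the fluctuations of X(n^3) / n^3
   around a deterministic sequence m_n vanish almost surely, and the sizes of the
   marks control X between consecutive cubes. The central limit theorem gives
   X(t) / t -> K in probability, which forces m_n -> K. *)
Require Import Defs.
From HB Require Import structures.
From mathcomp Require Import all_boot all_order all_algebra.
From mathcomp Require Import all_classical all_reals all_analysis.
From mathcomp Require Import measurable_realfun ring lra zify.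

Import Order.TTheory GRing.Theory Num.Theory.
Import numFieldNormedType.Exports.
Import HBNNSimple.

Local Open Scope classical_set_scope.
Local Open Scope ring_scope.

(** Convergence in law at fixed times says nothing about a whole path, so almost sure convergence
    has to come from independence in time, which the delays destroy: the move over a block depends
    on the past. The way out is to define the block increments for every outcome, from a process
    restarted at 0, whether or not the block contains a gap. Independence and moment bounds then
    hold without conditioning on gaps, and gaps only identify these increments with those of the
    path. Block lengths must grow, since all n^2 blocks are to contain a gap; the probability that
    one does not is geometric in n. Cubes are sparse enough for second moments alone to give almost
    sure convergence along them, yet consecutive cubes have ratio tending to 1. Marks are numbered
    globally and their laws depend on the arrival times; the independence of disjoint time windows
    is derived from the conditional law of the marks by fixing the counts at the left ends of the
    windows. All coordinates share arrival times and delays, so the genealogy is studied with scalar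
    marks. *)

(** * Independence of sigma-algebras and expectations of products *)

Section independence.
Context {d} {Om : measurableType d} {R : realType} (P : probability Om R).
Implicit Types G : set (set Om).

Lemma sigma_sub_measurable G :
  G `<=` measurable -> <<s G >> `<=` measurable.
Proof.
by move=> GM; apply: smallest_sub => //; exact: sigma_algebra_measurable.
Qed.

(** For fixed [B] the events independent of [B] form a Dynkin system, which therefore contains the
    sigma-algebra generated by the pi-system [G]. *)
Lemma indep_pi_lambda G B : setI_closed G -> G `<=` measurable ->
  measurable B -> (forall A, G A -> P (A `&` B) = (P A * P B)%E) ->
  forall A, <<s G >> A -> P (A `&` B) = (P A * P B)%E.
Proof.
move=> IG MG mB GB.
pose H := [set A | measurable A /\ P (A `&` B) = (P A * P B)%E].
suff : <<s G >> `<=` H by move=> + A GA => /(_ A GA)[].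
apply: lambda_system_subset => //.
apply/dynkin_lambda_system; split.
- by split => //; rewrite setTI probability_setT mul1e.
- move=> A [mA AB]; split; first exact: measurableC.
  have fB : P B \is a fin_num by exact: fin_num_measure.
  have fA : P A \is a fin_num by exact: fin_num_measure.
  have fAB : P (A `&` B) \is a fin_num.
    by apply: fin_num_measure; exact: measurableI.
  rewrite probability_setC// muleBl// ?mul1e.
  rewrite -AB -[in RHS](setIC B) -measureD//; last by rewrite ltey_eq fB.
  by rewrite setDE setIC.
- move=> F tF HF; split.
    by apply: bigcup_measurable => k _; have [] := HF k.
  rewrite setI_bigcupl measure_bigcup//=; last 2 first.
    by move=> k _; apply: measurableI => //; have [] := HF k.
    exact: trivIset_setIr.
  rewrite [in RHS]measure_bigcup//=; last by move=> k _; have [] := HF k.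
  rewrite muleC -(fineK (fin_num_measure P B mB)) -nneseriesZl//.
  by apply: eq_eseriesr => i _; have [_ ->] := HF i; rewrite muleC fineK// fin_num_measure.
- by move=> A GA; split; [exact: MG|exact: GB].
Qed.

Lemma independent_sigma_pi G1 G2 : setI_closed G1 -> setI_closed G2 ->
  G1 `<=` measurable -> G2 `<=` measurable ->
  (forall A B, G1 A -> G2 B -> P (A `&` B) = (P A * P B)%E) ->
  independent_sigma P <<s G1 >> <<s G2 >>.
Proof.
move=> I1 I2 M1 M2 G12 A B GA GB.
have mB := sigma_sub_measurable _ M2 _ GB.
apply: (indep_pi_lambda G1) => // A' GA'.
rewrite setIC muleC; apply: (indep_pi_lambda G2) => //; first exact: M1.
by move=> B' GB'; rewrite setIC muleC G12.
Qed.

(** The product rule on preimages says that the joint law of [f] and [g] is the product of their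
    laws; Fubini then separates the integral of the product. *)
Lemma expectation_indep (f g : Om -> R) :
  P.-integrable setT (EFin \o f) -> P.-integrable setT (EFin \o g) ->
  (forall A B, measurable A -> measurable B ->
     P (f @^-1` A `&` g @^-1` B) = (P (f @^-1` A) * P (g @^-1` B))%E) ->
  (\int[P]_w (f w * g w)%:E =
     (\int[P]_w (f w)%:E) * (\int[P]_w (g w)%:E))%E.
Proof.
move=> intf intg fg.
have mf : measurable_fun setT f.
  by apply/measurable_EFinP; exact: measurable_int intf.
have mg : measurable_fun setT g.
  by apply/measurable_EFinP; exact: measurable_int intg.
pose F : {RV P >-> R} := HB.pack f (isMeasurableFun.Build _ _ _ _ f mf).
pose H : {RV P >-> R} := HB.pack g (isMeasurableFun.Build _ _ _ _ g mg).
have mh : measurable_fun setT (fun w => (f w, g w)).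
  exact: measurable_fun_pair.
pose h : {mfun Om >-> (R * R)%type} :=
  HB.pack (fun w => (f w, g w)) (isMeasurableFun.Build _ _ _ _ _ mh).
have prodE (X : set (R * R)) : measurable X ->
    (distribution P F \x distribution P H)%E X = distribution P h X.
  apply: product_measure_unique => A B mA mB.
  by rewrite -[RHS]fg.
pose k : R * R -> \bar R := fun x => (x.1 * x.2)%:E.
have mk : measurable_fun setT k.
  apply/measurable_EFinP; apply: measurable_funM.
    exact: measurable_fst.
  exact: measurable_snd.
have iF : (distribution P F).-integrable setT (EFin : R -> \bar R).
  by apply: integrable_pushforward => //; exact: EFin_measurable.
have iH : (distribution P H).-integrable setT (EFin : R -> \bar R).
  by apply: integrable_pushforward => //; exact: EFin_measurable.
have EF : (\int[P]_w (f w)%:E = \int[distribution P F]_x x%:E)%E.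
  by rewrite integral_distribution//; exact: EFin_measurable.
have EH : (\int[P]_w (g w)%:E = \int[distribution P H]_x x%:E)%E.
  by rewrite integral_distribution//; exact: EFin_measurable.
have fE : (\int[distribution P H]_x x%:E)%E \is a fin_num.
  exact: (integrable_fin_num measurableT iH).
have ik : (distribution P F \x distribution P H)%E.-integrable setT k.
  apply/integrable12ltyP => //=.
  have fabs : (\int[distribution P H]_y `|y%:E| \is a fin_num)%E.
    by apply: (integrable_fin_num measurableT); exact: integrable_abse.
  under eq_integral => x _.
    under eq_integral => y _ do rewrite /k/= normrM EFinM.
    rewrite ge0_integralZl//=; last first.
      by apply: measurableT_comp => //; exact: normr_measurable.
    rewrite muleC -[X in (X * _)%E]fineK//. over.
  rewrite /= ge0_integralZl//=; last 2 first.
  - by apply: measurableT_comp => //; exact: normr_measurable.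
  - by rewrite lee_fin fine_ge0// integral_ge0.
  apply: lte_mul_pinfty => //.
  - by rewrite lee_fin fine_ge0// integral_ge0.
  - by have /integrableP[_] := iF.
have ikh : P.-integrable setT (k \o h).
  apply/integrableP; split; first exact: measurableT_comp.
  rewrite -(@ge0_integral_distribution _ _ _ _ _ P h (abse \o k)); last 2 first.
  - exact: measurableT_comp.
  - by move=> y; exact: abse_ge0.
  rewrite (eq_measure_integral (distribution P F \x distribution P H)%E).
    by have /integrableP[_] := ik.
  by move=> A mA _; exact/esym/prodE.
transitivity (\int[distribution P h]_z k z)%E.
  by rewrite integral_distribution.
transitivity (\int[(distribution P F \x distribution P H)%E]_z k z)%E.
  by apply: eq_measure_integral => A mA _; exact/esym/prodE.
rewrite -integral12_prod_meas1// /fubini_F EF EH.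
under eq_integral => x _.
  rewrite /k/=. under eq_integral do rewrite EFinM.
  rewrite integralZl// -[X in (_ * X)%E]fineK//. over.
by rewrite /= integralZr// fineK.
Qed.

End independence.

(** * Comparison of measures and integration against a density *)

(** Serves to dominate the law of a mark, restricted to an event, by a multiple of [Q]. *)
Lemma le_measure_integral {d} {T : measurableType d} {R : realType}
    (m1 m2 : {measure set T -> \bar R}) (f : T -> \bar R) :
  (forall A, measurable A -> (m1 A <= m2 A)%E) ->
  measurable_fun setT f -> (forall x, 0 <= f x)%E ->
  (\int[m1]_x f x <= \int[m2]_x f x)%E.
Proof.
move=> m12 mf f0; rewrite !ge0_integralTE//.
apply: ge_ereal_sup => _ [h hf <-].
apply: le_trans (le_measure_sintegral m12 h) _.
by apply: ereal_sup_ubound; exists h.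
Qed.

Section density.
Context {d} {T : measurableType d} {R : realType}.
Variables (mu nu : {measure set T -> \bar R}) (w : T -> R).
Hypotheses (mw : measurable_fun setT w) (w0 : forall x, 0 <= w x).
Hypothesis nuE :
  forall A, measurable A -> (nu A = \int[mu]_(x in A) (w x)%:E)%E.

Let ge0_integral_density_nnsfun (h : {nnsfun T >-> R}) :
  (\int[nu]_x (h x)%:E = \int[mu]_x ((h x)%:E * (w x)%:E))%E.
Proof.
have mh r : measurable (h @^-1` [set r]) by exact: measurable_sfunP.
rewrite integral_nnsfun// patch_setT sintegralE.
transitivity (\int[mu]_x (\sum_(r \in range h)
    r%:E * ((\1_(h @^-1` [set r]) x)%:E * (w x)%:E)))%E; last first.
  apply: eq_integral => x _; rewrite fimfunE -fsumEFin// ge0_mule_fsuml//.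
    by apply: eq_fsbigr => r _; rewrite EFinM muleA.
  by move=> r; exact: nnfun_muleindic_ge0.
rewrite ge0_integral_fsum//=; last 2 first.
- move=> r; apply: emeasurable_funM => //.
  by apply/measurable_EFinP; apply: measurable_funM.
- move=> r x _; rewrite muleA mule_ge0// ?lee_fin//.
  exact: nnfun_muleindic_ge0.
apply: eq_fsbigr => r; rewrite inE => -[t _ <-].
rewrite ge0_integralZl//; last 3 first.
- by apply/measurable_EFinP; apply: measurable_funM.
- by move=> x _; rewrite mule_ge0// lee_fin.
- by rewrite lee_fin.
rewrite nuE// [in LHS]integral_mkcond; congr (_ * _)%E.
apply: eq_integral => x _; rewrite patchE indicE.
by case: ifP => _; rewrite ?mul1e ?mul0e.
Qed.

(** Monotone convergence on both sides, from simple functions. It serves with [w] an indicator, for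
    laws restricted to an event, and with [w] the density of the limit law of the marks. *)
Lemma ge0_integral_density (f : T -> \bar R) :
  measurable_fun setT f -> (forall x, 0 <= f x)%E ->
  (\int[nu]_x f x = \int[mu]_x (f x * (w x)%:E))%E.
Proof.
move=> mf f0.
pose g := nnsfun_approx measurableT mf.
have cg x : EFin \o g ^~ x @ \oo --> f x by exact: cvg_nnsfun_approx.
have nd_g x (a b : nat) : (a <= b)%N -> g a x <= g b x.
  by move=> ab; exact/lefP/nd_nnsfun_approx.
have nu_lim : (\int[nu]_x (g n x)%:E)%E @[n --> \oo] --> (\int[nu]_x f x)%E.
  rewrite (eq_integral (fun x => limn (EFin \o g ^~ x))); last first.
    by move=> x _; exact/esym/cvg_lim.
  apply: cvg_monotone_convergence => //.
  - by move=> n; exact/measurable_EFinP.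
  - by move=> n x _; rewrite lee_fin.
  - by move=> x _ a b ab; rewrite lee_fin nd_g.
have mu_lim : (\int[mu]_x ((g n x)%:E * (w x)%:E))%E @[n --> \oo] -->
    (\int[mu]_x (f x * (w x)%:E))%E.
  rewrite (eq_integral (fun x => limn (fun n => (g n x)%:E * (w x)%:E))%E);
    last first.
    by move=> x _; apply/esym/cvg_lim => //; apply: cvgeZr => //; exact: cg.
  apply: cvg_monotone_convergence => //.
  - by move=> n; apply: emeasurable_funM; exact/measurable_EFinP.
  - by move=> n x _; rewrite mule_ge0// lee_fin.
  - by move=> x _ a b ab; rewrite lee_wpmul2r// lee_fin// nd_g.
apply: (cvg_unique _ nu_lim) => //.
by rewrite /=; under eq_fun do rewrite ge0_integral_density_nnsfun.
Qed.

(** As [w] is nonnegative, multiplication by it commutes with taking positive and negative parts. *)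
Lemma integral_density (f : T -> R) : measurable_fun setT f ->
  (\int[nu]_x (f x)%:E = \int[mu]_x (f x * w x)%:E)%E.
Proof.
have maxM (a b : R) : 0 <= b ->
    (maxe (a * b)%:E 0 = maxe a%:E 0 * b%:E)%E.
  move=> b0; have [a0|a0] := leP 0 a.
    by rewrite !max_l ?lee_fin// mulr_ge0.
  rewrite !max_r ?mul0e// ?lee_fin ?(ltW a0)//.
  by rewrite mulr_le0_ge0// ltW.
move=> mf; rewrite [LHS]integralE [RHS]integralE; congr (_ - _)%E.
- rewrite ge0_integral_density//; last exact/measurable_funepos/measurable_EFinP.
  by apply: eq_integral => x _; rewrite !funeposE maxM.
- rewrite ge0_integral_density//; last exact/measurable_funeneg/measurable_EFinP.
  by apply: eq_integral => x _; rewrite !funenegE -!EFinN -mulNr maxM.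
Qed.

End density.

(** * Countable partitions, and almost sure convergence from summable expectations *)

Section countable_partition.
Context {d} {Om : measurableType d} {R : realType} (P : probability Om R).

(** [K] will be a number of points: once the number up to time [s] is fixed, the marks after [s]
    have deterministic indices. *)
Lemma integral_countable_partition (K : Om -> nat) (f : Om -> \bar R)
    (E : set Om) :
  measurable_fun setT K -> measurable E ->
  measurable_fun setT f -> (forall w, 0 <= f w)%E ->
  (\int[P]_(w in E) f w =
   \sum_(k <oo) \int[P]_(w in E `&` (K @^-1` [set k])) f w)%E.
Proof.
move=> mK mE mf f0.
have mEK k : measurable (E `&` K @^-1` [set k]).
  by apply: measurableI => //; rewrite -[X in measurable X]setTI; exact: mK.
rewrite -ge0_integral_bigcup//; last 2 first.
- exact: measurable_funTS.
- by apply/trivIsetP => i j _ _ ij; rewrite -subset0 => w [[_ /= ->] [_ /= ijE]];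
    rewrite ijE eqxx in ij.
congr (integral _ _ _); apply/seteqP; split => [w Ew|w [k _ []]//].
by exists (K w).
Qed.

Lemma measure_countable_partition (K : Om -> nat) (E : set Om) :
  measurable_fun setT K -> measurable E ->
  (P E = \sum_(k <oo) P (E `&` (K @^-1` [set k])))%E.
Proof.
move=> mK mE.
have mEK k : measurable (E `&` K @^-1` [set k]).
  by apply: measurableI => //; rewrite -[X in measurable X]setTI; exact: mK.
have := integral_countable_partition K (cst 1%E) E mK mE.
rewrite integral_cst// mul1e => ->//.
by apply: eq_eseriesr => k _; rewrite integral_cst// mul1e.
Qed.

(** The sum of the [f n] has finite expectation, so it is almost everywhere finite and its terms
    tend to 0. This takes the place of Chebyshev with Borel-Cantelli. *)
Lemma summable_integral_ae_cvg0 (f : nat -> Om -> R) (c : nat -> R) :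
  (forall n, measurable_fun setT (f n)) -> (forall n w, 0 <= f n w) ->
  (forall n, (\int[P]_w (f n w)%:E <= (c n)%:E)%E) ->
  (\sum_(n <oo) (c n)%:E < +oo)%E ->
  {ae P, forall w, f n w @[n --> \oo] --> 0}.
Proof.
move=> mf f0 fc cy.
pose F w := (\sum_(n <oo) (f n w)%:E)%E.
have mF : measurable_fun setT F.
  apply: ge0_emeasurable_sum => //.
    by move=> n x _; rewrite lee_fin.
  by move=> n _; exact/measurable_EFinP.
have iF : P.-integrable setT F.
  apply/integrableP; split => //.
  rewrite (eq_integral F) => [|w _]; last first.
    by rewrite gee0_abs// nneseries_ge0// => n _ _; rewrite lee_fin.
  rewrite integral_nneseries//.
  - apply: le_lt_trans cy; apply: lee_nneseries => // n _.
    by move=> _; apply: integral_ge0 => w _; rewrite lee_fin.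
  - by move=> n; exact/measurable_EFinP.
  - by move=> n w _; rewrite lee_fin.
have := integrable_ae measurableT iF.
apply: filterS => w /(_ Logic.I) Fw.
apply: (@cvg_series_cvg_0 _ R).
have nd : nondecreasing_seq (series (f ^~ w)).
  by apply/nondecreasing_seqP => n; rewrite seriesSr lerDl.
apply: nondecreasing_is_cvgn => //.
exists (fine (F w)) => _ [n _ <-].
rewrite -lee_fin fineK// /F /series/= -sumEFin.
by apply: nneseries_lim_ge => // i _; rewrite lee_fin.
Qed.

End countable_partition.

Lemma measurable_coord {R : realType} {N : nat} (i : 'I_N) :
  measurable_fun setT (fun x : 'cV[R]_N => x i 0).
Proof.
apply: (measurability _ (RGenOpens.measurableE R)) => //.
move=> _ [_ [a [b ->]] <-]; rewrite setTI; apply: sub_sigma_algebra.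
by apply: open_comp; [move=> x _; exact: coord_continuous|exact: itv_open].
Qed.

Section inverse_square.
Context {d} {Om : measurableType d} {R : realType} (P : probability Om R).

(** The right-hand side telescopes. The factor 6 is forced by n = 1; at n = 0 the left-hand side is
    0, because the inverse of 0 is 0. *)
Lemma inv_sqr_le (n : nat) : (n%:R : R) ^- 2 <= 6 / (n.+1%:R * n.+2%:R).
Proof.
case: n => [|n]; first by rewrite expr0n/= invr0 divr_ge0// mulr_ge0.
rewrite -[leLHS]div1r ler_pdivrMr ?exprn_gt0// mulrAC ler_pdivlMr ?mulr_gt0// mul1r.
rewrite -natrX -!natrM ler_nat; nia.
Qed.

Lemma nneseries_inv_sqr_lty (K : R) : 0 <= K ->
  (\sum_(n <oo) (K * n%:R ^- 2)%:E < +oo)%E.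
Proof.
move=> K0.
have term_ge0 n : (0 <= (K * n%:R ^- 2)%:E)%E.
  by rewrite lee_fin mulr_ge0// invr_ge0 exprn_ge0.
apply: (@le_lt_trans _ _ (K * 6)%:E); last exact: ltry.
apply: lime_le; first by apply: is_cvg_nneseries => n _ _; exact: term_ge0.
apply: nearW => n; rewrite sumEFin lee_fin -mulr_sumr ler_wpM2l//.
apply: le_trans (_ : 6 * \sum_(0 <= k < n) (k.+1%:R^-1 - k.+2%:R^-1) <= _).
  rewrite mulr_sumr; apply: ler_sum => k _; apply: le_trans (inv_sqr_le k) _.
  rewrite le_eqVlt; apply/orP; left; apply/eqP.
  rewrite -[k.+2%:R]natr1; field.
  have k0 : 0 <= k%:R :> R by [].
  by apply/andP; split; apply: lt0r_neq0; lra.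
rewrite (eq_bigr (fun k => - k.+2%:R^-1 - - k.+1%:R^-1)); last first.
  by move=> k _; rewrite opprK addrC.
rewrite (telescope_sumr (fun k => - k.+1%:R^-1))// invr1 opprK.
by rewrite -[leRHS]mulr1 ler_wpM2l// gerDr oppr_le0 invr_ge0.
Qed.

Lemma inv_sqr_integral_ae_cvg0 (f : nat -> Om -> R) (K : R) : 0 <= K ->
  (forall n, measurable_fun setT (f n)) -> (forall n w, 0 <= f n w) ->
  (forall n, (\int[P]_w (f n w)%:E <= (K * n%:R ^- 2)%:E)%E) ->
  {ae P, forall w, f n w @[n --> \oo] --> 0}.
Proof.
move=> K0 mf f0 fK; apply: (summable_integral_ae_cvg0 P f) => //; first exact: fK.
exact: nneseries_inv_sqr_lty.
Qed.

Lemma fourth_power_moment_ae_cvg0 (g : nat -> Om -> R) (K : R) : 0 <= K ->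
  (forall n, measurable_fun setT (g n)) ->
  (forall n, (0 < n)%N -> (\int[P]_w (g n w ^+ 2)%:E <= (K * n%:R ^+ 4)%:E)%E) ->
  {ae P, forall w, g n w / (n ^ 3)%:R @[n --> \oo] --> 0}.
Proof.
move=> K0 mg gK.
have mg2 n : measurable_fun setT (fun w => (g n w ^+ 2)%:E).
  by apply/measurable_EFinP; exact: measurable_funX.
have sqr0 : {ae P, forall w, (g n w / (n ^ 3)%:R) ^+ 2 @[n --> \oo] --> 0}.
  apply: (inv_sqr_integral_ae_cvg0 (fun n w => (g n w / (n ^ 3)%:R) ^+ 2) K K0).
  - move=> n; apply: measurable_funX; apply: measurable_funM => //.
  - by move=> n w; exact: sqr_ge0.
  - move=> n; under eq_integral do rewrite expr_div_n mulrC EFinM.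
    rewrite ge0_integralZl//; last first.
      by move=> w _; rewrite lee_fin sqr_ge0.
    have [->|n0] := posnP n.
      by rewrite exp0n// expr0n/= invr0 mul0e mulr0.
    apply: le_trans (_ : ((n ^ 3)%:R ^- 2)%:E * (K * n%:R ^+ 4)%:E <= _)%E.
      by rewrite lee_wpmul2l ?gK// lee_fin invr_ge0 sqr_ge0.
    rewrite -EFinM lee_fin natrX le_eqVlt; apply/orP; left; apply/eqP.
    by field; rewrite pnatr_eq0 -lt0n.
apply: filterS sqr0 => w /= /cvgrPdist_lt H; apply/cvgrPdist_lt => e e0.
have := H (e ^+ 2) (exprn_gt0 _ e0).
apply: filterS => n; rewrite !sub0r !normrN normrX => He.
by rewrite -(ltr_pXn2r (n := 2))// nnegrE ltW.
Qed.

End inverse_square.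

Lemma sqr_sum_le {R : realDomainType} n (x : 'I_n -> R) :
  (\sum_i x i) ^+ 2 <= n%:R * \sum_i x i ^+ 2.
Proof.
elim: n x => [|n IH] x; first by rewrite !big_ord0 expr0n mulr0.
have H0 := IH (fun i => x (lift ord0 i)).
rewrite !big_ord_recl.
set S := \sum_(i < n) x (lift ord0 i) in H0 *.
set V := \sum_(i < n) x (lift ord0 i) ^+ 2 in H0 *.
have cross : 2 * x ord0 * S <= n%:R * x ord0 ^+ 2 + V.
  have : 0 <= \sum_(i < n) (x ord0 - x (lift ord0 i)) ^+ 2.
    by apply: sumr_ge0 => i _; exact: sqr_ge0.
  have -> : \sum_(i < n) (x ord0 - x (lift ord0 i)) ^+ 2 =
      n%:R * x ord0 ^+ 2 + - (2 * x ord0) * S + V.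
    rewrite mulr_sumr mulr_natl -[X in _ *+ X]card_ord -sumr_const -!big_split.
    by apply: eq_bigr => i _; rewrite /=; ring.
  by lra.
rewrite -[n.+1%:R]natr1; lra.
Qed.

(** * Genealogy of a sequence of points that copy earlier values *)

Section genealogy.
Context {R : realType}.
Variables (T th z : nat -> R).

(* For nondecreasing T, the last index l < i with T l < T i + th i, or 0 if there is
   none. *)
Definition parent (i : nat) : nat := (\sum_(1 <= l < i) (T l < T i + th i)%R)%N.

(* The first argument is fuel. *)
Fixpoint lineage (n i : nat) : R :=
  if n is n'.+1 then
    if i == 0%N then 0 else lineage n' (parent i) + z i
  else 0.

Definition lineage_value (i : nat) : R := lineage i i.

Lemma parent_lt i : (0 < i)%N -> (parent i < i)%N.
Proof.
case: i => // i _; rewrite /parent ltnS.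
apply: leq_trans (_ : (\sum_(1 <= l < i.+1) 1 <= i)%N).
  by apply: leq_sum => l _; case: (_ < _)%R.
by rewrite sum_nat_const_nat subSS subn0 muln1.
Qed.

(** Parents strictly decrease, so fuel [i] is enough to reach 0 from [i]. *)
Lemma lineage_stable n i : (i <= n)%N -> lineage n i = lineage_value i.
Proof.
suff H m k p : (k <= m)%N -> (k <= p)%N -> lineage m k = lineage p k.
  by move=> le; exact: H.
elim: m k p => [|m IH] k p.
  by rewrite leqn0 => /eqP -> _; case: p.
case: p => [|p]; first by rewrite leqn0 => _ /eqP ->.
move=> km kp /=; case: eqP => // /eqP; rewrite -lt0n => k0.
have := parent_lt _ k0 => pk.
by rewrite (IH _ p)// -ltnS (leq_trans pk).
Qed.

Lemma lineage_valueE i : (0 < i)%N ->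
  lineage_value i = lineage_value (parent i) + z i.
Proof.
case: i => // i _; rewrite /lineage_value /= lineage_stable// -ltnS.
exact: parent_lt.
Qed.

(** The ancestors of [i] are distinct, so the value contains each mark at most once. *)
Lemma norm_lineage_value i : `|lineage_value i| <= \sum_(1 <= l < i.+1) `|z l|.
Proof.
elim/ltn_ind: i => -[|i] IH; first by rewrite big_geq// normr0.
rewrite lineage_valueE// big_nat_recr//=.
apply: le_trans (ler_normD _ _) _; rewrite lerD2r.
have pi := parent_lt _ (ltn0Sn i).
apply: le_trans (IH _ pi) _.
rewrite [leRHS](@big_cat_nat _ _ _ (parent i.+1).+1)//=.
by rewrite lerDl sumr_ge0.
Qed.

(** By monotonicity the indices counted by [parent] are exactly 1, ..., [l]; for [l = 0] none is
    counted. *)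
Lemma parent_eq i l : {homo T : a b / (a <= b)%N >-> a <= b} -> (l < i)%N ->
  T l < T i + th i -> T i + th i <= T l.+1 -> parent i = l.
Proof.
move=> ndT li lt1 le2; rewrite /parent (@big_cat_nat _ _ _ l.+1)//=.
rewrite [X in (X + _)%N](eq_big_nat _ _ (F2 := fun=> 1%N)); last first.
  move=> j /andP[_]; rewrite ltnS => jl.
  by rewrite (le_lt_trans (ndT _ _ jl)).
rewrite [X in (_ + X)%N](eq_big_nat _ _ (F2 := fun=> 0%N)); last first.
  by move=> j /andP[lj _]; rewrite ltNge (le_trans le2)// ndT.
by rewrite !sum_nat_const_nat muln0 addn0 subSS subn0 muln1.
Qed.

End genealogy.

(** * Deterministic paths: restarts, gaps and block increments *)

Section path.
Context {R : realType}.
Variables (N : R -> nat) (T th z : nat -> R).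

(** Indices are shifted by [N s]: the shifted index 0 is the common ancestor, of value 0 whatever
    the value of the path at that point. *)
Definition excursion_idx (s : R) (i : nat) : R :=
  lineage_value (fun k => T (N s + k)%N) (fun k => th (N s + k)%N)
    (fun k => z (N s + k)%N) i.

(* Value at time t of the process started from 0 at time s: a point that looks
   back before its first point after s copies the value 0. *)
Definition excursion (s t : R) : R := excursion_idx s (N t - N s).

Definition mark_sum (s t : R) : R := \sum_(1 <= i < (N t - N s).+1) `|z (N s + i)%N|.

Lemma norm_excursion s t : `|excursion s t| <= mark_sum s t.
Proof. exact: norm_lineage_value. Qed.

Lemma mark_sum_ge0 s t : 0 <= mark_sum s t.
Proof. exact: sumr_ge0. Qed.

Section mark_sum_additivity.
Hypothesis N_homo : forall s t, 0 <= s -> s <= t -> (N s <= N t)%N.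

Lemma mark_sumE s t : 0 <= s -> s <= t ->
  mark_sum s t = \sum_((N s).+1 <= k < (N t).+1) `|z k|.
Proof.
move=> s0 st; rewrite /mark_sum -[in RHS]add1n.
rewrite big_addn subSn ?N_homo//.
by apply: eq_bigr => i _; rewrite addnC.
Qed.

Lemma mark_sumD r s t : 0 <= r -> r <= s -> s <= t ->
  mark_sum r t = mark_sum r s + mark_sum s t.
Proof.
move=> r0 rs st; have s0 := le_trans r0 rs.
by rewrite !mark_sumE ?(le_trans rs)// -big_cat_nat// ltnS N_homo.
Qed.

Lemma mark_sum_le r t : 0 <= r ->
  {in `[r, t] &, forall s u, s <= u -> mark_sum s u <= mark_sum r t}.
Proof.
move=> r0 s u; rewrite !in_itv/= => /andP[rs st] /andP[ru ut] su.
rewrite (mark_sumD r s t)// (mark_sumD s u t)//; last exact: le_trans r0 rs.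
by have := mark_sum_ge0 r s; have := mark_sum_ge0 u t; lra.
Qed.

Lemma mark_sum_unit_intervals a n :
  mark_sum a%:R (a + n)%:R = \sum_(i < n) mark_sum (a + i)%:R (a + i.+1)%:R.
Proof.
elim: n => [|n IH].
  by rewrite big_ord0 addn0 /mark_sum subnn big_geq.
by rewrite big_ord_recr/= -IH -mark_sumD// ler_nat ?leq_addr// leq_add2l.
Qed.

End mark_sum_additivity.

Hypothesis T_ge0 : forall n, 0 <= T n.
Hypothesis galois : forall n t, 0 <= t -> (n <= N t)%N = (T n <= t).
Hypothesis th_range : forall n, (0 < n)%N -> -1 <= th n <= 0.

Lemma path_N_homo s t : 0 <= s -> s <= t -> (N s <= N t)%N.
Proof.
move=> s0 st; rewrite galois ?(le_trans s0)//; apply: le_trans st.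
by rewrite -galois.
Qed.

Lemma path_T_homo : {homo T : a b / (a <= b)%N >-> a <= b}.
Proof.
by move=> a b ab; rewrite -galois// (leq_trans ab)// galois.
Qed.

(* On ]T l, T (l + 1)] the left limit of the path is its value number l, which the
   point k copies when it looks back into that interval. *)
Definition reproduces (g : nat) (x : nat -> R) : Prop :=
  forall k l, (g <= l < k)%N -> T l < T k + th k -> T k + th k <= T l.+1 ->
    x k = x l + z k.

Lemma reproduces_weaken g g' x : (g <= g')%N ->
  reproduces g x -> reproduces g' x.
Proof.
by move=> gg' gx k l /andP[gl lk]; apply: gx; rewrite lk (leq_trans gg').
Qed.

(** A look-back that lands after point number [N s] finds the same parent in the shifted numbering,
    so the restarted process copies by the same rule as the path. *)
Lemma reproduces_excursion s : 0 <= s ->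
  reproduces (N s) (fun k => excursion_idx s (k - N s)).
Proof.
move=> s0 k l /andP[sl lk] lt1 le2.
have sk : (N s <= k)%N by rewrite (leq_trans sl)// ltnW.
rewrite /excursion_idx lineage_valueE ?subn_gt0 ?(leq_ltn_trans sl)//.
rewrite subnKC// (@parent_eq _ _ _ _ (l - N s))//.
- by move=> a b ab; apply: path_T_homo; rewrite leq_add2l.
- by rewrite ltn_sub2r// (leq_ltn_trans sl).
- by rewrite !subnKC.
- by rewrite addnS !subnKC.
Qed.

(** A point after [m] looks back to a time later than [m - 1], hence later than [T (N m)]. So both
    sequences copy a value with index at least [N m] and add the same mark, and the difference is
    carried on unchanged by induction. *)
Lemma reproduction_gap m x y : 1 <= m -> N m = N (m - 1) ->
  reproduces (N m) x -> reproduces (N m) y ->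
  forall k, (N m <= k)%N -> x k - y k = x (N m) - y (N m).
Proof.
move=> m1 gap rx ry; elim/ltn_ind => k IH.
rewrite leq_eqVlt => /predU1P[<-//|mk].
have k0 : (0 < k)%N by rewrite (leq_ltn_trans _ mk).
have /andP[th1 th0] := th_range _ k0.
have Tk : m < T k by rewrite ltNge -galois -?ltnNge//; lra.
have Tg : T (N m) <= m - 1 by rewrite -galois ?gap//; lra.
set tau := T k + th k.
have tauk : tau <= T k by rewrite gerDl.
have taum : T (N m) < tau.
  by apply: le_lt_trans Tg _; exact: ltr_leD.
have [l [/andP[gl lk] lt1 le2]] : exists l, [/\ (N m <= l < k)%N,
    T l < tau & tau <= T l.+1].
  suff H j : (N m < j)%N -> tau <= T j -> exists l, [/\ (N m <= l < j)%N,
      T l < tau & tau <= T l.+1] by exact: H.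
  elim: j => // j IHj; rewrite ltnS leq_eqVlt => /predU1P[<-|mj] le.
    by exists (N m); rewrite leqnn ltnSn.
  have [lej|ltj] := leP tau (T j); last first.
    by exists j; split => //; rewrite (ltnW mj) ltnSn.
  have [l [/andP[gl lj] ? ?]] := IHj mj lej.
  by exists l; rewrite gl (ltn_trans lj).
rewrite (rx k l) ?gl// (ry k l) ?gl// -(IH l)//.
by rewrite opprD addrACA subrr addr0.
Qed.

Lemma excursion_gap r s m t u : 0 <= r -> 0 <= s -> r <= m - 1 -> s <= m - 1 ->
  N m = N (m - 1) -> m <= t -> m <= u ->
  excursion r u - excursion r t = excursion s u - excursion s t.
Proof.
move=> r0 s0 rm sm gap mt mu.
have m1 : 1 <= m by rewrite -subr_ge0 (le_trans r0).
have m0 : 0 <= m by rewrite (le_trans _ m1).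
have rN : (N r <= N m)%N by rewrite gap path_N_homo.
have sN : (N s <= N m)%N by rewrite gap path_N_homo.
have H := reproduction_gap m _ _ m1 gap
  (reproduces_weaken _ _ _ rN (reproduces_excursion _ r0))
  (reproduces_weaken _ _ _ sN (reproduces_excursion _ s0)).
have := H (N t) (path_N_homo _ _ m0 mt); have := H (N u) (path_N_homo _ _ m0 mu).
by rewrite /excursion; lra.
Qed.

Section values.
Variables (x : R -> R) (y : nat -> R).
Hypothesis xy : forall t, 0 <= t -> x t = y (N t).
Hypothesis ry : reproduces 0 y.

Lemma value_gap s m t u : 0 <= s -> s <= m - 1 ->
  N m = N (m - 1) -> m <= t -> m <= u ->
  x u - x t = excursion s u - excursion s t.
Proof.
move=> s0 sm gap mt mu.
have m1 : 1 <= m by rewrite -subr_ge0 (le_trans s0).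
have m0 : 0 <= m by rewrite (le_trans _ m1).
have sN : (N s <= N m)%N by rewrite gap path_N_homo.
have H := reproduction_gap m _ _ m1 gap
  (reproduces_weaken _ _ _ (leq0n _) ry)
  (reproduces_weaken _ _ _ sN (reproduces_excursion _ s0)).
have := H (N t) (path_N_homo _ _ m0 mt); have := H (N u) (path_N_homo _ _ m0 mu).
by rewrite /excursion !xy ?(le_trans m0)//; lra.
Qed.

(* An interval ]m - 1, m] without arrivals: points after m have delays at most 1,
   hence cannot look back beyond m - 1. *)
Definition block_gap (n j : nat) : Prop :=
  exists2 m : nat, (j * n < m <= j.+1 * n)%N & N m%:R = N (m%:R - 1).

(** The restart takes place one block before the increment is measured, so that a gap in block [j]
    makes this the increment of the path over block [j + 1]. The formula itself refers to no gap. *)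
Definition block_increment (n j : nat) : R :=
  excursion (j * n)%:R (j.+2 * n)%:R - excursion (j * n)%:R (j.+1 * n)%:R.

(** The increments with j < n^2 - 1 telescope from time n to time n^3. The first block and the
    stretch from the last block to [t] are left to the mark sums. *)
Lemma value_block_increments n1 : (0 < n1)%N ->
  (forall n j, (n1 <= n)%N -> (j < n ^ 2)%N -> block_gap n j) ->
  exists c, forall n t, (n1 <= n)%N -> (n ^ 3)%:R <= t <= (n.+1 ^ 3)%:R ->
    `|x t - c - \sum_(j < (n ^ 2).-1) block_increment n j| <=
      mark_sum 0 n%:R + 2 * mark_sum ((n ^ 2).-1 * n)%:R (n.+1 ^ 3)%:R.
Proof.
move=> n10 gaps.
have pred_le (k m : nat) : (k < m)%N -> k%:R <= m%:R - 1 :> R.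
  by move=> km; rewrite lerBrDr natr1 ler_nat.
(* A gap before time n1 freezes the difference between the path and the process started from 0 at
   time 0, so one constant serves all n. *)
exists (x n1%:R - excursion 0 n1%:R) => n t nn1 /andP[nt tn].
have n0 : (0 < n)%N by exact: leq_trans nn1.
have n20 : (0 < n ^ 2)%N by rewrite expn_gt0 n0.
have n32 : (n ^ 3 = n ^ 2 * n)%N by rewrite expnSr.
have n1_gt0 : (0 < n1 ^ 2)%N by rewrite expn_gt0 n10.
have [m] := gaps n1 0%N (leqnn _) n1_gt0; rewrite mul0n mul1n.
move=> /andP[m0 mn1] gm.
have nn3 : (n <= n ^ 3)%N by rewrite n32 leq_pmull.
have mt : m%:R <= t.
  by apply: le_trans nt; rewrite ler_nat (leq_trans mn1)// (leq_trans nn1).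
have -> : x t - (x n1%:R - excursion 0 n1%:R) = excursion 0 t.
  have := value_gap 0 m%:R n1%:R t (lexx _) (pred_le 0%N m m0) gm.
  by rewrite ler_nat mn1 => /(_ isT mt); lra.
have n2_pred : ((n ^ 2).-1 < n ^ 2)%N by rewrite ltn_predL.
(* A gap in the last block before n^3 lets the move from n^3 to [t] be read off a restart at the
   beginning of that block, so that only later marks enter. *)
have [m'] := gaps n (n ^ 2).-1 nn1 n2_pred; rewrite prednK//.
move=> /andP[m'1 m'2] gm'.
have telescope : excursion 0 (n ^ 3)%:R =
    excursion 0 n%:R + \sum_(j < (n ^ 2).-1) block_increment n j.
  transitivity (excursion 0 n%:R + \sum_(0 <= j < (n ^ 2).-1)
      (excursion 0 (j.+2 * n)%:R - excursion 0 (j.+1 * n)%:R)).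
    rewrite (telescope_sumr (fun j => excursion 0 (j.+1 * n)%:R))//.
    by rewrite prednK// mul1n addrC subrK n32.
  rewrite big_mkord; congr (_ + _); apply: eq_bigr => j _.
  have jn2 : (j < n ^ 2)%N by rewrite (leq_trans (ltn_ord j))// leq_pred.
  have [k /andP[k1 k2] gk] := gaps n j nn1 jn2.
  apply: (excursion_gap _ _ k%:R) => //.
  - by apply: (pred_le 0%N); rewrite (leq_ltn_trans _ k1).
  - exact: pred_le.
  - by rewrite ler_nat.
  - by rewrite ler_nat (leq_trans k2)// leq_mul2r leqnSn orbT.
have last_block : excursion 0 t - excursion 0 (n ^ 3)%:R =
    excursion ((n ^ 2).-1 * n)%:R t - excursion ((n ^ 2).-1 * n)%:R (n ^ 3)%:R.
  apply: (excursion_gap _ _ m'%:R) => //.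
  - by apply: (pred_le 0%N); rewrite (leq_ltn_trans _ m'1).
  - exact: pred_le.
  - by rewrite ler_nat n32.
  - by apply: le_trans nt; rewrite ler_nat n32.
set s := ((n ^ 2).-1 * n)%:R in last_block *.
have sn3 : s <= (n ^ 3)%:R by rewrite ler_nat n32 leq_mul2r leq_pred orbT.
have s0 : 0 <= s by rewrite ler0n.
have le1 : `|excursion s t| <= mark_sum s (n.+1 ^ 3)%:R.
  apply: le_trans (norm_excursion _ _) _.
  by apply: (mark_sum_le path_N_homo) => //; rewrite ?in_itv/= ?lexx ?tn ?(le_trans sn3)//=;
    exact: le_trans tn.
have le2 : `|excursion s (n ^ 3)%:R| <= mark_sum s (n.+1 ^ 3)%:R.
  apply: le_trans (norm_excursion _ _) _.
  have n3S : (n ^ 3)%:R <= (n.+1 ^ 3)%:R :> R by rewrite ler_nat leq_exp2r.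
  by apply: (mark_sum_le path_N_homo) => //; rewrite ?in_itv/= ?lexx ?n3S ?(le_trans sn3).
have le3 := norm_excursion 0 n%:R.
have -> : excursion 0 t - \sum_(j < (n ^ 2).-1) block_increment n j =
    excursion 0 n%:R + (excursion s t - excursion s (n ^ 3)%:R) by lra.
apply: le_trans (ler_normD _ _) _.
have := ler_normB (excursion s t) (excursion s (n ^ 3)%:R).
by lra.
Qed.

End values.

End path.

(** * Interpolation between consecutive cubes *)

Section cubes.
Context {R : realType}.

Lemma between_cubes (n2 : nat) (t : R) : (n2 ^ 3)%:R <= t ->
  exists2 n : nat, (n2 <= n)%N & (n ^ 3)%:R <= t <= (n.+1 ^ 3)%:R.
Proof.
move=> n2t; have t0 : 0 <= t by rewrite (le_trans _ n2t).
pose p n := (n ^ 3)%:R <= t.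
have exp : exists n, p n by exists n2.
have ub n : p n -> (n <= (Num.truncn t).+1)%N.
  move=> pn; rewrite -(ler_nat R); apply: le_trans (_ : t <= _); last first.
    exact/ltW/truncnS_gt.
  apply: le_trans pn; rewrite ler_nat; case: n => // n.
  exact: (@leq_pexp2l n.+1 1 3).
have [n pn maxn] := ex_maxnP exp ub.
exists n; first exact: maxn.
rewrite (pn : (n ^ 3)%:R <= t)/= leNgt; apply/negP => /ltW /maxn.
by rewrite ltnn.
Qed.

(** Dividing by [t] instead of n^3 costs a factor between 1 - 3 / (n + 1) and 1, so the errors at
    the cube below [t] control the quotient. *)
Lemma cvg_between_cubes (x : R -> R) (c : R) (a M F : nat -> R) (K : R) (n1 : nat) :
  (forall n t, (n1 <= n)%N -> (n ^ 3)%:R <= t <= (n.+1 ^ 3)%:R ->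
     `|x t - c - a n| <= F n) ->
  (a n - M n) / (n ^ 3)%:R @[n --> \oo] --> 0 ->
  F n / (n ^ 3)%:R @[n --> \oo] --> 0 ->
  M n / (n ^ 3)%:R @[n --> \oo] --> K ->
  x t / t @[t --> +oo] --> K.
Proof.
move=> xF aM F0 MK.
(* One term each for the constant, the boundary sums, the fluctuation, the centring and the ratio
   n^3 / t. *)
pose b n := `|c| * n%:R^-1 + F n / (n ^ 3)%:R + `|(a n - M n) / (n ^ 3)%:R| +
  `|M n / (n ^ 3)%:R - K| + `|K| * (3 * n.+1%:R^-1).
have b0 : b n @[n --> \oo] --> 0.
  rewrite (_ : 0 = `|c| * 0 + 0 + `|0 : R| + `|K - K| + `|K| * (3 * 0)); last first.
    by rewrite subrr normr0 !mulr0 !addr0.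
  have inv0 : (n%:R : R)^-1 @[n --> \oo] --> 0.
    by rewrite -(cvg_shiftS (fun n => (n%:R : R)^-1)); exact: cvg_harmonic.
  have inv1 : (n.+1%:R : R)^-1 @[n --> \oo] --> 0.
    exact: cvg_harmonic.
  apply: cvgD; last by apply: cvgMr; apply: cvgMr.
  apply: cvgD; last by apply: cvg_norm; apply: cvgB => //; exact: cvg_cst.
  apply: cvgD; last exact: cvg_norm.
  by apply: cvgD => //; apply: cvgMr.
apply/cvgrPdist_lt => e e0.
have [n2 _ hn2] : \forall n \near \oo, b n < e.
  by move/cvgrPdist_lt : b0 => /(_ e e0); apply: filterS => n;
    rewrite sub0r normrN; exact: le_lt_trans (ler_norm _).
have : \forall t \near +oo, (((maxn n1 n2).+1) ^ 3)%:R <= t :> R.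
  exact: nbhs_pinfty_ge.
apply: filterS => t; move/between_cubes => [n]; rewrite gtn_max => /andP[nn1 nn2].
move=> /[dup] /andP[nt tn] tin.
have n0 : (0 < n)%N by exact: leq_trans nn1.
have n3_gt0 : 0 < (n ^ 3)%:R :> R by rewrite ltr0n expn_gt0 n0.
have t0 : 0 < t by exact: lt_le_trans nt.
apply: le_lt_trans (hn2 n (ltnW nn2)); rewrite /b.
have n1n : n%:R <= (n ^ 3)%:R :> R.
  by rewrite ler_nat; exact: (@leq_pexp2l n 1 3).
have nR : 0 < n%:R :> R by rewrite ltr0n.
have tV : t^-1 <= ((n ^ 3)%:R)^-1 by rewrite lef_pV2 ?posrE.
have cE : `|c| / t <= `|c| / n%:R.
  by rewrite ler_wpM2l// lef_pV2 ?posrE// (le_trans n1n).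
have F_ge0 : 0 <= F n by exact: le_trans (xF n t (ltnW nn1) tin).
have FE : F n / t <= F n / (n ^ 3)%:R by rewrite ler_wpM2l.
have aE : `|a n - M n| / t <= `|(a n - M n) / (n ^ 3)%:R|.
  by rewrite normrM ler_wpM2l// ger0_norm// invr_ge0 ltW.
have ratio : 0 <= 1 - (n ^ 3)%:R / t <= 3 / n.+1%:R.
  rewrite subr_ge0 ler_pdivrMr// mul1r nt/=.
  (* Bernoulli's inequality (1 - 1/N)^3 >= 1 - 3/N with N = n + 1, for t at most N^3; when N < 3 the
     right-hand side is negative. *)
  have nS3 : t * (3 / n.+1%:R) >= t - (n ^ 3)%:R.
    set N := n.+1%:R; have N0 : 0 < N :> R by rewrite ltr0n.
    have nE : (n ^ 3)%:R = (N - 1) ^+ 3 :> R.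
      by rewrite natrX /N -natr1 addrK.
    have tN : t <= N ^+ 3 by rewrite -natrX.
    rewrite mulrA ler_pdivlMr// nE mulrBl lerBlDr.
    have N1 : 0 <= N - 1 by rewrite /N -natr1 addrK.
    have [N3|N3] := leP 3 N.
      have := ler_wpM2r (ltac:(lra) : 0 <= N - 3) tN.
      have : 0 <= N * (3 * (N - 1) + 2) by apply: mulr_ge0; lra.
      by lra.
    have := mulr_ge0 (ltW t0) (ltac:(lra) : 0 <= 3 - N).
    have : 0 <= (N - 1) ^+ 3 * N by rewrite mulr_ge0 ?exprn_ge0// ltW.
    by lra.
  by rewrite -(ler_pM2l t0) mulrBr mulr1 mulrCA divff ?gt_eqF// mulr1.
have -> : K - x t / t = - (c / t) - (x t - c - a n) / t - (a n - M n) / t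
    - (M n / (n ^ 3)%:R - K) * ((n ^ 3)%:R / t) + K * (1 - (n ^ 3)%:R / t).
  by field; rewrite !gt_eqF.
have rt : `|(n ^ 3)%:R / t| <= 1.
  by rewrite ger0_norm ?ler_pdivrMr ?mul1r// divr_ge0// ltW.
have tV0 : `|t^-1| = t^-1 by rewrite ger0_norm// invr_ge0 ltW.
apply: le_trans (ler_normD _ _) _; apply: lerD; last first.
  rewrite normrM ler_wpM2l//; case/andP: ratio => r0.
  by rewrite ger0_norm.
apply: le_trans (ler_normB _ _) _; apply: lerD; last first.
  by rewrite normrM ler_piMr.
apply: le_trans (ler_normB _ _) _; apply: lerD; last first.
  by rewrite normrM tV0.
apply: le_trans (ler_normB _ _) _; apply: lerD; last first.
  apply: le_trans FE; rewrite normrM tV0 ler_wpM2r ?invr_ge0 ?(ltW t0)//.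
  exact: xF (ltnW nn1) tin.
by rewrite normrN normrM tV0.
Qed.

(** No limit of [M n] / n^3 is presupposed here: the statement serves to find that limit. *)
Lemma cvg_at_cubes (x : R -> R) (c : R) (a M F : nat -> R) (n1 : nat) :
  (forall n t, (n1 <= n)%N -> (n ^ 3)%:R <= t <= (n.+1 ^ 3)%:R ->
     `|x t - c - a n| <= F n) ->
  (a n - M n) / (n ^ 3)%:R @[n --> \oo] --> 0 ->
  F n / (n ^ 3)%:R @[n --> \oo] --> 0 ->
  x (n ^ 3)%:R / (n ^ 3)%:R - M n / (n ^ 3)%:R @[n --> \oo] --> 0.
Proof.
move=> xF aM F0; apply/cvgrPdist_lt => e e0.
have inv0 : (n%:R : R)^-1 @[n --> \oo] --> 0.
  by rewrite -(cvg_shiftS (fun n => (n%:R : R)^-1)); exact: cvg_harmonic.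
have : `|c| * n%:R^-1 + F n / (n ^ 3)%:R + `|(a n - M n) / (n ^ 3)%:R|
    @[n --> \oo] --> `|c| * 0 + 0 + `|0 : R|.
  by apply: cvgD; [apply: cvgD => //; apply: cvgMr|exact: cvg_norm].
rewrite mulr0 normr0 !addr0 => /cvgrPdist_lt /(_ e e0) H.
near=> n.
have n1n : (n1 <= n)%N by near: n; exact: nbhs_infty_ge.
have : `|0 - (`|c| * n%:R^-1 + F n / (n ^ 3)%:R + `|(a n - M n) / (n ^ 3)%:R|)| < e.
  by near: n.
rewrite !sub0r !normrN => /(le_lt_trans (ler_norm _)); apply: le_lt_trans.
have -> : x (n ^ 3)%:R / (n ^ 3)%:R - M n / (n ^ 3)%:R = c / (n ^ 3)%:R +
    (x (n ^ 3)%:R - c - a n) / (n ^ 3)%:R + (a n - M n) / (n ^ 3)%:R by ring.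
have inv_ge0 : 0 <= (n ^ 3)%:R^-1 :> R by rewrite invr_ge0.
apply: le_trans (ler_normD _ _) _; rewrite lerD2r.
apply: le_trans (ler_normD _ _) _; apply: lerD.
  rewrite normrM ler_wpM2l// ger0_norm//.
  have [->|n0] := posnP n; first by rewrite exp0n.
  rewrite lef_pV2 ?posrE ?ltr0n ?expn_gt0 ?n0// ler_nat.
  exact: (@leq_pexp2l n 1 3).
rewrite normrM [`|_^-1|]ger0_norm// ler_wpM2r//; apply: xF => //.
by rewrite lexx ler_nat leq_exp2r// leqnSn.
Unshelve. all: by end_near. Qed.

End cubes.

(** * Sample paths of the delayed process follow the genealogy *)

Lemma delayed_path_constant {R : realType} {n : nat} (U : R -> 'cV[R]_n)
    (Nt : R -> nat) (T : nat -> R) (Y : nat -> R * 'cV[R]_n) (x : R -> 'cV[R]_n) :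
  (forall k t, 0 <= t -> (k <= Nt t)%N = (T k <= t)) ->
  delayed_path U T Y x -> forall t, 0 <= t -> x t = x (T (Nt t)).
Proof.
move=> galois [_ cst_x _] t t0; apply: cst_x; first by rewrite -galois.
by rewrite ltNge -galois// ltnn.
Qed.

(** The left limit is taken at a time of ]T l, T (l + 1)], just before which the path is constant.
    Look-backs into the initial data fall outside [reproduces]. *)
Lemma delayed_path_reproduces {R : realType} {n : nat} (U : R -> 'cV[R]_n)
    (T : nat -> R) (Y : nat -> R * 'cV[R]_n) (x : R -> 'cV[R]_n) (i : 'I_n) :
  delayed_path U T Y x ->
  reproduces T (fun k => (Y k).1) (fun k => (Y k).2 i 0) 0 (fun k => x (T k) i 0).
Proof.
move=> [_ cst_x jump] [//|k] l /andP[_ lk] lt1 le2.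
rewrite jump mxE; congr (fun_of_matrix _ i 0 + _).
apply: cvg_lim; first exact: norm_hausdorff.
apply: cvg_near_cst; near=> s.
apply: cst_x; first by near: s; exact: nbhs_left_ge.
by apply: lt_le_trans le2; near: s; exact: nbhs_left_lt.
Unshelve. all: by end_near. Qed.

(** * Measurability of the genealogy *)

Section measurable_genealogy.
Context {d} {S : measurableType d} {R : realType}.
Variable D : set S.

Lemma measurable_count_true (b : nat -> S -> bool) m k :
  (forall l, (m <= l < k)%N -> measurable_fun D (b l)) ->
  measurable_fun D (fun w => \sum_(m <= l < k) (b l w : nat))%N.
Proof.
have [km|mk] := leqP k m.
  move=> _; apply: (eq_measurable_fun (cst 0%N : S -> nat)) => [w _|]; last first.
    exact: measurable_cst.
  by rewrite big_geq.
elim: k mk => // k IH; rewrite ltnS => mk mb.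
apply: (eq_measurable_fun
  (fun w => \sum_(m <= l < k) (b l w : nat) + b k w)%N) => [w _|].
  by rewrite big_nat_recr.
apply: measurable_fun_addn.
  move: mk; rewrite leq_eqVlt => /predU1P[<-|mk].
    apply: (eq_measurable_fun (cst 0%N : S -> nat)) => [w _|]; last first.
      exact: measurable_cst.
    by rewrite big_geq.
  by apply: IH => // l /andP[ml lk]; apply: mb; rewrite ml/= ltnW.
apply: (@measurableT_comp _ _ _ _ _ _ (nat_of_bool)) => //.
by apply: mb; rewrite mk/=.
Qed.

(** With finitely many values of the index, the composite is a finite sum of indicators times the
    [f l]. The domain [D] will fix the number of points in a window, which bounds the index. *)
Lemma measurable_fun_index (K : S -> nat) (f : nat -> S -> R) k :
  measurable_fun D K -> (forall l, (l <= k)%N -> measurable_fun D (f l)) ->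
  (forall w, D w -> (K w <= k)%N) -> measurable_fun D (fun w => f (K w) w).
Proof.
move=> mK mf Kk.
apply: (eq_measurable_fun
  (fun w => \sum_(l < k.+1) (K w == l :> nat)%:R * f l w)) => [w|].
  rewrite inE => /Kk; rewrite -ltnS => Kw.
  rewrite (bigD1 (Ordinal Kw))//= eqxx mul1r big1 ?addr0// => i.
  by rewrite -val_eqE/= eq_sym => /negbTE ->; rewrite mul0r.
apply: measurable_sum => l; apply: measurable_funM; last first.
  by apply: mf; rewrite -ltnS.
exact: (@measurableT_comp _ _ _ _ _ _ (fun n : nat => (n == l)%:R : R)).
Qed.

Variables (t_ th_ z_ : nat -> S -> R) (k : nat).
Hypothesis mt : forall j, (0 < j <= k)%N -> measurable_fun D (t_ j).
Hypothesis mth : forall j, (0 < j <= k)%N -> measurable_fun D (th_ j).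
Hypothesis mz : forall j, (0 < j <= k)%N -> measurable_fun D (z_ j).

Lemma measurable_parent i : (i <= k)%N ->
  measurable_fun D (fun w => parent (t_ ^~ w) (th_ ^~ w) i).
Proof.
move=> ik; apply: measurable_count_true => l /andP[l0 li].
have i0 : (0 < i)%N by exact: leq_ltn_trans li.
apply: measurable_fun_ltr; first by apply: mt; rewrite l0 (leq_trans (ltnW li)).
by apply: measurable_funD; [apply: mt|apply: mth]; rewrite i0.
Qed.

Lemma measurable_lineage n i : (i <= k)%N ->
  measurable_fun D (fun w => lineage (t_ ^~ w) (th_ ^~ w) (z_ ^~ w) n i).
Proof.
elim: n i => [|n IH] i ik /=; first exact: measurable_cst.
case: eqP => [_|/eqP]; first exact: measurable_cst.
rewrite -lt0n => i0; apply: measurable_funD; last by apply: mz; rewrite i0.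
apply: (measurable_fun_index _
  (fun j w => lineage (t_ ^~ w) (th_ ^~ w) (z_ ^~ w) n j) k) => //.
  exact: measurable_parent.
by move=> w _; rewrite (leq_trans _ ik)// ltnW// parent_lt.
Qed.

End measurable_genealogy.

(** * Square-integrable variables and the variance of one-dependent sums *)

Section square_integrable.
Context {d} {Om : measurableType d} {R : realType} (P : probability Om R).
Local Notation E f := (Rintegral P setT f).

Definition square_integrable (f : Om -> R) : Prop :=
  measurable_fun setT f /\ P.-integrable setT (fun w => (f w ^+ 2)%:E).

Lemma square_integrableM f g : square_integrable f -> square_integrable g ->
  P.-integrable setT (fun w => (f w * g w)%:E).
Proof.
move=> [mf if2] [mg ig2].
apply: (@le_integrable _ _ _ P setT measurableT _
  (fun w => (f w ^+ 2)%:E + (g w ^+ 2)%:E)%E).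
- by apply/measurable_EFinP; exact: measurable_funM.
- move=> w _; rewrite /= lee_fin normrM [leRHS]ger0_norm ?addr_ge0 ?sqr_ge0//.
  rewrite -[f w ^+ 2]real_normK ?num_real// -[g w ^+ 2]real_normK ?num_real//.
  by have := sqr_ge0 (`|f w| - `|g w|); have := sqr_ge0 (`|f w| + `|g w|); nra.
- exact: integrableD.
Qed.

Lemma square_integrable_cst c : square_integrable (cst c).
Proof.
split; first exact: measurable_cst.
exact: (finite_measure_integrable_cst P (c ^+ 2)).
Qed.

Lemma square_integrable_integrable f :
  square_integrable f -> P.-integrable setT (EFin \o f).
Proof.
move=> sf; have := square_integrableM _ _ sf (square_integrable_cst 1).
by apply: eq_integrable => // w _; rewrite /= mulr1.
Qed.

Lemma square_integrableD f g : square_integrable f -> square_integrable g ->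
  square_integrable (fun w => f w + g w).
Proof.
move=> sf sg; split; first by apply: measurable_funD; [case: sf|case: sg].
have := integrableD measurableT (integrableD measurableT sf.2 sg.2)
  (integrableZl measurableT 2 (square_integrableM _ _ sf sg)).
by apply: eq_integrable => // w _; rewrite /= -EFinM -!EFinD; congr _%:E; ring.
Qed.

Lemma square_integrable_sum (I : Type) (r : seq I) (f : I -> Om -> R) :
  (forall i, square_integrable (f i)) ->
  square_integrable (fun w => \sum_(i <- r) f i w).
Proof.
move=> sf; elim: r => [|i r IH].
  rewrite [X in square_integrable X](_ : _ = cst 0).
    exact: square_integrable_cst.
  by apply/funext => w; rewrite big_nil.
rewrite [X in square_integrable X](_ : _ = fun w => f i w + \sum_(j <- r) f j w).
  exact: square_integrableD.
by apply/funext => w; rewrite big_cons.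
Qed.

Definition centred (f : Om -> R) (w : Om) : R := f w - E f.

Lemma square_integrable_centred f :
  square_integrable f -> square_integrable (centred f).
Proof.
move=> sf; apply: (square_integrableD f (cst (- E f))) => //.
exact: square_integrable_cst.
Qed.

Lemma expectation_cst_R (c : R) : Rintegral P setT (fun=> c) = c.
Proof.
rewrite /Rintegral -[X in fine X]/(integral P setT (cst c%:E)) integral_cst//.
by rewrite [X in (_ * X)%E](probability_setT P) mule1.
Qed.

Lemma expectation_centred f : square_integrable f -> E (centred f) = 0.
Proof.
move=> sf; rewrite RintegralB//; last 2 first.
- exact: square_integrable_integrable.
- exact: finite_measure_integrable_cst.
by rewrite expectation_cst_R subrr.
Qed.

Lemma centred_second_moment f : square_integrable f ->
  E (fun w => centred f w ^+ 2) <= E (fun w => f w ^+ 2).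
Proof.
move=> sf; set m := E f.
have i1 : P.-integrable setT (EFin \o (fun w => f w ^+ 2)) := sf.2.
have i2 := integrableZl measurableT (2 * m) (square_integrable_integrable f sf).
have i3 : P.-integrable setT (EFin \o cst (m ^+ 2)).
  exact: finite_measure_integrable_cst.
have -> : E (fun w => centred f w ^+ 2) =
    E (fun w => f w ^+ 2 - 2 * m * f w + m ^+ 2).
  by apply: eq_Rintegral => w _; rewrite /centred -/m; ring.
have iB : P.-integrable setT (EFin \o (fun w => f w ^+ 2 - 2 * m * f w)).
  exact: (integrableB measurableT i1 i2).
rewrite RintegralD//.
rewrite RintegralB// RintegralZl//; last exact: square_integrable_integrable.
by rewrite expectation_cst_R -/m; have := sqr_ge0 m; nra.
Qed.

Lemma expectation_mul_le f g B : square_integrable f -> square_integrable g ->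
  E (fun w => f w ^+ 2) <= B -> E (fun w => g w ^+ 2) <= B ->
  E (fun w => f w * g w) <= B.
Proof.
move=> sf sg fB gB.
have iD : P.-integrable setT (EFin \o (fun w => f w ^+ 2 + g w ^+ 2)).
  exact: (integrableD measurableT sf.2 sg.2).
apply: le_trans (_ : E (fun w => 2^-1 * (f w ^+ 2 + g w ^+ 2)) <= _).
  apply: le_Rintegral => //; first exact: square_integrableM.
    exact: (integrableZl measurableT 2^-1 iD).
  by move=> w _; have := sqr_ge0 (f w - g w); nra.
rewrite RintegralZl//.
have -> : E (fun w => f w ^+ 2 + g w ^+ 2) =
    E (fun w => f w ^+ 2) + E (fun w => g w ^+ 2).
  by apply: RintegralD => //; [exact: sf.2|exact: sg.2].
by lra.
Qed.

Definition independent_functions (f g : Om -> R) : Prop :=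
  forall A B, measurable A -> measurable B ->
    P (f @^-1` A `&` g @^-1` B) = (P (f @^-1` A) * P (g @^-1` B))%E.

Lemma expectation_centred_mul f g : square_integrable f -> square_integrable g ->
  independent_functions f g -> E (fun w => centred f w * centred g w) = 0.
Proof.
move=> sf sg fg.
have scf := square_integrable_centred _ sf.
have scg := square_integrable_centred _ sg.
have shift (h : Om -> R) A : centred h @^-1` A = h @^-1` ((fun x => x - E h) @^-1` A).
  by [].
have mshift (c : R) (A : set R) : measurable A -> measurable ((fun x => x - c) @^-1` A).
  move=> mA; rewrite -[X in measurable X]setTI.
  have mf : measurable_fun setT (fun x : R => x - c).
    by apply: measurable_funB; [exact: measurable_id|exact: measurable_cst].
  exact: (mf measurableT A mA).
have -> : E (fun w => centred f w * centred g w) = E (centred f) * E (centred g).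
  rewrite /Rintegral expectation_indep; first 1 last.
  - exact: square_integrable_integrable.
  - exact: square_integrable_integrable.
  - by move=> A B mA mB; rewrite !shift; apply: fg; exact: mshift.
  by rewrite fineM//; apply: integrable_fin_num => //;
    exact: square_integrable_integrable.
by rewrite expectation_centred// mul0r.
Qed.

(* Cauchy-Schwarz bounds the covariances of neighbours, all others vanish. *)
Lemma one_dependent_variance (xi : nat -> Om -> R) (B : R) (J : nat) :
  (forall j, square_integrable (xi j)) ->
  (forall j, E (fun w => xi j w ^+ 2) <= B) ->
  (forall j l, (j.+1 < l)%N -> independent_functions (xi j) (xi l)) ->
  E (fun w => (\sum_(j < J) centred (xi j) w) ^+ 2) <= 3 * B * J%:R.
Proof.
move=> sxi xiB ind.
have scxi j := square_integrable_centred _ (sxi j).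
have cB j : E (fun w => centred (xi j) w ^+ 2) <= B.
  exact: le_trans (centred_second_moment _ (sxi j)) (xiB j).
have B0 : 0 <= B.
  by apply: le_trans (xiB 0%N); apply: Rintegral_ge0 => w _; exact: sqr_ge0.
have ssum n : square_integrable (fun w => \sum_(j < n) centred (xi j) w).
  exact: square_integrable_sum.
have isx n l : P.-integrable setT
    (EFin \o (fun w => (\sum_(j < n) centred (xi j) w) * centred (xi l) w)).
  exact: (square_integrableM _ _ (ssum n) (scxi l)).
have ixx n l : P.-integrable setT
    (EFin \o (fun w => centred (xi n) w * centred (xi l) w)).
  exact: (square_integrableM _ _ (scxi n) (scxi l)).
elim: J => [|J IH].
  by under eq_Rintegral do rewrite big_ord0 expr0n/=; rewrite mulr0 expectation_cst_R.
have cross : E (fun w => (\sum_(j < J) centred (xi j) w) * centred (xi J) w) <= B.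
  case: J {IH} => [|J].
    under eq_Rintegral do rewrite big_ord0 mul0r.
    by rewrite expectation_cst_R.
  under eq_Rintegral do rewrite big_ord_recr/= mulrDl.
  rewrite RintegralD//; last exact: isx.
  rewrite -[leRHS]add0r lerD//; last exact: expectation_mul_le.
  suff H m : (m <= J)%N ->
      E (fun w => (\sum_(j < m) centred (xi j) w) * centred (xi J.+1) w) = 0.
    by rewrite H.
  elim: m => [|m IHm] mJ.
    under eq_Rintegral do rewrite big_ord0 mul0r.
    by rewrite expectation_cst_R.
  under eq_Rintegral do rewrite big_ord_recr/= mulrDl.
  rewrite RintegralD//; last exact: isx.
  by rewrite IHm ?(ltnW mJ)// expectation_centred_mul ?addr0//; exact: ind.
(* Origin of the constant 3: a new term adds its own second moment and twice its covariance with the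
   preceding sum, each covariance being at most B. *)
have -> : E (fun w => (\sum_(j < J.+1) centred (xi j) w) ^+ 2) =
    E (fun w => (\sum_(j < J) centred (xi j) w) ^+ 2 +
      2 * ((\sum_(j < J) centred (xi j) w) * centred (xi J) w) +
      centred (xi J) w ^+ 2).
  by apply: eq_Rintegral => w _; rewrite big_ord_recr/=; ring.
have i2 := isx J J.
have i2' : P.-integrable setT
    (EFin \o (fun w => 2 * ((\sum_(j < J) centred (xi j) w) * centred (xi J) w))).
  exact: (integrableZl measurableT 2 i2).
have i1 : P.-integrable setT
    (EFin \o (fun w => (\sum_(j < J) centred (xi j) w) ^+ 2)) := (ssum J).2.
have i3 : P.-integrable setT (EFin \o (fun w => centred (xi J) w ^+ 2)) :=
  (scxi J).2.
rewrite RintegralD//; last exact: (integrableD measurableT i1 i2').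
rewrite RintegralD// RintegralZl//.
by rewrite -[J.+1%:R]natr1 mulrDr mulr1; have := cB J; lra.
Qed.

End square_integrable.

(** * Arrival times and independent increments of the counting process *)

Section increments.
Context {d} {Om : measurableType d} {R : realType} (P : probability Om R).
Variables (lam : R -> R) (Nt : R -> {RV P >-> nat}).
Hypothesis HN : poisson_process lam Nt.

Lemma poisson_homo w s t : 0 <= s -> s <= t -> (Nt s w <= Nt t w)%N.
Proof. by case: HN => _ + _ _ _; exact. Qed.

Lemma arrival_ge0 n w : 0 <= arrival Nt n w.
Proof.
case: n => [//|n] /=; set A := [set t | _].
have [->|A0] := eqVneq A set0; first by rewrite inf0.
by apply: lb_le_inf; [exact/set0P|move=> t []].
Qed.

Lemma arrival_le n t w : 0 <= t -> (n <= Nt t w)%N -> arrival Nt n w <= t.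
Proof.
move=> t0; case: n => [//|n] nt /=.
by apply: ge_inf => //; exists 0 => u [].
Qed.

(** Right-continuity makes the infimum a minimum. The witness [u] keeps the set nonempty; otherwise
    [arrival] would take the default value 0. *)
Lemma arrival_galois n u t w : 0 <= u -> (n <= Nt u w)%N -> 0 <= t ->
  (n <= Nt t w)%N = (arrival Nt n w <= t).
Proof.
move=> u0 nu t0; apply/idP/idP; first exact: arrival_le.
case: n nu => [//|n] nu /= Tt; set A := [set t | _] in Tt.
have infA : has_inf A by split; [exists u|exists 0 => x []].
have a0 : 0 <= inf A by apply: lb_le_inf; [exists u|move=> x []].
suff : (n < Nt (inf A) w)%N by move=> /leq_trans; apply; exact: poisson_homo.
case: HN => _ _ /(_ w _ a0) rc _ _.
have [e /= e0 eN] := rc.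
have [x [x0 nx] xe] := inf_adherent e0 infA.
have : inf A <= x by apply: ge_inf => //; exists 0 => ? [].
rewrite le_eqVlt => /predU1P[->//|ax].
rewrite -(eN x)//= ltr0_norm ?subr_lt0//; lra.
Qed.

(** Lists of times with sets, rather than indexed families, so that constraints on successive
    windows are joined by concatenation. *)
Fixpoint chain (N : R -> nat) (s : R) (L : seq (R * set nat)) : Prop :=
  if L is (r, B) :: L' then B (N r - N s)%N /\ chain N r L' else True.

Fixpoint chain_prob (s : R) (L : seq (R * set nat)) : \bar R :=
  if L is (r, B) :: L' then
    (P [set w | B (Nt r w - Nt s w)%N] * chain_prob r L')%E
  else 1%E.

Lemma chain_nth (N : R -> nat) x0 s L :
  chain N s L <-> forall i, (i < size L)%N ->
    (nth (0%R, setT) L i).2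
      (N (nth x0 (s :: map fst L) i.+1) - N (nth x0 (s :: map fst L) i))%N.
Proof.
elim: L s => [|[r B] L IH] s /=; first by split.
split=> [[Bs cL] [//|i] iL|H]; first exact: (IH r).1.
by split; [exact: (H 0%N)|apply/IH => i iL; exact: (H i.+1)].
Qed.

Lemma chain_prob_nth x0 s L : (chain_prob s L = \prod_(i < size L)
  P [set w | (nth (0%R, setT) L i).2 (Nt (nth x0 (s :: map fst L) i.+1) w -
     Nt (nth x0 (s :: map fst L) i) w)%N])%E.
Proof.
elim: L s => [|[r B] L IH] s; first by rewrite big_ord0.
by rewrite big_ord_recl/= IH.
Qed.

Lemma probability_chain s L : 0 <= s -> path <=%R s (map fst L) ->
  P [set w | chain (Nt ^~ w) s L] = chain_prob s L.
Proof.
(* The independence of increments is stated for infinite nondecreasing sequences of times: the list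
   is continued by its last time. *)
move=> s0 sL; set x0 := last s (map fst L).
have t_homo i : nth x0 (s :: map fst L) i <= nth x0 (s :: map fst L) i.+1.
  have [iL|Li] := ltnP i (size L).
    by apply: (pathP x0 sL); rewrite size_map.
  rewrite [leRHS]nth_default/= ?size_map//.
  have [->|iL] := eqVneq i (size L).
    by rewrite -(size_map fst) -last_nth.
  by rewrite nth_default//= size_map ltn_neqAle eq_sym iL.
case: HN => _ _ _ /(_ (size L) (fun i => nth x0 (s :: map fst L) i)
  (fun i => (nth (0%R, setT) L i).2) s0 t_homo) indep _.
rewrite (chain_prob_nth x0) -indep; congr (P _).
apply/seteqP; split => w /=.
  by move=> /(chain_nth _ x0) H i /= iL; exact: H.
by move=> H; apply/(chain_nth _ x0).
Qed.

Lemma chain_cat (N : R -> nat) s L L' :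
  chain N s (L ++ L') <-> chain N s L /\ chain N (last s (map fst L)) L'.
Proof.
elim: L s => [|[r B] L IH] s /=; first by split => [|[]].
by rewrite IH; split => [[? []]|[[]]].
Qed.

Lemma chain_prob_cat s L L' : chain_prob s (L ++ L') =
  (chain_prob s L * chain_prob (last s (map fst L)) L')%E.
Proof.
by elim: L s => [|[r B] L IH] s /=; rewrite ?mul1e// IH muleA.
Qed.

(* Turns prescribed counts at increasing times into prescribed increments, the
   only events whose probabilities are given. *)
Fixpoint count_chain (c : nat) (L : seq (R * nat)) : seq (R * set nat) :=
  if L is (r, k) :: L' then
    (r, [set n | (c + n)%N = k]) :: count_chain k L' else [::].

Lemma map_fst_count_chain c L : map fst (count_chain c L) = map fst L.
Proof. by elim: L c => [|[r k] L IH] c //=; rewrite IH. Qed.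

Lemma count_chainP (N : R -> nat) s s0 c (L : seq (R * nat)) :
  {in [pred x | 0 <= x] &, {homo N : x y / x <= y >-> (x <= y)%N}} ->
  0 <= s -> s <= s0 -> c = (N s0 - N s)%N -> path <=%R s0 (map fst L) ->
  (forall p, p \in L -> (N p.1 - N s)%N = p.2) <-> chain N s0 (count_chain c L).
Proof.
move=> ndN s_ge0; elim: L s0 c => [|[r k] L IH] s0 c ss0 cE /=; first by split.
move=> /andP[s0r rL].
have sr := le_trans ss0 s0r.
have NN : (N s <= N s0 <= N r)%N.
  by rewrite !ndN// inE ?(le_trans s_ge0).
have rE : (N r - N s = c + (N r - N s0))%N by lia.
split => [H|[kE /IH H] p].
  have kE := H (r, k) (mem_head _ _); rewrite /= in kE.
  split; first by rewrite /= -rE.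
  by apply/(IH r) => // p pL; apply: H; rewrite inE pL orbT.
rewrite inE => /predU1P[->/=|]; first by rewrite rE.
by apply: H => //; rewrite rE.
Qed.

Definition count_event (s : R) (L : seq (R * nat)) : set Om :=
  [set w | forall p, p \in L -> (Nt p.1 w - Nt s w)%N = p.2].

(** Counts are relative to [s] and the times come in any order, so that an intersection of two such
    events is given by the concatenated list. *)
Definition count_system (s t : R) : set (set Om) :=
  [set A | exists2 L : seq (R * nat),
     all (fun p => s <= p.1 <= t) L & A = count_event s L].

Lemma count_system_setI s t : setI_closed (count_system s t).
Proof.
move=> _ _ [L hL ->] [L' hL' ->]; exists (L ++ L'); first by rewrite all_cat hL.
apply/seteqP; split => w /=.
  by move=> [H H'] p; rewrite mem_cat => /orP[/H|/H'].
by move=> H; split => p pL; apply: H; rewrite mem_cat pL ?orbT.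
Qed.

Lemma measurable_increment s t : measurable_fun setT (fun w => Nt t w - Nt s w)%N.
Proof. exact: measurable_fun_subn. Qed.

Lemma measurable_count_event s L : measurable (count_event s L).
Proof.
elim: L => [|p L IH].
  by rewrite (_ : count_event _ _ = setT)//; apply/seteqP; split.
rewrite (_ : count_event _ _ =
    (fun w => Nt p.1 w - Nt s w)%N @^-1` [set p.2] `&` count_event s L).
  apply: measurableI => //.
  by rewrite -[X in measurable X]setTI; exact: measurable_increment.
apply/seteqP; split => w /=.
  by move=> H; split => [|q qL]; apply: H; rewrite inE ?eqxx ?qL ?orbT.
by move=> [pE H] q; rewrite inE => /predU1P[->//|/H].
Qed.

Lemma count_system_measurable s t : count_system s t `<=` measurable.
Proof. by move=> _ [L _ ->]; exact: measurable_count_event. Qed.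

(** Sorting the times turns prescribed counts into prescribed increments; a repeated time gives an
    increment over an interval of length 0. *)
Lemma count_event_chain s t L : 0 <= s -> s <= t ->
  all (fun p => s <= p.1 <= t) L ->
  exists L', [/\ count_event s L = [set w | chain (Nt ^~ w) s L'],
    path <=%R s (map fst L') & last s (map fst L') <= t].
Proof.
move=> s0 st hL.
set le1 := relpre (@fst R nat) <=%R.
pose K := sort le1 L.
have hK : all (fun p => s <= p.1 <= t) K by rewrite all_sort.
have sK : path <=%R s (map fst K).
  rewrite path_min_sorted.
    by rewrite sorted_map; apply: sort_sorted => x y; exact: le_total.
  by rewrite all_map; apply: sub_all hK => p /andP[].
exists (count_chain 0 K); rewrite map_fst_count_chain; split => //.
  apply/seteqP; split => w /=.
    move=> H; apply/(count_chainP (Nt ^~ w) s s); rewrite ?subnn//.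
      by move=> x y /= x0 _; exact: poisson_homo.
    by move=> p; rewrite mem_sort => /H.
  move=> /(count_chainP (Nt ^~ w) s s) H p pL; apply: H; rewrite ?subnn ?mem_sort//.
  by move=> x y /= x0 _; exact: poisson_homo.
have : last s (map fst K) \in s :: map fst K by exact: mem_last.
by rewrite inE => /predU1P[->//|/mapP[p /(allP hK)/andP[_ ?] ->]].
Qed.

Lemma independent_counts s t s' t' : 0 <= s -> s <= t -> t <= s' -> s' <= t' ->
  independent_sigma P <<s count_system s t >> <<s count_system s' t' >>.
Proof.
move=> s0 st ts' s't'.
have s'0 : 0 <= s' by lra.
apply: independent_sigma_pi; [exact: count_system_setI|exact: count_system_setI|
  exact: count_system_measurable|exact: count_system_measurable|].
move=> _ _ [L hL ->] [L' hL' ->].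
have [K [-> sK Kt]] := count_event_chain _ _ _ s0 st hL.
have [K' [-> sK' _]] := count_event_chain _ _ _ s'0 s't' hL'.
rewrite !probability_chain//.
(* The pair [(s', setT)] inserts an unconstrained increment, of probability 1, between the two
   windows. *)
have -> : [set w | chain (Nt ^~ w) s K] `&` [set w | chain (Nt ^~ w) s' K'] =
    [set w | chain (Nt ^~ w) s (K ++ (s', setT) :: K')].
  by apply/seteqP; split => w /=; rewrite chain_cat/=; [case|case=> ? []].
rewrite probability_chain//; last first.
  by rewrite map_cat cat_path sK/= sK' (le_trans Kt).
rewrite chain_prob_cat/= [X in (_ * (X * _))%E](_ : _ = 1%E) ?mul1e//.
by rewrite -(probability_setT P); congr (P _); apply/seteqP; split.
Qed.

End increments.

(** * Poisson estimates uniform in the rate *)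

Section poisson_estimates.
Context {R : realType}.

(** Dropping the factor e^-r leaves a bound monotone in the rate. For r = 0 the law is the Dirac
    mass at 0. *)
Lemma poisson_pmf_le_rate (r C : R) k : 0 <= r -> r <= C ->
  (poisson_prob r 0 [set k] <= (C ^+ k / k`!%:R)%:E)%E.
Proof.
move=> r0 rC; have C0 : 0 <= C by exact: le_trans rC.
rewrite /poisson_prob; case: ifPn => [rgt0|].
  rewrite esum_set1; last by rewrite lee_fin poisson_pmf_ge0.
  rewrite lee_fin /poisson_pmf rgt0.
  apply: le_trans (_ : r ^+ k / k`!%:R <= _).
    rewrite ler_piMr ?divr_ge0 ?exprn_ge0//.
    by rewrite -[leRHS]expR0 ler_expR oppr_le0.
  by rewrite ler_wpM2r// ?invr_ge0// lerXn2r// nnegrE.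
move=> _; rewrite diracE; have [->|k0] := eqVneq k 0%N.
  by rewrite fact0 expr0 divr1 mem_set.
by rewrite memNset ?lee_fin ?divr_ge0 ?exprn_ge0// => /= /esym; exact/eqP.
Qed.

Lemma poisson_prob0_ge (r C : R) : 0 <= r -> r <= C ->
  ((expR (- C))%:E <= poisson_prob r 0 [set 0%N])%E.
Proof.
move=> r0 rC; rewrite /poisson_prob; case: ifPn => [rgt0|_].
  rewrite esum_set1; last by rewrite lee_fin poisson_pmf_ge0.
  by rewrite lee_fin /poisson_pmf rgt0 expr0 fact0 divr1 mul1r ler_expR lerN2.
rewrite diracE mem_set// lee_fin -[leRHS]expR0 ler_expR oppr_le0.
exact: le_trans rC.
Qed.

Lemma expR_ge_monomial (r : R) k : 0 <= r -> r ^+ k / k`!%:R <= expR r.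
Proof.
move=> r0; rewrite -[leRHS]/(limn (series (exp_coeff r))).
have cs := is_cvg_series_exp_coeff r.
apply: le_trans (_ : series (exp_coeff r) k.+1 <= _); last first.
  apply: nondecreasing_cvgn_le => //.
  by apply/nondecreasing_seqP => n; rewrite seriesSr lerDl exp_coeff_ge0.
rewrite seriesSr /exp_coeff/= lerDr /series/=.
by apply: sumr_ge0 => i _; rewrite divr_ge0// exprn_ge0.
Qed.

(** From e^r >= r^(i+1) / (i+1)! the mass at i is at most (i + 1) / r, hence at most n / c for each
    of the n values. *)
Lemma poisson_prob_lt (r c : R) n : 0 < c -> c <= r ->
  (poisson_prob r 0 `I_n <= ((n ^ 2)%:R / c)%:E)%E.
Proof.
move=> c0 cr; have r0 : 0 < r by exact: lt_le_trans cr.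
rewrite /poisson_prob r0 esum_fset//; last first.
  by move=> k _; rewrite lee_fin poisson_pmf_ge0.
rewrite -fsbig_ord sumEFin lee_fin.
apply: le_trans (_ : \sum_(i < n) n%:R / c <= _); last first.
  by rewrite sumr_const card_ord -[leLHS]mulr_natr mulrAC -natrM mulnn.
apply: ler_sum => i _; rewrite /poisson_pmf r0 expRN.
rewrite ler_pdivrMr ?expR_gt0//.
have := expR_ge_monomial _ i.+1 (ltW r0); rewrite exprS factS natrM => H.
have iR : 0 < i.+1%:R :> R by rewrite ltr0n.
have fR : 0 < i`!%:R :> R by rewrite ltr0n fact_gt0.
have -> : r ^+ i / i`!%:R = i.+1%:R / r * (r * r ^+ i / (i.+1%:R * i`!%:R)).
  by field; rewrite !gt_eqF.
apply: ler_pM => //.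
- by rewrite divr_ge0// ltW.
- by rewrite divr_ge0// ?mulr_ge0 ?exprn_ge0 ?(ltW r0)// ltW.
- by apply: ler_pM; rewrite ?invr_ge0 ?(ltW r0)// ?ler_nat// lef_pV2 ?posrE.
Qed.

(** Since k^2 <= 4^k, the factor k^2 is absorbed into the exponential series of 4 C. *)
Lemma poisson_prob_sq_summable (C : R) : 0 <= C ->
  (\sum_(k <oo) ((k ^ 2)%:R * (C ^+ k / k`!%:R))%:E <= (expR (4 * C))%:E)%E.
Proof.
move=> C0; apply: lime_le; first by apply: is_cvg_nneseries => n _ _;
  rewrite lee_fin mulr_ge0// divr_ge0// exprn_ge0.
apply: nearW => n; rewrite big_mkord sumEFin lee_fin -[leRHS]/(limn (series (exp_coeff (4 * C)))).
apply: le_trans (_ : series (exp_coeff (4 * C)) n <= _); last first.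
  apply: nondecreasing_cvgn_le; last exact: is_cvg_series_exp_coeff.
  by apply/nondecreasing_seqP => m; rewrite seriesSr lerDl exp_coeff_ge0// mulr_ge0.
rewrite /series/= big_mkord; apply: ler_sum => k _.
rewrite /exp_coeff/= exprMn mulrA ler_wpM2r ?invr_ge0// ler_wpM2r ?exprn_ge0//.
rewrite -natrX ler_nat (_ : 4 = 2 ^ 2)%N// -expnM mulnC expnM leq_exp2r//.
exact/ltnW/ltn_expl.
Qed.

End poisson_estimates.

Section poisson_process_estimates.
Context {d} {Om : measurableType d} {R : realType} (P : probability Om R).
Variables (lam : R -> R) (Nt : R -> {RV P >-> nat}).
Hypothesis HN : poisson_process lam Nt.
Variables (c C : R).
Hypotheses (c_gt0 : 0 < c) (C_gt0 : 0 < C).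
Hypothesis lamI : forall s t, 0 <= s -> s <= t ->
  c * (t - s) <= \int[lebesgue_measure]_(r in `[s, t]) lam r <= C * (t - s).

Lemma probability_increment s t (B : set nat) : 0 <= s -> s <= t ->
  exists2 r : R, c * (t - s) <= r <= C * (t - s) &
    P [set w | B (Nt t w - Nt s w)%N] = poisson_prob r 0 B.
Proof.
move=> s0 st; exists (\int[lebesgue_measure]_(r in `[s, t]) lam r).
  exact: lamI.
by case: HN => _ _ _ _; exact.
Qed.

Let rate_ge0 s t r : s <= t -> c * (t - s) <= r <= C * (t - s) -> 0 <= r.
Proof.
by move=> st /andP[cr _]; apply: le_trans cr; rewrite mulr_ge0 ?subr_ge0// ltW.
Qed.

Lemma probability_increment_eq s t k : 0 <= s -> s <= t ->
  (P [set w | (Nt t w - Nt s w)%N = k] <= ((C * (t - s)) ^+ k / k`!%:R)%:E)%E.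
Proof.
move=> s0 st; have [r rE ->] := probability_increment s t [set k] s0 st.
by apply: poisson_pmf_le_rate; [exact: rate_ge0 rE|case/andP: rE].
Qed.

Lemma probability_no_arrival s t : 0 <= s -> s <= t ->
  ((expR (- (C * (t - s))))%:E <= P [set w | (Nt t w - Nt s w)%N = 0%N])%E.
Proof.
move=> s0 st; have [r rE ->] := probability_increment s t [set 0%N] s0 st.
by apply: poisson_prob0_ge; [exact: rate_ge0 rE|case/andP: rE].
Qed.

(** On this event every arrival time is the infimum of a nonempty set, so that arrival times and
    counts determine each other. *)
Definition infinitely_many_arrivals : set Om :=
  [set w | forall n, exists u : nat, (n <= Nt u%:R w)%N].

Lemma ae_infinitely_many_arrivals : {ae P, forall w, infinitely_many_arrivals w}.
Proof.
apply/ae_foralln => n.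
pose A := \bigcap_(u : nat) [set w | (Nt u%:R w < n)%N].
have mlt u : measurable [set w | (Nt u w < n)%N].
  rewrite (_ : [set _ | _] = Nt u @^-1` `I_n)//.
  by rewrite -[X in measurable X]setTI; exact: measurable_funP.
have mA : measurable A by exact: bigcap_measurable.
exists A; split => //; last first.
  move=> w /= nw u _ /=; rewrite ltnNge; apply/negP => nu.
  by apply: nw; exists u.
apply/eqP; rewrite eq_le measure_ge0 andbT; apply/lee_addgt0Pr => e e0.
rewrite add0e.
(* Chosen so that the bound n^2 / (c u) on the probability of fewer than n points up to time u is at
   most e. *)
pose u := (Num.truncn ((n ^ 2)%:R / (e * c))).+1.
have u0 : 0 < u%:R :> R by rewrite ltr0n.
apply: le_trans (_ : P [set w | (Nt u%:R w < n)%N] <= _)%E.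
  by rewrite le_measure ?inE//; exact: bigcap_inf.
have [r /andP[cr _] rE] := probability_increment 0 u%:R `I_n (lexx _) (ltW u0).
rewrite (_ : [set w | _] = [set w | `I_n (Nt u%:R w - Nt 0 w)%N]); last first.
  by case: HN => N0 _ _ _ _; apply/seteqP; split => w; rewrite /= N0 subn0.
rewrite {}rE subr0 in cr *.
apply: le_trans (poisson_prob_lt r (c * u%:R) n _ cr) _; first by rewrite mulr_gt0.
rewrite lee_fin ler_pdivrMr ?mulr_gt0// mulrA mulrC -ler_pdivrMr ?mulr_gt0//.
exact/ltW/truncnS_gt.
Qed.

End poisson_process_estimates.

Arguments arrival : simpl never.

Lemma measurable_fun_comp_ge0 {d} {T : measurableType d} {R : realType}
    (f : R -> R) (g : T -> R) (D : set T) :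
  measurable_fun (`[0, +oo[ : set R) f -> measurable_fun D g ->
  (forall x, 0 <= g x) -> measurable_fun D (fun x => f (g x)).
Proof.
move=> mf mg g0.
have gD : [set g x | x in D] `<=` `[0, +oo[%classic.
  by move=> _ [x _ <-]; rewrite /= in_itv/= g0.
have mI : measurable (`[0, +oo[%classic : set R) by exact: measurable_itv.
exact: (measurable_comp mI gD mf mg).
Qed.

(** * Marked points: independence of disjoint time windows *)

Section marks.
Context {d} {Om : measurableType d} {R : realType} {N : nat}
  (P : probability Om R).
Variables (lam : R -> R) (Nt : R -> {RV P >-> nat}).
Hypothesis HN : poisson_process lam Nt.
Hypothesis infN : {ae P, forall w, infinitely_many_arrivals P Nt w}.
Variables (q : R -> set (R * 'cV[R]_N) -> R)
  (Y : nat -> {RV P >-> (R * 'cV[R]_N)%type}).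
Hypothesis HY : cond_independent_marks P q (arrival Nt) Y.
Hypothesis mq : forall B, measurable B ->
  measurable_fun (`[0, +oo[ : set R) (fun t => q t B).
Hypothesis qT : forall t, 0 <= t -> q t setT = 1.
Hypothesis q_ge0 : forall t B, 0 <= t -> 0 <= q t B.
Hypothesis q_le1 : forall t B, 0 <= t -> measurable B -> q t B <= 1.

Local Notation T := (arrival Nt).
Local Notation Good := (infinitely_many_arrivals P Nt).
Local Notation arrival_ge0 := (arrival_ge0 P Nt).

Lemma good_galois w n t : Good w -> 0 <= t -> (n <= Nt t w)%N = (T n w <= t).
Proof.
by move=> /(_ n)[u nu]; apply: (arrival_galois P lam Nt HN n u%:R).
Qed.

(** For x >= 0, T_(n+1) exceeds x when at most n points have come by time x and an (n+1)-st one
    comes eventually; without the latter the infimum would be 0. *)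
Lemma measurable_arrival n : measurable_fun setT (T n).
Proof.
case: n => [|n]; first exact: measurable_cst.
apply: (measurability _ (RGenOInfty.measurableE R)) => //.
move=> _ [_ [x ->] <-]; rewrite setTI.
have [x0|x0] := ltP x 0.
  rewrite (_ : _ @^-1` _ = setT)//; apply/seteqP; split => w //= _.
  by rewrite in_itv/= andbT (lt_le_trans x0)// arrival_ge0.
have mlt u (D : set nat) : measurable (Nt u @^-1` D).
  by rewrite -[X in measurable X]setTI; exact: measurable_funP.
rewrite (_ : _ @^-1` _ = Nt x @^-1` `I_n.+1 `&`
    \bigcup_(u : nat) Nt u%:R @^-1` [set k | (n < k)%N]).
  by apply: measurableI; [exact: mlt|apply: bigcup_measurable => u _; exact: mlt].
apply/seteqP; split => w.
  rewrite /= in_itv/= andbT => xT; split.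
    rewrite /= ltnNge; apply/negP => nx.
    by have := arrival_le P Nt n.+1 x w x0 nx; rewrite leNgt xT.
  have : [set t | 0 <= t /\ (n < Nt t w)%N] !=set0.
    by apply/set0P/eqP => E; move: xT; rewrite /arrival E inf0 ltNge x0.
  move=> [u [u0 nu]]; exists (Num.truncn u).+1 => //=.
  by rewrite (leq_trans nu)// (poisson_homo P lam Nt HN)// ltW// truncnS_gt.
move=> [/= nx [u _ /= nu]]; rewrite in_itv/= andbT ltNge.
by rewrite -(arrival_galois P lam Nt HN n.+1 u%:R)// -ltnNge.
Qed.

Let G := \bigcup_(i in [set n | (0 < n)%N])
  preimage_set_system setT (T i) (@measurable _ R).

Lemma measurable_arrival_sigma n :
  measurable_fun setT (T n : g_sigma_algebraType G -> R).
Proof.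
case: n => [|n]; first exact: measurable_cst.
move=> _ A mA; apply: sub_sigma_algebra; exists n.+1 => //.
by exists A.
Qed.

Lemma measurable_sigma_fam E :
  sigma_fam [set n | (0 < n)%N] T E -> measurable E.
Proof.
apply: sigma_sub_measurable => A [n _] [B mB <-].
exact: measurable_arrival.
Qed.

Lemma integral_eq_good (A B : set Om) (f : Om -> \bar R) :
  measurable A -> measurable B -> measurable_fun setT f ->
  (forall w, 0 <= f w)%E -> (forall w, Good w -> A w <-> B w) ->
  (\int[P]_(w in A) f w = \int[P]_(w in B) f w)%E.
Proof.
move=> mA mB mf f0 AB; rewrite integral_mkcond [RHS]integral_mkcond.
have mr D : measurable D -> measurable_fun setT (f \_ D).
  by move=> mD; apply/(measurable_restrictT _ mD); exact: measurable_funTS.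
apply: ge0_ae_eq_integral => //; [exact: mr|exact: mr|..].
- by move=> w _; rewrite patchE; case: ifP.
- by move=> w _; rewrite patchE; case: ifP.
apply: filterS infN => w /AB ABw _; rewrite !patchE.
by congr (if _ then _ else _); apply/idP/idP; rewrite !inE => /ABw.
Qed.

Lemma measure_eq_good (A B : set Om) : measurable A -> measurable B ->
  (forall w, Good w -> A w <-> B w) -> P A = P B.
Proof.
move=> mA mB AB; have := integral_eq_good A B (cst 1%E) mA mB.
by rewrite !integral_cst// !mul1e; apply.
Qed.

Lemma measurable_prod_weights m (B : nat -> set (R * 'cV[R]_N)) :
  (forall i, measurable (B i)) ->
  measurable_fun setT (fun w => (\prod_(i < m) q (T i.+1 w) (B i))%:E).
Proof.
move=> mB; apply/measurable_EFinP; apply: measurable_prod => i _.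
apply: (measurable_fun_comp_ge0 (fun t => q t (B i))).
- exact: mq.
- exact: measurable_arrival.
- by move=> w; exact: arrival_ge0.
Qed.

(* On the almost sure event of infinitely many arrivals the counts are
   functions of the arrival times. *)
Lemma marks_given_arrivals m (B : nat -> set (R * 'cV[R]_N)) E E' :
  (forall i, measurable (B i)) -> measurable E ->
  sigma_fam [set n | (0 < n)%N] T E' -> (forall w, Good w -> E w <-> E' w) ->
  (P ((\bigcap_(i in `I_m) (Y i.+1 @^-1` B i)) `&` E) =
     \int[P]_(w in E) (\prod_(i < m) q (T i.+1 w) (B i))%:E)%E.
Proof.
move=> mB mE FE' EE'.
have mE' := measurable_sigma_fam _ FE'.
have mY : measurable (\bigcap_(i in `I_m) (Y i.+1 @^-1` B i)).
  by apply: bigcap_measurableType => i _; rewrite -[X in measurable X]setTI;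
    exact: measurable_funP.
have mp := measurable_prod_weights m B mB.
have [_ /(_ _ FE')] := HY m B mB.
have E1 : (P ((\bigcap_(i in `I_m) (Y i.+1 @^-1` B i)) `&` E) =
    P ((\bigcap_(i in `I_m) (Y i.+1 @^-1` B i)) `&` E'))%E.
  apply: measure_eq_good; [exact: measurableI|exact: measurableI|].
  by move=> w /EE' Ew /=; split => -[? /Ew].
have E2 : (\int[P]_(w in E) (\prod_(i < m) q (T i.+1 w) (B i))%:E =
  \int[P]_(w in E') (\prod_(i < m) q (T i.+1 w) (B i))%:E)%E.
  apply: integral_eq_good => // w; rewrite lee_fin.
  by apply: prodr_ge0 => i _; exact: q_ge0 (arrival_ge0 _ _).
by rewrite E1 E2.
Qed.

(** Fixing the count [a] at [s] gives the points of the window the deterministic indices a + 1, ...,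
    a + k, the form required by the conditional law of the marks. *)
Definition arrival_event (s t : R) (a k : nat) (C : nat -> set R) : set Om :=
  [set w | [/\ Nt s w = a, Nt t w = (a + k)%N &
    forall i, (i < k)%N -> C i (T (a + i.+1)%N w)]].

Lemma measurable_forall_lt (F : nat -> set Om) k :
  (forall i, measurable (F i)) ->
  measurable [set w | forall i, (i < k)%N -> F i w].
Proof.
move=> mF; rewrite (_ : [set _ | _] = \bigcap_(i in `I_k) F i)//.
by apply: bigcap_measurableType => i _.
Qed.

Lemma measurable_arrival_event s t a k C : (forall i, measurable (C i)) ->
  measurable (arrival_event s t a k C).
Proof.
move=> mC.
have mlt u (D : set nat) : measurable (Nt u @^-1` D).
  by rewrite -[X in measurable X]setTI; exact: measurable_funP.
rewrite (_ : arrival_event _ _ _ _ _ = Nt s @^-1` [set a] `&`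
  Nt t @^-1` [set (a + k)%N] `&`
  [set w | forall i, (i < k)%N -> (T (a + i.+1)%N @^-1` C i) w]); last first.
  by apply/seteqP; split => w /=; [case|case=> -[]].
apply: measurableI; first exact: measurableI.
apply: measurable_forall_lt => i; rewrite -[X in measurable X]setTI.
exact: measurable_arrival.
Qed.

(** A count equal to [a] at time [s] is read as T_a <= s < T_(a+1), an equivalence available on
    [Good]. *)
Lemma arrival_event_sigma s t a k C : 0 <= s -> 0 <= t ->
  (forall i, measurable (C i)) ->
  exists2 E, sigma_fam [set n | (0 < n)%N] T E &
    forall w, Good w -> arrival_event s t a k C w <-> E w.
Proof.
move=> s0 t0 mC.
pose E : set (g_sigma_algebraType G) :=
  T a @^-1` `]-oo, s] `&` T a.+1 @^-1` `]s, +oo[ `&`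
  (T (a + k)%N @^-1` `]-oo, t] `&` T (a + k).+1 @^-1` `]t, +oo[) `&`
  \bigcap_(i in `I_k) (T (a + i.+1)%N @^-1` C i).
have mE : measurable E.
  have mT n (B : set R) : measurable B ->
      measurable (T n @^-1` B : set (g_sigma_algebraType G)).
    by move=> mB; rewrite -[X in measurable X]setTI; exact: measurable_arrival_sigma.
  apply: measurableI.
    by apply: measurableI; apply: measurableI; apply: mT; exact: measurable_itv.
  by apply: bigcap_measurableType => i _; apply: mT.
exists E => // w gw.
have NE u n : 0 <= u -> (Nt u w = n) <->
    (T n @^-1` `]-oo, u]) w /\ (T n.+1 @^-1` `]u, +oo[) w.
  move=> u0; rewrite /preimage/= !in_itv/= andbT -(good_galois _ _ _ gw u0).
  rewrite ltNge -(good_galois _ _ _ gw u0) -leqNgt; split => [->//|[? ?]].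
  by apply/eqP; rewrite eqn_leq; apply/andP.
rewrite /arrival_event/=; split.
  by move=> [/NE[//|? ?] /NE[//|? ?] H]; split.
by move=> [[[? ?] [? ?]] H]; split => //; exact/NE.
Qed.

(** Points are numbered from the first one after [s], so that the event concerns the window alone: a
    global index would reveal how many points precede it. *)
Definition mark_event (s t : R) (k : nat) (C : nat -> set R)
    (B : nat -> set (R * 'cV[R]_N)) : set Om :=
  [set w | (Nt t w - Nt s w)%N = k /\ forall i, (i < k)%N ->
     C i (T (Nt s w + i.+1)%N w) /\ B i (Y (Nt s w + i.+1)%N w)].

(* The conditional probability of [mark_event] given the arrival times. *)
Definition mark_weight (s t : R) (k : nat) (C : nat -> set R)
    (B : nat -> set (R * 'cV[R]_N)) (w : Om) : R :=
  ((Nt t w - Nt s w)%N == k)%:R * \prod_(i < k)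
    (\1_(C i) (T (Nt s w + i.+1)%N w) * q (T (Nt s w + i.+1)%N w) (B i)).

Lemma mark_weight_arrival_event s t a k C B w : s <= t -> 0 <= s ->
  Nt s w = a -> mark_weight s t k C B w =
    \1_(arrival_event s t a k C) w * \prod_(i < k) q (T (a + i.+1)%N w) (B i).
Proof.
move=> st s0 Na; rewrite /mark_weight Na big_split/= mulrA; congr (_ * _).
have NN : (Nt s w <= Nt t w)%N by apply: poisson_homo HN _ _ _ s0 st.
rewrite indicE; case: eqP => [Nk|Nk]; last first.
  rewrite mul0r memNset// => -[_ Nt_ _]; apply: Nk.
  by rewrite Nt_ addKn.
rewrite mul1r; have [Cw|Cw] := pselect (forall i, (i < k)%N -> C i (T (a + i.+1)%N w)).
  have aw : arrival_event s t a k C w by split => //; rewrite -Nk subnKC// -Na.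
  by rewrite (mem_set aw) big1// => i _; rewrite indicE mem_set//; exact: Cw.
rewrite memNset; last by case.
have /existsNP[i /not_implyP[ik NC]] := Cw.
by rewrite (bigD1 (Ordinal ik))//= indicE memNset// mul0r.
Qed.

Lemma measurable_mark_event s t k C B : (forall i, measurable (C i)) ->
  (forall i, measurable (B i)) -> measurable (mark_event s t k C B).
Proof.
move=> mC mB.
have mlt u (D : set nat) : measurable (Nt u @^-1` D).
  by rewrite -[X in measurable X]setTI; exact: measurable_funP.
pose F a i : set Om := T (a + i.+1)%N @^-1` C i `&` Y (a + i.+1)%N @^-1` B i.
rewrite (_ : mark_event _ _ _ _ _ = \bigcup_a (Nt s @^-1` [set a] `&`
  ([set w | (Nt t w - Nt s w)%N = k] `&`
  [set w | forall i, (i < k)%N -> F a i w]))); last first.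
  by apply/seteqP; split => [w [? ?]|w [a _ [/= <- []]]]; [exists (Nt s w)|].
apply: bigcup_measurable => a _; apply: measurableI => //.
apply: measurableI.
  have := measurable_increment P Nt s t measurableT [set k] Logic.I.
  by rewrite setTI.
apply: measurable_forall_lt => i; apply: measurableI;
  rewrite -[X in measurable X]setTI; first exact: measurable_arrival.
exact: measurable_funP.
Qed.

(** Places the test sets of two windows in one sequence, since the conditional law speaks of initial
    segments of the marks. The indices in neither window receive [z], which will be [setT], of mass
    1. *)
Let glue (T' : Type) (a k b : nat) (F F' : nat -> T') (z : T') i : T' :=
  if (a <= i < a + k)%N then F (i - a)%N else
  if (b <= i)%N then F' (i - b)%N else z.

Let prod_glue (a k b k' : nat) (B B' : nat -> set (R * 'cV[R]_N)) w :
  (a + k <= b)%N ->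
  \prod_(i < b + k') q (T i.+1 w) (glue _ a k b B B' setT i) =
  (\prod_(i < k) q (T (a + i.+1)%N w) (B i)) *
  \prod_(i < k') q (T (b + i.+1)%N w) (B' i).
Proof.
move=> akb; pose f i := q (T i.+1 w) (glue _ a k b B B' setT i).
rewrite -(big_mkord xpredT f) (@big_cat_nat _ _ _ b)//=; last exact: leq_addr.
rewrite (@big_cat_nat _ _ _ (a + k)%N)//= (@big_cat_nat _ _ _ a 0%N)//=; last first.
  exact: leq_addr.
rewrite big1_seq ?mul1r; last first.
  move=> i; rewrite mem_index_iota => /andP[_ /andP[_ ia]].
  rewrite /f /glue ifF; last by rewrite leqNgt ia.
  rewrite ifF ?qT ?arrival_ge0//.
  by apply/negbTE; rewrite -ltnNge (leq_trans ia)// (leq_trans _ akb)// leq_addr.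
rewrite [X in _ * X * _]big1_seq ?mulr1; last first.
  move=> i; rewrite mem_index_iota => /andP[_ /andP[aki ib]].
  rewrite /f /glue ifF; last by rewrite [(_ < _)%N]ltnNge aki andbF.
  by rewrite ifF ?qT ?arrival_ge0//; apply/negbTE; rewrite -ltnNge.
have shift m p : \prod_(m <= i < m + p) f i = \prod_(i < p) f (m + i)%N.
  rewrite -{1}(add0n m) big_addn addKn big_mkord.
  by apply: eq_bigr => i _; rewrite addnC.
rewrite !shift; congr (_ * _); apply: eq_bigr => i _; rewrite /f /glue -addnS.
  by rewrite leq_addr leq_add2l ltn_ord addKn.
rewrite ifF ?leq_addr ?addKn//; apply/negP => /andP[_].
by rewrite leqNgt addnS ltnS (leq_trans akb)// leq_addr.
Qed.

Local Notation count_sigma s t := (g_sigma_algebraType (count_system P Nt s t)).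

Lemma measurable_count s t r (D : set nat) : s <= r -> r <= t ->
  measurable ([set w | D (Nt r w - Nt s w)%N] : set (count_sigma s t)).
Proof.
move=> sr rt; rewrite (_ : [set _ | _] =
  \bigcup_(k in D) count_event P Nt s [:: (r, k)]); last first.
  apply/seteqP; split => [w Dw|w [k Dk /(_ (r, k) (mem_head _ _)) /= kE]]; last first.
    by rewrite /= kE.
  by exists (Nt r w - Nt s w)%N => // p; rewrite inE => /eqP ->.
apply: bigcup_measurable => k _; apply: sub_sigma_algebra.
by exists [:: (r, k)] => //=; rewrite sr rt.
Qed.

(** Given k points in the window, the (i+1)-st comes after x exactly when at most i have come by
    time x. This constrains a count if x lies in the window, and is always true for x < s, never for
    x > t. *)
Lemma measurable_count_arrival s t k i : 0 <= s -> s <= t -> (i < k)%N ->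
  measurable_fun ([set w | (Nt t w - Nt s w)%N = k] : set (count_sigma s t))
    (fun w => T (Nt s w + i.+1)%N w).
Proof.
move=> s0 st ik; have t0 := le_trans s0 st.
have mD : measurable ([set w | (Nt t w - Nt s w)%N = k] : set (count_sigma s t)).
  by apply: (measurable_count s t t [set k]).
apply: (measurability _ (RGenOInfty.measurableE R)) => //.
move=> _ [_ [x ->] <-].
have homo := poisson_homo P lam Nt HN.
have TE w u : (Nt t w - Nt s w)%N = k -> 0 <= u ->
    (u < T (Nt s w + i.+1)%N w) = ~~ (Nt s w + i.+1 <= Nt u w)%N.
  move=> Nk u0; rewrite (arrival_galois P lam Nt HN _ t)// -?ltNge//.
  have := homo w _ _ s0 st; lia.
have [xs|sx] := ltP x s.
  rewrite (_ : _ `&` _ = [set w | (Nt t w - Nt s w)%N = k])//.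
  apply/seteqP; split => [w []//|w /= Nk]; split => //.
  rewrite /preimage/= in_itv/= andbT (lt_le_trans xs)// ltW// TE//.
  by rewrite -ltnNge addnS ltnS leq_addr.
have [xt|tx] := leP x t.
  rewrite (_ : _ `&` _ = [set w | (Nt t w - Nt s w)%N = k] `&`
      [set w | `I_i.+1 (Nt x w - Nt s w)%N]).
    by apply: measurableI => //; exact: measurable_count.
  have x0 := le_trans s0 sx.
  apply/seteqP; split => w [/= Nk]; rewrite /preimage/= in_itv/= andbT TE//;
    have := homo w _ _ s0 sx; lia.
rewrite (_ : _ `&` _ = set0)//; rewrite -subset0 => w [/= Nk].
rewrite /preimage/= in_itv/= andbT TE ?(le_trans t0 (ltW tx))//.
have := homo w _ _ t0 (ltW tx); have := homo w _ _ s0 st; lia.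
Qed.

Lemma measurable_mark_weight s t k C B : 0 <= s -> s <= t ->
  (forall i, measurable (C i)) -> (forall i, measurable (B i)) ->
  measurable_fun setT (mark_weight s t k C B : count_sigma s t -> R).
Proof.
move=> s0 st mC mB.
pose D : set (count_sigma s t) := [set w | (Nt t w - Nt s w)%N = k].
have mD : measurable D by apply: (measurable_count s t t [set k]).
rewrite -(setUv D); apply/measurable_funU => //; first exact: measurableC.
split; last first.
  apply: (eq_measurable_fun (cst 0 : count_sigma s t -> R)) => [w|]; last exact: measurable_cst.
  by rewrite inE /D/= /mark_weight => /eqP/negbTE ->; rewrite mul0r.
apply: (eq_measurable_fun (fun w : count_sigma s t => \prod_(i < k)
    (\1_(C i) (T (Nt s w + i.+1)%N w) * q (T (Nt s w + i.+1)%N w) (B i)))).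
  by move=> w; rewrite inE /D/= /mark_weight => ->; rewrite eqxx mul1r.
apply: measurable_prod => i _; apply: measurable_funM.
  apply: (measurableT_comp (measurable_indic (D := setT) (mC i))).
  exact: measurable_count_arrival.
apply: (measurable_fun_comp_ge0 (fun t => q t (B i))).
- exact: mq.
- exact: measurable_count_arrival.
- by move=> w; exact: arrival_ge0.
Qed.

Lemma measurable_fun_sub_sigma (G0 : set (set Om)) (f : Om -> R) :
  G0 `<=` measurable ->
  measurable_fun setT (f : g_sigma_algebraType G0 -> R) -> measurable_fun setT f.
Proof.
move=> G0M mf _ A mA; apply: (sigma_sub_measurable _ G0M).
exact: (mf measurableT A mA).
Qed.

Lemma mark_weight_ge0 s t k C B w : 0 <= mark_weight s t k C B w.
Proof.
rewrite mulr_ge0//; apply: prodr_ge0 => i _; rewrite mulr_ge0//.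
by apply: q_ge0; exact: arrival_ge0.
Qed.

Lemma mark_weight_le1 s t k C B w : (forall i, measurable (B i)) ->
  mark_weight s t k C B w <= 1.
Proof.
move=> mB; rewrite -[leRHS]mulr1 /mark_weight; apply: ler_pM => //.
- apply: prodr_ge0 => i _; rewrite mulr_ge0//.
  by apply: q_ge0; exact: arrival_ge0.
- by case: (_ == _).
apply: prodr_ile1 => i _; rewrite mulr_ge0//=; last first.
  by apply: q_ge0; exact: arrival_ge0.
rewrite -[leRHS]mulr1; apply: ler_pM => //.
- by apply: q_ge0; exact: arrival_ge0.
- by apply: q_le1 => //; exact: arrival_ge0.
Qed.

(* Integrating out the marks given the arrival times leaves [mark_weight], a
   function of the counts in the interval, so that only the independence of the
   increments is needed. *)
Lemma probability_mark_events s t s' t' k k' C B C' B' :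
  0 <= s -> s <= t -> t <= s' -> s' <= t' ->
  (forall i, measurable (C i)) -> (forall i, measurable (B i)) ->
  (forall i, measurable (C' i)) -> (forall i, measurable (B' i)) ->
  (P (mark_event s t k C B `&` mark_event s' t' k' C' B') =
   \int[P]_w (mark_weight s t k C B w * mark_weight s' t' k' C' B' w)%:E)%E.
Proof.
move=> s0 st ts' s't' mC mB mC' mB'.
have t0 := le_trans s0 st; have s'0 := le_trans t0 ts'.
have t'0 := le_trans s'0 s't'.
set A := _ `&` _.
have mA : measurable A by apply: measurableI; exact: measurable_mark_event.
have mNt u n : measurable (Nt u @^-1` [set n]).
  by rewrite -[X in measurable X]setTI; exact: measurable_funP.
have mW : measurable_fun setT
    (fun w => (mark_weight s t k C B w * mark_weight s' t' k' C' B' w)%:E).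
  apply/measurable_EFinP; apply: measurable_funM.
    apply: (measurable_fun_sub_sigma (count_system P Nt s t)).
      exact: count_system_measurable.
    exact: measurable_mark_weight.
  apply: (measurable_fun_sub_sigma (count_system P Nt s' t')).
    exact: count_system_measurable.
  exact: measurable_mark_weight.
have W0 w : (0 <= (mark_weight s t k C B w * mark_weight s' t' k' C' B' w)%:E)%E.
  by rewrite lee_fin mulr_ge0// mark_weight_ge0.
(* Both sides are split according to the counts a at [s] and b at [s'], after which the marks of
   both windows have deterministic indices. *)
rewrite (measure_countable_partition P (Nt s) A)//.
rewrite (integral_countable_partition P (Nt s) _ setT)//.
apply: eq_eseriesr => a _.
rewrite (measure_countable_partition P (Nt s') (A `&` _))//; last first.
  exact: measurableI.
rewrite (integral_countable_partition P (Nt s') _ (setT `&` _))//; last first.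
  exact: measurableI.
apply: eq_eseriesr => b _.
rewrite setTI; set ab := Nt s @^-1` [set a] `&` Nt s' @^-1` [set b].
have mab : measurable ab by exact: measurableI.
pose D := arrival_event s t a k C `&` arrival_event s' t' b k' C'.
have mD : measurable D by apply: measurableI; exact: measurable_arrival_event.
have homo := poisson_homo P lam Nt HN.
have DI w : \1_(arrival_event s t a k C) w * \1_(arrival_event s' t' b k' C') w
    = \1_D w :> R by rewrite /D indicI.
(* If b < a + k there would be more points up to [t] than up to [s'], and both sides vanish. *)
have [akb|bak] := leqP (a + k) b; last first.
  have D0 : D = set0.
    rewrite -subset0 => w [[_ Nk _] [Nb _ _]].
    have := homo w _ _ t0 ts'; lia.
  rewrite (_ : A `&` _ `&` _ = set0) ?measure0; last first.
    rewrite -subset0 => w [[[[Nk _] _] /= Na] Nb].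
    have := homo w _ _ t0 ts'; have := homo w _ _ s0 st; lia.
  rewrite integral0_eq// => w [/= Na Nb].
  rewrite (mark_weight_arrival_event _ _ _ _ _ _ _ st s0 Na).
  rewrite (mark_weight_arrival_event _ _ _ _ _ _ _ s't' s'0 Nb).
  by rewrite mulrACA DI D0 indicE in_set0 mul0r.
pose BB := glue _ a k b B B' setT.
have mBB i : measurable (BB i).
  by rewrite /BB /glue; case: ifP => // _; case: ifP.
have -> : A `&` Nt s @^-1` [set a] `&` Nt s' @^-1` [set b] =
    (\bigcap_(i in `I_(b + k')) (Y i.+1 @^-1` BB i)) `&` D.
  apply/seteqP; split => w.
    move=> [[[[Nk H] [Nk' H']] /= Na] Nb].
    have Nst := homo w _ _ s0 st; have Nst' := homo w _ _ s'0 s't'.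
    split; last first.
      split; (split => //; first by lia) => i ik.
        by rewrite -Na; have [] := H i ik.
      by rewrite -Nb; have [] := H' i ik.
    move=> i /= ibk; rewrite /BB /glue; case: ifP => [/andP[ai iak]|_].
      have [] := H (i - a)%N; first by lia.
      by rewrite Na addnS subnKC.
    case: ifP => // bi; have [] := H' (i - b)%N; first by lia.
    by rewrite Nb addnS subnKC.
  move=> [HB [[Na Nak HC] [Nb Nbk HC']]]; split=> //; split=> //; split; split.
  - by rewrite Na Nak addKn.
  - move=> i ik; rewrite Na; split; first exact: HC.
    have := HB (a + i)%N; rewrite /BB /glue /= leq_addr ltn_add2l ik addKn addnS.
    by apply; lia.
  - by rewrite Nb Nbk addKn.
  - move=> i ik; rewrite Nb; split; first exact: HC'.
    have := HB (b + i)%N; rewrite /BB /glue /= ifF; last by apply/negbTE; lia.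
    by rewrite leq_addr addKn addnS ltn_add2l; apply.
have [E FE EE] := arrival_event_sigma s t a k C s0 t0 mC.
have [E' FE' EE'] := arrival_event_sigma s' t' b k' C' s'0 t'0 mC'.
have FI : sigma_fam [set n | (0 < n)%N] T (E `&` E').
  exact: (@measurableI _ (g_sigma_algebraType G)).
rewrite (marks_given_arrivals _ _ D (E `&` E'))//; last first.
  by move=> w gw; split => -[/(EE w gw) ? /(EE' w gw)].
rewrite integral_mkcond [RHS]integral_mkcond; apply: eq_integral => w _.
rewrite !patchE; case: ifPn => [/set_mem [E1 E2]|wD].
  rewrite ifT; last by rewrite inE /ab; case: E1 => ? _ _; case: E2.
  have [Na _ _] := E1; have [Nb _ _] := E2.
  rewrite (mark_weight_arrival_event _ _ _ _ _ _ _ st s0 Na).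
  rewrite (mark_weight_arrival_event _ _ _ _ _ _ _ s't' s'0 Nb).
  by rewrite !indicE !mem_set// !mul1r prod_glue.
case: ifPn => // /set_mem [/= Na Nb].
rewrite (mark_weight_arrival_event _ _ _ _ _ _ _ st s0 Na).
rewrite (mark_weight_arrival_event _ _ _ _ _ _ _ s't' s'0 Nb).
by rewrite mulrACA DI indicE (negbTE wD) mul0r.
Qed.

Definition mark_system (s t : R) : set (set Om) :=
  [set A | exists k C B, [/\ forall i, measurable (C i),
     forall i, measurable (B i) & A = mark_event s t k C B]].

Lemma mark_system_setI s t : setI_closed (mark_system s t).
Proof.
move=> _ _ [k [C [B [mC mB ->]]]] [k' [C' [B' [mC' mB' ->]]]].
have [<-|kk'] := eqVneq k k'.
  exists k, (fun i => C i `&` C' i), (fun i => B i `&` B' i).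
  split; [by move=> i; exact: measurableI|by move=> i; exact: measurableI|].
  apply/seteqP; split => w.
    move=> [[Nk H] [_ H']]; split => // i ik.
    by have [? ?] := H i ik; have [? ?] := H' i ik.
  by move=> [Nk H]; split; split => // i ik; have [[? ?] [? ?]] := H i ik.
(* Different counts are incompatible; the empty event is written as one point at a time of the empty
   set. *)
exists 1%N, (fun=> set0), (fun=> setT); split => //.
apply/seteqP; split => w; first by move=> [[Nk _] [Nk' _]]; rewrite -Nk -Nk' eqxx in kk'.
by move=> [_ /(_ 0%N isT)[]].
Qed.

Lemma mark_system_measurable s t : mark_system s t `<=` measurable.
Proof. by move=> _ [k [C [B [mC mB ->]]]]; exact: measurable_mark_event. Qed.

Lemma independent_marks s t s' t' : 0 <= s -> s <= t -> t <= s' -> s' <= t' ->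
  independent_sigma P <<s mark_system s t >> <<s mark_system s' t' >>.
Proof.
move=> s0 st ts' s't'; have t0 := le_trans s0 st; have s'0 := le_trans t0 ts'.
apply: independent_sigma_pi; [exact: mark_system_setI|exact: mark_system_setI|
  exact: mark_system_measurable|exact: mark_system_measurable|].
move=> _ _ [k [C [B [mC mB ->]]]] [k' [C' [B' [mC' mB' ->]]]].
(* A window of length 0 carries the sure event with weight 1, so the formula for two windows also
   gives the probability of a single event. *)
have noneE u : mark_event u u 0 (fun=> setT) (fun=> setT) = setT.
  by apply/seteqP; split => w // _; split; rewrite ?subnn.
have none1 u w : mark_weight u u 0 (fun=> setT) (fun=> setT) w = 1.
  by rewrite /mark_weight subnn eqxx big_ord0 mulr1.
have mT : forall i : nat, measurable (setT : set R) by [].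
have mTY : forall i : nat, measurable (setT : set (R * 'cV[R]_N)) by [].
have PA : (P (mark_event s t k C B) = \int[P]_w (mark_weight s t k C B w)%:E)%E.
  transitivity (P (mark_event s t k C B `&`
      mark_event t t 0 (fun=> setT) (fun=> setT))); first by rewrite noneE setIT.
  rewrite (probability_mark_events s t t t)//.
  by apply: eq_integral => w _; rewrite none1 mulr1.
have PA' : (P (mark_event s' t' k' C' B') =
    \int[P]_w (mark_weight s' t' k' C' B' w)%:E)%E.
  transitivity (P (mark_event s' s' 0 (fun=> setT) (fun=> setT) `&`
      mark_event s' t' k' C' B')); first by rewrite noneE setTI.
  rewrite (probability_mark_events s' s' s' t')//.
  by apply: eq_integral => w _; rewrite none1 mul1r.
rewrite probability_mark_events// PA PA'.
have int u v k0 C0 B0 : 0 <= u -> u <= v -> (forall i, measurable (C0 i)) ->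
    (forall i, measurable (B0 i)) ->
    P.-integrable setT (EFin \o mark_weight u v k0 C0 B0).
  move=> u0 uv mC0 mB0.
  apply: (@le_integrable _ _ _ P setT measurableT _ (EFin \o cst 1)); last first.
  - exact: finite_measure_integrable_cst.
  - move=> w _; rewrite /= lee_fin normr1 ger0_norm ?mark_weight_ge0//.
    exact: mark_weight_le1.
  - apply/measurable_EFinP.
    apply: (measurable_fun_sub_sigma (count_system P Nt u v)).
      exact: count_system_measurable.
    exact: measurable_mark_weight.
apply: expectation_indep; [exact: int|exact: int|].
move=> D D' mD mD'; apply: (independent_counts P lam Nt HN s t s' t') => //.
- rewrite -[X in <<s _ >> X]setTI.
  exact: (measurable_mark_weight s t k C B s0 st mC mB measurableT D mD).
- rewrite -[X in <<s _ >> X]setTI.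
  exact: (measurable_mark_weight s' t' k' C' B' s'0 s't' mC' mB' measurableT D' mD').
Qed.

(** * Second moments of mark sums and block increments *)

Variables (Q : probability (R * 'cV[R]_N)%type R) (kappa C V2 : R).
Hypothesis kappa_ge0 : 0 <= kappa.
Hypothesis C_ge0 : 0 <= C.
Hypothesis q_leQ : forall t B, 0 <= t -> measurable B ->
  q t B <= kappa * fine (Q B).
Hypothesis increment_le : forall s t k, 0 <= s -> s <= t ->
  (P [set w | (Nt t w - Nt s w)%N = k] <= ((C * (t - s)) ^+ k / k`!%:R)%:E)%E.
Variable i0 : 'I_N.
Hypothesis V2_ge : (\int[Q]_y ((y.2 i0 0) ^+ 2)%:E <= V2%:E)%E.

Let zeta n w : R := (Y n w).2 i0 0.
Let theta n w : R := (Y n w).1.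

Lemma measurable_zeta_of : measurable_fun setT (fun y : R * 'cV[R]_N => y.2 i0 0).
Proof. by apply: (measurableT_comp (measurable_coord i0)); exact: measurable_snd. Qed.

Lemma V2_ge0 : 0 <= V2.
Proof.
rewrite -lee_fin; apply: le_trans V2_ge; apply: integral_ge0 => y _.
by rewrite lee_fin sqr_ge0.
Qed.

(** Given the arrival times, the law of the mark is at most kappa Q, whatever they are. So on an
    event [E] determined by them the mark has law at most kappa P(E) Q. *)
Lemma mark_second_moment n E E' : measurable E ->
  sigma_fam [set n | (0 < n)%N] T E' -> (forall w, Good w -> E w <-> E' w) ->
  (\int[P]_(w in E) (zeta n.+1 w ^+ 2)%:E <= (kappa * V2)%:E * P E)%E.
Proof.
move=> mE FE' EE'.
pose v (y : R * 'cV[R]_N) : \bar R := ((y.2 i0 0) ^+ 2)%:E.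
have mv : measurable_fun setT v.
  by apply/measurable_EFinP; apply: measurable_funX; exact: measurable_zeta_of.
have v0 y : (0 <= v y)%E by rewrite lee_fin sqr_ge0.
pose m1 := pushforward (mrestr P mE) (Y n.+1).
have PE : P E = (fine (P E))%:E by rewrite fineK// fin_num_measure.
have k0 : 0 <= kappa * fine (P E) by rewrite mulr_ge0// fine_ge0.
have m12 B : measurable B -> (m1 B <= mscale (NngNum k0) Q B)%E.
  move=> mB; rewrite /m1 /pushforward /mrestr /mscale/=.
  pose BB i : set (R * 'cV[R]_N) := if i == n then B else setT.
  have mBB i : measurable (BB i) by rewrite /BB; case: ifP.
  have -> : Y n.+1 @^-1` B `&` E = \bigcap_(i in `I_n.+1) (Y i.+1 @^-1` BB i) `&` E.
    congr (_ `&` _); apply/seteqP; split => w.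
      by move=> Bw i _; rewrite /BB /=; case: eqP => // ->.
    by move=> /(_ n (ltnSn n)); rewrite /BB /= eqxx.
  rewrite (marks_given_arrivals _ _ _ E' mBB mE FE' EE').
  have QB : Q B = (fine (Q B))%:E by rewrite fineK// fin_num_measure.
  rewrite QB -EFinM mulrAC EFinM -PE -integral_cst//.
  apply: ge0_le_integral => //.
  - move=> w _; rewrite lee_fin; apply: prodr_ge0 => i _.
    by apply: q_ge0; exact: arrival_ge0.
  - by apply: measurable_funTS; exact: measurable_prod_weights.
  - move=> w _; rewrite lee_fin (bigD1 ord_max)//= /BB eqxx big1 ?mulr1.
      by apply: q_leQ => //; exact: arrival_ge0.
    move=> i; rewrite -val_eqE/= => /negbTE ->.
    by rewrite qT//; exact: arrival_ge0.
have mYn : measurable_fun setT (Y n.+1) by exact: measurable_funP.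
have -> : (\int[P]_(w in E) (zeta n.+1 w ^+ 2)%:E = \int[m1]_y v y)%E.
  rewrite ge0_integral_pushforward// preimage_setT.
  rewrite (ge0_integral_density P _ (\1_E : Om -> R))//.
  - rewrite [LHS]integral_mkcond; apply: eq_integral => w _.
    by rewrite patchE indicE; case: ifP => _; rewrite ?mule1 ?mule0.
  - by move=> A mA; rewrite integral_indic// setIC.
  - exact: measurableT_comp.
  - by move=> w; exact: v0.
apply: le_trans (le_measure_integral m1 (mscale (NngNum k0) Q) v m12 mv v0) _.
  exact: mYn.
rewrite ge0_integral_mscale//=.
apply: le_trans (_ : (kappa * fine (P E))%:E * V2%:E <= _)%E.
  by rewrite lee_wpmul2l// lee_fin.
by rewrite -EFinM mulrAC EFinM -PE.
Qed.

Local Notation mark_sigma s t := (g_sigma_algebraType (mark_system s t)).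

Let count_eq s t k : set Om := [set w | (Nt t w - Nt s w)%N = k].

Lemma measurable_mark_count s t k :
  measurable (count_eq s t k : set (mark_sigma s t)).
Proof.
apply: sub_sigma_algebra; exists k, (fun=> setT), (fun=> setT); split => //.
by apply/seteqP; split => w; [split|case].
Qed.

Lemma measurable_mark_arrival s t k i : (i < k)%N ->
  measurable_fun (count_eq s t k : set (mark_sigma s t))
    (fun w => T (Nt s w + i.+1)%N w).
Proof.
move=> ik _ A mA; apply: sub_sigma_algebra.
exists k, (fun j => if j == i then A else setT), (fun=> setT).
split => // [j|]; first by case: ifP.
apply/seteqP; split => w; last by move=> [? /(_ i ik)]; rewrite eqxx => -[].
by move=> [? Aw]; split => // j _; split => //; case: eqP => // ->.
Qed.

Lemma measurable_mark_mark s t k i : (i < k)%N ->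
  measurable_fun (count_eq s t k : set (mark_sigma s t))
    (fun w => Y (Nt s w + i.+1)%N w).
Proof.
move=> ik _ A mA; apply: sub_sigma_algebra.
exists k, (fun=> setT), (fun j => if j == i then A else setT).
split => // [j|]; first by case: ifP.
apply/seteqP; split => w; last by move=> [? /(_ i ik)]; rewrite eqxx => -[].
by move=> [? Aw]; split => // j _; split => //; case: eqP => // ->.
Qed.

Lemma measurable_mark_zeta s t k i : (0 < i <= k)%N ->
  measurable_fun (count_eq s t k : set (mark_sigma s t))
    (fun w => zeta (Nt s w + i)%N w).
Proof.
case: i => // i ik.
exact: (measurableT_comp measurable_zeta_of (measurable_mark_mark s t k i ik)).
Qed.

Lemma measurable_mark_theta s t k i : (0 < i <= k)%N ->
  measurable_fun (count_eq s t k : set (mark_sigma s t))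
    (fun w => theta (Nt s w + i)%N w).
Proof.
case: i => // i ik.
exact: (measurableT_comp measurable_fst (measurable_mark_mark s t k i ik)).
Qed.

Lemma measurable_mark_sigma s t (f : Om -> R) :
  (forall k, measurable_fun (count_eq s t k : set (mark_sigma s t)) f) ->
  measurable_fun setT (f : mark_sigma s t -> R).
Proof.
move=> mf; rewrite (_ : setT = \bigcup_k count_eq s t k); last first.
  by apply/seteqP; split => // w _; exists (Nt t w - Nt s w)%N.
by apply/measurable_fun_bigcup => // k; exact: measurable_mark_count.
Qed.

Local Notation exc w s t := (excursion (Nt ^~ w) (T ^~ w) (theta ^~ w) (zeta ^~ w) s t).
Local Notation msum w s t := (mark_sum (Nt ^~ w) (zeta ^~ w) s t).

Lemma measurable_mark_sum s t :
  measurable_fun setT ((fun w => msum w s t) : mark_sigma s t -> R).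
Proof.
apply: measurable_mark_sigma => k.
apply: (eq_measurable_fun (fun w : mark_sigma s t =>
    \sum_(1 <= i < k.+1) `|zeta (Nt s w + i)%N w|)) => [w|].
  by rewrite inE /count_eq/= /mark_sum => ->.
apply: (eq_measurable_fun (fun w : mark_sigma s t =>
    \sum_(i < k) `|zeta (Nt s w + i.+1)%N w|)) => [w _|].
  by rewrite big_add1 big_mkord.
apply: measurable_sum => i; apply: measurableT_comp => //.
by apply: measurable_mark_zeta; rewrite /= ltn_ord.
Qed.

(** Once the number of points in the window is fixed, the excursion is a lineage value of bounded
    index, computed from the times, delays and marks of these points. *)
Lemma measurable_excursion s t u : 0 <= s -> s <= u -> u <= t ->
  measurable_fun setT ((fun w => exc w s u) : mark_sigma s t -> R).
Proof.
move=> s0 su ut; have u0 := le_trans s0 su.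
apply: measurable_mark_sigma => k.
have homo := poisson_homo P lam Nt HN.
rewrite /excursion; apply: (@measurable_fun_index _ (mark_sigma s t) R
  (count_eq s t k) (fun w => Nt u w - Nt s w)%N
  (fun i w => excursion_idx (Nt ^~ w) (T ^~ w) (theta ^~ w) (zeta ^~ w) s i) k).
(* The count up to [u] is not among the generators of the sigma-algebra; it is recovered as the
   number of arrival times of the window that are at most [u]. *)
- pose b l (w : mark_sigma s t) : bool := T (Nt s w + l)%N w <= u.
  apply: (@eq_measurable_fun _ _ (mark_sigma s t) nat (count_eq s t k)
    (fun w => \sum_(1 <= l < k.+1) (b l w : nat))%N).
    move=> w; rewrite inE /count_eq/= => Nk.
    have Nsu := homo w _ _ s0 su; have Nut := homo w _ _ u0 ut.
    have kE : (Nt u w - Nt s w <= k)%N by lia.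
    rewrite (eq_big_nat _ _ (F2 := fun l => (l <= Nt u w - Nt s w)%N : nat)).
      rewrite (@big_cat_nat _ _ _ (Nt u w - Nt s w).+1)//=.
      rewrite (eq_big_nat _ _ (F2 := fun=> 1%N)); last first.
        by move=> l /andP[_]; rewrite ltnS => ->.
      rewrite sum_nat_const_nat subSS subn0 muln1 big1_seq ?addn0//.
      by move=> l; rewrite mem_index_iota => /andP[_ /andP[ul _]]; rewrite leqNgt ul.
    move=> l /andP[l0 lk]; rewrite /b -(arrival_galois P lam Nt HN _ t)//.
    - congr (nat_of_bool _); lia.
    - exact: le_trans ut.
    - lia.
  apply: measurable_count_true => // -[//|l] lk.
  apply: measurable_fun_ler; last exact: measurable_cst.
  exact: measurable_mark_arrival.
- move=> l lk; rewrite /excursion_idx /lineage_value.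
  apply: (@measurable_lineage _ (mark_sigma s t) R (count_eq s t k)
    (fun i w => T (Nt s w + i)%N w)
    (fun i w => theta (Nt s w + i)%N w) (fun i w => zeta (Nt s w + i)%N w) k) => //.
  + by move=> [//|j] jk; exact: measurable_mark_arrival.
  + by move=> j jk; exact: measurable_mark_theta.
  + by move=> j jk; exact: measurable_mark_zeta.
- by move=> w <-; apply: leq_sub2r; exact: homo.
Qed.
Lemma arrival_event_full s t a k : 0 <= s -> s <= t ->
  count_eq s t k `&` (Nt s @^-1` [set a]) = arrival_event s t a k (fun=> setT).
Proof.
move=> s0 st; have homo := poisson_homo P lam Nt HN.
apply/seteqP; split => w.
  by move=> [/= Nk Na]; split => //; rewrite -Nk -Na subnKC// homo.
by move=> [Na Nk _]; split => //; rewrite /count_eq/= Nk Na addKn.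
Qed.

Lemma measurable_mark_sum_Om s t : measurable_fun setT (fun w => msum w s t).
Proof.
apply: (measurable_fun_sub_sigma (mark_system s t)).
  exact: mark_system_measurable.
exact: measurable_mark_sum.
Qed.

Let K1 := kappa * V2 * expR (4 * C).

(** With k points, Cauchy-Schwarz bounds the square by k times the sum of squares, hence its
    integral by k^2 kappa V2 times the probability of k points. Summing against the Poisson bound
    gives [K1]. *)
Lemma mark_sum_second_moment_unit s t : 0 <= s -> s <= t -> t <= s + 1 ->
  (\int[P]_w (msum w s t ^+ 2)%:E <= K1%:E)%E.
Proof.
move=> s0 st ts1; have t0 := le_trans s0 st.
have kV : 0 <= kappa * V2 by rewrite mulr_ge0// V2_ge0.
have mcount : measurable_fun setT (fun w => Nt t w - Nt s w)%N.
  exact: measurable_increment.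
have mceq k : measurable (count_eq s t k).
  by have := mcount measurableT [set k] Logic.I; rewrite setTI.
have mNs a : measurable (Nt s @^-1` [set a]).
  by rewrite -[X in measurable X]setTI; exact: measurable_funP.
have mS : measurable_fun setT (fun w => (msum w s t ^+ 2)%:E).
  by apply/measurable_EFinP; apply: measurable_funX; exact: measurable_mark_sum_Om.
have S0 w : (0 <= (msum w s t ^+ 2)%:E)%E by rewrite lee_fin sqr_ge0.
rewrite (integral_countable_partition P (fun w => Nt t w - Nt s w)%N)//.
apply: le_trans (_ : \sum_(k <oo) ((k ^ 2)%:R * (kappa * V2))%:E *
    P (count_eq s t k) <= _)%E.
  apply: lee_nneseries => [k _ _|k _].
    by apply: integral_ge0 => w _.
  rewrite setTI -/(count_eq s t k).
  rewrite (integral_countable_partition P (Nt s) _ (count_eq s t k))//.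
  rewrite [P (count_eq s t k)](measure_countable_partition P (Nt s))//.
  rewrite -nneseriesZl//; apply: lee_nneseries => [a _ _|a _].
    by apply: integral_ge0 => w _.
  rewrite arrival_event_full//; set A := arrival_event _ _ _ _ _.
  have mA : measurable A by exact: measurable_arrival_event.
  have [E FE AE] := arrival_event_sigma s t a k (fun=> setT) s0 t0 (fun=> measurableT).
  have mz i : measurable_fun setT (fun w => (zeta (a + i.+1)%N w ^+ 2)%:E).
    apply/measurable_EFinP; apply: measurable_funX.
    by apply: (measurableT_comp measurable_zeta_of); exact: measurable_funP.
  apply: le_trans (_ : \int[P]_(w in A)
      (k%:R%:E * \sum_(i < k) (zeta (a + i.+1)%N w ^+ 2)%:E) <= _)%E.
    apply: ge0_le_integral => //.
    - exact: measurable_funTS.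
    - apply: measurable_funTS; apply: measurable_funeM.
      by apply: emeasurable_sum => i; exact: mz.
    - move=> w [Na Nk _]; rewrite sumEFin -EFinM lee_fin /mark_sum Na Nk addKn.
      rewrite big_add1 big_mkord/=.
      apply: le_trans (sqr_sum_le _ _) _.
      rewrite ler_wpM2l//; apply: ler_sum => i _.
      by rewrite real_normK ?num_real.
  rewrite ge0_integralZl//; last 2 first.
  - by apply: measurable_funTS; apply: emeasurable_sum => i; exact: mz.
  - by move=> w _; apply: sume_ge0 => i _; rewrite lee_fin sqr_ge0.
  rewrite ge0_integral_sum//; last 2 first.
  - by move=> i; apply: measurable_funTS; exact: mz.
  - by move=> i w _; rewrite lee_fin sqr_ge0.
  apply: le_trans (_ : k%:R%:E * \sum_(i < k) ((kappa * V2)%:E * P A) <= _)%E.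
    rewrite lee_wpmul2l ?lee_fin//; apply: lee_sum => i _.
    by rewrite addnS; exact: (mark_second_moment _ A E mA FE AE).
  have -> : P A = (fine (P A))%:E by rewrite fineK// fin_num_measure.
  rewrite -EFinM sumEFin -!EFinM lee_fin sumr_const card_ord -[X in _ * X <= _]mulr_natl natrX.
  by rewrite expr2 !mulrA.
apply: le_trans (_ : \sum_(k <oo) ((kappa * V2)%:E *
    ((k ^ 2)%:R * (C ^+ k / k`!%:R))%:E) <= _)%E.
  apply: lee_nneseries => [k _ _|k _]; first by rewrite mule_ge0// lee_fin mulr_ge0.
  rewrite mulrC EFinM -muleA lee_wpmul2l ?lee_fin// EFinM lee_wpmul2l ?lee_fin//.
  apply: le_trans (increment_le s t k s0 st) _.
  rewrite lee_fin ler_wpM2r ?invr_ge0// lerXn2r ?nnegrE ?mulr_ge0 ?subr_ge0//.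
  by rewrite -[leRHS]mulr1 ler_wpM2l// lerBlDl.
rewrite nneseriesZl; last by move=> k _; rewrite lee_fin mulr_ge0// divr_ge0// exprn_ge0.
rewrite /K1 [X in (_ <= X)%E]EFinM lee_wpmul2l ?lee_fin//.
exact: poisson_prob_sq_summable.
Qed.

Hypothesis no_arrival_ge : forall s t, 0 <= s -> s <= t ->
  ((expR (- (C * (t - s))))%:E <= P [set w | (Nt t w - Nt s w)%N = 0%N])%E.

Let K1_ge0 : 0 <= K1.
Proof. by rewrite /K1 !mulr_ge0 ?expR_ge0// V2_ge0. Qed.

(** Cauchy-Schwarz over the n unit intervals is lossy, but the order n^2 is what the blocks of
    length n can afford. *)
Lemma mark_sum_second_moment a n :
  (\int[P]_w (msum w a%:R (a + n)%:R ^+ 2)%:E <= (n%:R ^+ 2 * K1)%:E)%E.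
Proof.
have homo w := poisson_homo P lam Nt HN w.
have mS i : measurable_fun setT (fun w => (msum w (a + i)%:R (a + i.+1)%:R ^+ 2)%:E).
  by apply/measurable_EFinP; apply: measurable_funX; exact: measurable_mark_sum_Om.
apply: le_trans (_ : \int[P]_w (n%:R%:E * \sum_(i < n)
    (msum w (a + i)%:R (a + i.+1)%:R ^+ 2)%:E) <= _)%E.
  apply: ge0_le_integral => //.
  - by move=> w _; rewrite lee_fin sqr_ge0.
  - apply/measurable_EFinP; apply: measurable_funX; exact: measurable_mark_sum_Om.
  - by apply: measurable_funeM; apply: emeasurable_sum => i; exact: mS.
  - move=> w _; rewrite sumEFin -EFinM lee_fin.
    rewrite (mark_sum_unit_intervals (Nt ^~ w) (zeta ^~ w) (homo w)).
    exact: sqr_sum_le.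
rewrite ge0_integralZl//; last 2 first.
- by apply: emeasurable_sum => i; exact: mS.
- by move=> w _; apply: sume_ge0 => i _; rewrite lee_fin sqr_ge0.
rewrite ge0_integral_sum//; last by move=> i w _; rewrite lee_fin sqr_ge0.
apply: le_trans (_ : n%:R%:E * \sum_(i < n) K1%:E <= _)%E.
  rewrite lee_wpmul2l ?lee_fin//; apply: lee_sum => i _.
  apply: mark_sum_second_moment_unit; rewrite ?ler_nat ?leq_add2l//.
  by rewrite addnS natr1.
by rewrite sumEFin -EFinM lee_fin sumr_const card_ord -[X in _ * X <= _]mulr_natl mulrA.
Qed.

Let xi n j w : R :=
  block_increment (Nt ^~ w) (T ^~ w) (theta ^~ w) (zeta ^~ w) n j.

Lemma measurable_block_increment n j : measurable_fun setT
  (xi n j : mark_sigma (j * n)%:R (j.+2 * n)%:R -> R).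
Proof.
have blk i k : (i <= k)%N -> (i * n)%:R <= (k * n)%:R :> R.
  by move=> ik; rewrite ler_nat leq_mul2r ik orbT.
by apply: measurable_funB; apply: measurable_excursion; rewrite ?ler0n//;
  apply: blk; lia.
Qed.

Lemma block_increment_le n j w :
  xi n j w ^+ 2 <= 4 * msum w (j * n)%:R (j * n + 2 * n)%:R ^+ 2.
Proof.
have homo := poisson_homo P lam Nt HN w.
have jn0 : 0 <= (j * n)%:R :> R by rewrite ler0n.
have E2 : (j.+2 * n = j * n + 2 * n)%N by lia.
have le_msum u : (j * n)%:R <= u -> u <= (j * n + 2 * n)%:R ->
    `|exc w (j * n)%:R u| <= msum w (j * n)%:R (j * n + 2 * n)%:R.
  move=> ju uj; apply: le_trans (norm_excursion _ _ _ _ _ _) _.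
  by apply: (mark_sum_le (Nt ^~ w) (zeta ^~ w) homo) => //;
    rewrite in_itv/= ?lexx ?ju ?uj ?(le_trans ju).
have := le_msum (j.+2 * n)%:R; have := le_msum (j.+1 * n)%:R.
have blk i k : (i <= k)%N -> (i * n)%:R <= (k * n)%:R :> R.
  by move=> ik; rewrite ler_nat leq_mul2r ik orbT.
rewrite -E2 => /(_ (blk _ _ (leqnSn _)) (blk _ _ (leqnSn _))) H1.
move=> /(_ (blk _ _ (leqW (leqnSn _))) (lexx _)) H2.
rewrite /xi /block_increment.
set x := exc w _ _ in H2 *; set y := exc w _ _ in H1 *; set S := msum w _ _ in H1 H2 *.
have : `|x - y| <= 2 * S by apply: le_trans (ler_normB _ _) _; lra.
move=> H; rewrite -[(x - y) ^+ 2]real_normK ?num_real//.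
have -> : 4 * S ^+ 2 = (2 * S) ^+ 2 by ring.
by rewrite lerXn2r// nnegrE// mulr_ge0// mark_sum_ge0.
Qed.

(** 16 is the product of two factors 4: two excursion values, each at most the mark sum, and a
    window of length 2 n. *)
Lemma block_increment_second_moment n j : square_integrable P (xi n j) /\
  Rintegral P setT (fun w => xi n j w ^+ 2) <= 16 * n%:R ^+ 2 * K1.
Proof.
have mxi : measurable_fun setT (xi n j).
  apply: (measurable_fun_sub_sigma (mark_system (j * n)%:R (j.+2 * n)%:R)).
    exact: mark_system_measurable.
  exact: measurable_block_increment.
have bound : (\int[P]_w (xi n j w ^+ 2)%:E <= (16 * n%:R ^+ 2 * K1)%:E)%E.
  apply: le_trans (_ : \int[P]_w (4%:E *
      (msum w (j * n)%:R (j * n + 2 * n)%:R ^+ 2)%:E) <= _)%E.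
    apply: ge0_le_integral => //.
    - by move=> w _; rewrite lee_fin sqr_ge0.
    - by apply/measurable_EFinP; exact: measurable_funX.
    - apply: measurable_funeM; apply/measurable_EFinP; apply: measurable_funX.
      exact: measurable_mark_sum_Om.
    - by move=> w _; rewrite -EFinM lee_fin; exact: block_increment_le.
  rewrite ge0_integralZl//; last 2 first.
  - apply/measurable_EFinP; apply: measurable_funX; exact: measurable_mark_sum_Om.
  - by move=> w _; rewrite lee_fin sqr_ge0.
  apply: le_trans (_ : 4%:E * ((2 * n)%:R ^+ 2 * K1)%:E <= _)%E.
    by rewrite lee_wpmul2l ?lee_fin//; exact: mark_sum_second_moment.
  by rewrite -EFinM lee_fin natrM; lra.
have ixi : P.-integrable setT (fun w => (xi n j w ^+ 2)%:E).
  apply/integrableP; split; first by apply/measurable_EFinP; exact: measurable_funX.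
  under eq_integral do rewrite gee0_abs ?lee_fin ?sqr_ge0//.
  exact: le_lt_trans bound (ltry _).
split; first by split.
by rewrite -lee_fin /Rintegral fineK//; exact: integrable_fin_num.
Qed.

Lemma independent_block_increments n j l : (j.+1 < l)%N ->
  independent_functions P (xi n j) (xi n l).
Proof.
move=> jl A B mA mB.
have H := independent_marks (j * n)%:R (j.+2 * n)%:R (l * n)%:R (l.+2 * n)%:R.
apply: H.
- by rewrite ler0n.
- by rewrite ler_nat leq_mul2r !leqW ?orbT.
- by rewrite ler_nat leq_mul2r jl orbT.
- by rewrite ler_nat leq_mul2r !leqW ?orbT.
- rewrite -[X in <<s _ >> X]setTI.
  exact: (measurable_block_increment n j measurableT A mA).
- rewrite -[X in <<s _ >> X]setTI.
  exact: (measurable_block_increment n l measurableT B mB).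
Qed.

(** 48 is 3 times 16: the one-dependent bound 3 B J with B = 16 n^2 K1 and J at most n^2. *)
Lemma block_increments_variance n :
  (\int[P]_w ((\sum_(j < (n ^ 2).-1) centred P (xi n j) w) ^+ 2)%:E <=
    (48 * K1 * n%:R ^+ 4)%:E)%E.
Proof.
have sx j : square_integrable P (xi n j).
  by have [] := block_increment_second_moment n j.
have xB j : Rintegral P setT (fun w => xi n j w ^+ 2) <= 16 * n%:R ^+ 2 * K1.
  by have [] := block_increment_second_moment n j.
have H := one_dependent_variance P (xi n) _ (n ^ 2).-1 sx xB
  (independent_block_increments n).
have ss : square_integrable P
    (fun w => \sum_(j < (n ^ 2).-1) centred P (xi n j) w).
  by apply: square_integrable_sum => j; exact: square_integrable_centred.
have fin := integrable_fin_num measurableT ss.2.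
rewrite -[leLHS]fineK// lee_fin; apply: le_trans H _.
have : ((n ^ 2).-1%:R : R) <= n%:R ^+ 2 by rewrite -natrX ler_nat leq_pred.
have n2 : 0 <= n%:R ^+ 2 * K1 by rewrite mulr_ge0// exprn_ge0.
move=> /(ler_wpM2l n2); rewrite (_ : n%:R ^+ 4 = n%:R ^+ 2 * n%:R ^+ 2); last by ring.
by lra.
Qed.

(* The deterministic centring; the CLT is used only to find its limit. *)
Definition increments_mean n : R :=
  \sum_(j < (n ^ 2).-1) Rintegral P setT (xi n j).

Lemma ae_block_increments_cvg : {ae P, forall w,
  (\sum_(j < (n ^ 2).-1) xi n j w - increments_mean n) / (n ^ 3)%:R
    @[n --> \oo] --> 0}.
Proof.
have mc n j : measurable_fun setT (centred P (xi n j)).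
  have [[mxi _] _] := block_increment_second_moment n j.
  by apply: measurable_funB => //; exact: measurable_cst.
have := fourth_power_moment_ae_cvg0 P
  (fun n w => \sum_(j < (n ^ 2).-1) centred P (xi n j) w) (48 * K1).
move=> /(_ (mulr_ge0 (ler0n _ _) K1_ge0)) H.
have {H} : {ae P, forall w, (\sum_(j < (n ^ 2).-1) centred P (xi n j) w)
    / (n ^ 3)%:R @[n --> \oo] --> 0}.
  apply: H => [n|n _]; last exact: block_increments_variance.
  by apply: measurable_sum => j; exact: mc.
by apply: filterS => w; under eq_fun do rewrite sumrB.
Qed.

Lemma ae_mark_sums_cvg : {ae P, forall w,
  (msum w 0 n%:R + 2 * msum w ((n ^ 2).-1 * n)%:R (n.+1 ^ 3)%:R) / (n ^ 3)%:R
    @[n --> \oo] --> 0}.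
Proof.
have a1 := fourth_power_moment_ae_cvg0 P (fun n w => msum w 0 n%:R) K1 K1_ge0.
have a2 := fourth_power_moment_ae_cvg0 P
  (fun n w => msum w ((n ^ 2).-1 * n)%:R (n.+1 ^ 3)%:R) (64 * K1)
  (mulr_ge0 (ler0n _ _) K1_ge0).
have {}a1 : {ae P, forall w, msum w 0 n%:R / (n ^ 3)%:R @[n --> \oo] --> 0}.
  apply: a1 => [n|n n0]; first exact: measurable_mark_sum_Om.
  have := mark_sum_second_moment 0 n; rewrite add0n => /le_trans; apply.
  rewrite lee_fin mulrC ler_wpM2l ?K1_ge0// -!natrX ler_nat.
  exact: leq_pexp2l.
have {}a2 : {ae P, forall w, msum w ((n ^ 2).-1 * n)%:R (n.+1 ^ 3)%:R /
    (n ^ 3)%:R @[n --> \oo] --> 0}.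
  apply: a2 => [n|n n0]; first exact: measurable_mark_sum_Om.
  (* The length of the window from (n^2 - 1) n to (n + 1)^3. It is at most 8 n^2, whence 64 n^4 for
     the second moment. *)
  pose b := (3 * n ^ 2 + 4 * n + 1)%N.
  have bE : (n.+1 ^ 3 = (n ^ 2).-1 * n + b)%N.
    have : (n ^ 3 = (n ^ 2).-1 * n + n)%N.
      by rewrite addnC -mulSn prednK ?expn_gt0 ?n0// -expnSr.
    by rewrite /b !expnS !expn0 !muln1; lia.
  have b8 : (b <= 8 * n ^ 2)%N by rewrite /b; nia.
  rewrite bE; apply: le_trans (mark_sum_second_moment _ _) _.
  rewrite lee_fin [leRHS]mulrAC ler_wpM2r ?K1_ge0//.
  apply: le_trans (_ : (8 * n ^ 2)%:R ^+ 2 <= _).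
    by rewrite lerXn2r ?nnegrE// ler_nat.
  by rewrite natrM natrX; lra.
apply: filterS2 a1 a2 => w a1 a2.
have a3 : msum w 0 n%:R / (n ^ 3)%:R + 2 * (msum w ((n ^ 2).-1 * n)%:R
    (n.+1 ^ 3)%:R / (n ^ 3)%:R) @[n --> \oo] --> 0 + 2 * (0 : R).
  by apply: cvgD => //; apply: cvgMr.
rewrite mulr0 addr0 in a3; apply: cvg_trans a3; apply: near_eq_cvg.
by apply: nearW => n; rewrite mulrA -mulrDl.
Qed.

(** * Almost surely, all late blocks contain a gap *)

(** Only the unit intervals with integer endpoints are tested: their counts are independent, and a
    single empty one provides a gap. *)
Let crowded n j : set Om := \bigcap_(i in `I_n)
  [set w | (Nt (j * n + i.+1)%:R w - Nt (j * n + i)%:R w)%N <> 0%N].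

Let mno s t : measurable [set w | (Nt t w - Nt s w)%N = 0%N].
Proof.
rewrite -[X in measurable X]setTI.
exact: (measurable_increment P Nt s t measurableT [set 0%N] Logic.I).
Qed.

Let measurable_crowded n j : measurable (crowded n j).
Proof. by apply: bigcap_measurableType => i _; apply: measurableC; exact: mno. Qed.

Lemma probability_crowded n j :
  (P (crowded n j) <= ((1 - expR (- C)) ^+ n)%:E)%E.
Proof.
case: HN => _ _ _ indep _.
rewrite (indep n (fun i => (j * n + i)%:R) (fun=> [set k | k <> 0%N])) //; last first.
  by move=> i; rewrite ler_nat leq_add2l.
have p0 : 0 <= 1 - expR (- C) by rewrite subr_ge0 -expR0 ler_expR oppr_le0.
have mY i : measurable [set w | (Nt (j * n + i.+1)%:R w - Nt (j * n + i)%:R w)%N <> 0%N].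
  by apply: measurableC; exact: mno.
rewrite (eq_bigr (fun i : 'I_n => (fine (P [set w |
    (Nt (j * n + i.+1)%:R w - Nt (j * n + i)%:R w)%N <> 0%N]))%:E)); last first.
  by move=> i _; rewrite fineK// fin_num_measure.
rewrite prodEFin lee_fin -[n in leRHS]card_ord -prodr_const.
apply: ler_prod => i _; rewrite fine_ge0//= -lee_fin fineK ?fin_num_measure//.
have := no_arrival_ge (j * n + i)%:R (j * n + i.+1)%:R.
rewrite ler0n ler_nat leq_add2l leqnSn => /(_ isT isT).
rewrite -natrB ?leq_add2l// subnDl subSnn mulr1 => H.
rewrite -[X in P X]setCK probability_setC; last by apply: measurableC; exact: mY.
rewrite EFinB leeB// (_ : ~` _ = [set w |
  (Nt (j * n + i.+1)%:R w - Nt (j * n + i)%:R w)%N = 0%N])//.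
by apply/seteqP; split => w /= => [/contrapT|->].
Qed.

(** The expected number of crowded blocks is at most n^2 (1 - e^-C)^n, which is summable. *)
Lemma ae_block_gaps : {ae P, forall w, exists n1, (0 < n1)%N /\
  forall n j, (n1 <= n)%N -> (j < n ^ 2)%N -> block_gap (Nt ^~ w) n j}.
Proof.
pose f n w : R := \sum_(j < n ^ 2) \1_(crowded n j) w.
(* With p = e^-C, (1 - p)^n <= e^(-n p) and (n p)^4 <= 4! e^(n p) give n^4 (1 - p)^n <= 24 / p^4. *)
pose K : R := 24 / expR (- C) ^+ 4.
have e0 : 0 < expR (- C) by exact: expR_gt0.
have K0 : 0 <= K by rewrite divr_ge0// exprn_ge0// ltW.
have mf n : measurable_fun setT (f n).
  by apply: measurable_sum => j; apply: measurable_indic.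
have f0 n w : 0 <= f n w by apply: sumr_ge0 => j _.
have fK n : (\int[P]_w (f n w)%:E <= (K * n%:R ^- 2)%:E)%E.
  under eq_integral do rewrite -sumEFin.
  rewrite ge0_integral_sum//; last first.
    by move=> j; apply/measurable_EFinP; apply: measurable_indic.
  apply: le_trans (_ : \sum_(j < n ^ 2) ((1 - expR (- C)) ^+ n)%:E <= _)%E.
    apply: lee_sum => j _; rewrite integral_indic// setIT.
    exact: probability_crowded.
  rewrite sumEFin lee_fin sumr_const card_ord -[leLHS]mulr_natl natrX.
  have [->|n0] := posnP n; first by rewrite expr0n/= mul0r invr0 mulr0.
  have nR : 0 < n%:R :> R by rewrite ltr0n.
  rewrite ler_pdivlMr ?exprn_gt0// mulrAC -exprD ler_pdivlMr ?exprn_gt0//.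
  rewrite mulrAC -exprMn.
  have e1 : 0 <= 1 - expR (- C) by rewrite subr_ge0 -expR0 ler_expR oppr_le0.
  have ne0 : 0 <= n%:R * expR (- C) by rewrite mulr_ge0// ltW.
  apply: le_trans (_ : (24 * expR (n%:R * expR (- C))) *
      expR (- (n%:R * expR (- C))) <= _); last by rewrite -mulrA -expRD subrr expR0 mulr1.
  apply: ler_pM; rewrite ?exprn_ge0//.
    have := expR_ge_monomial _ 4 ne0.
    by rewrite ler_pdivrMr ?ltr0n// => /le_trans; apply; rewrite [leLHS]mulrC.
  rewrite mulrC -mulNr mulrC expRM_natl lerXn2r ?nnegrE ?expR_ge0//.
  exact: expR_ge1Dx.
have := inv_sqr_integral_ae_cvg0 P f K K0 mf f0 fK.
apply: filterS => w /= /cvgrPdist_lt /(_ _ ltr01)[n1 _ Hn1].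
exists n1.+1; split => // n j n1n jn2.
(* The number of crowded blocks is below 1, so there is none. *)
have /= := Hn1 n (ltnW n1n); rewrite sub0r normrN ger0_norm// => fn.
have ncr : ~ crowded n j w.
  move=> cr; move: fn; rewrite /f (bigD1 (Ordinal jn2))//= indicE mem_set//.
  by rewrite ltNge lerDl sumr_ge0// => k _.
have [i /= ij] : exists2 i, (i < n)%N &
    (Nt (j * n + i.+1)%:R w - Nt (j * n + i)%:R w)%N = 0%N.
  apply: contrapT => H; apply: ncr => i /= ij E; apply: H.
  by exists i.
move=> /eqP; rewrite subn_eq0 => le1.
exists (j * n + i.+1)%N.
  by rewrite addnS ltnS leq_addr/= mulSn; lia.
rewrite addnS -natr1 addrK; apply/eqP; rewrite eqn_leq natr1 -addnS le1/=.
by apply: (poisson_homo P lam Nt HN); rewrite ?ler_nat ?leq_add2l.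
Qed.

(** * Almost sure behaviour of one coordinate *)

Variables (U X : R -> {RV P >-> 'cV[R]_N}).
Hypothesis Y_range : forall n w, (0 < n)%N -> -1 <= (Y n w).1 <= 0.
Hypothesis X_path :
  {ae P, forall w, delayed_path (U ^~ w) (T ^~ w) (Y ^~ w) (X ^~ w)}.

Let ae_value_bound : {ae P, forall w, exists c n1,
  forall n t, (n1 <= n)%N -> (n ^ 3)%:R <= t <= (n.+1 ^ 3)%:R ->
    `|X t w i0 0 - c - \sum_(j < (n ^ 2).-1) xi n j w| <=
      msum w 0 n%:R + 2 * msum w ((n ^ 2).-1 * n)%:R (n.+1 ^ 3)%:R}.
Proof.
apply: filterS3 infN ae_block_gaps X_path => w good [n1 [n10 gaps]] pathX.
have gal n t : 0 <= t -> (n <= Nt t w)%N = (T n w <= t).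
  exact: good_galois.
have [c xc] := value_block_increments (Nt ^~ w) (T ^~ w) (theta ^~ w)
  (zeta ^~ w) (fun n => arrival_ge0 n w) gal (fun n => Y_range n w)
  (fun t => X t w i0 0) (fun k => X (T k w) w i0 0)
  (fun t t0 => congr1 (fun v : 'cV[R]_N => v i0 0)
     (delayed_path_constant _ _ _ _ _ gal pathX t t0))
  (delayed_path_reproduces _ _ _ _ i0 pathX) n1 n10 gaps.
by exists c, n1.
Qed.

Lemma ae_coordinate_at_cubes : {ae P, forall w,
  X (n ^ 3)%:R w i0 0 / (n ^ 3)%:R - increments_mean n / (n ^ 3)%:R
    @[n --> \oo] --> 0}.
Proof.
apply: filterS3 ae_value_bound ae_block_increments_cvg ae_mark_sums_cvg.
move=> w [c [n1 xF]] aM F0.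
exact: (cvg_at_cubes (fun t => X t w i0 0) c _ _ _ n1 xF aM F0).
Qed.

Lemma ae_coordinate_cvg (K : R) :
  increments_mean n / (n ^ 3)%:R @[n --> \oo] --> K ->
  {ae P, forall w, X t w i0 0 / t @[t --> +oo] --> K}.
Proof.
move=> MK; apply: filterS3 ae_value_bound ae_block_increments_cvg ae_mark_sums_cvg.
move=> w [c [n1 xF]] aM F0.
exact: (cvg_between_cubes (fun t => X t w i0 0) c _ _ _ K n1 xF aM F0 MK).
Qed.

End marks.

(** * Bounds and measurability of the intensity and of the mark laws *)

Section continuity.
Context {R : realType}.

(** The open preimage of a half-line is a countable union of open rectangles with rational corners,
    which are measurable for the product sigma-algebra. *)
Lemma continuous_measurable_fun2 (f : R * R -> R) :
  continuous f -> measurable_fun setT f.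
Proof.
move=> cf; apply: (measurability _ (RGenOInfty.measurableE R)) => //.
move=> _ [_ [x ->] <-]; rewrite setTI.
pose rect (p : (rat * rat) * (rat * rat)) : set (R * R) :=
  `]ratr p.1.1, ratr p.1.2[ `*` `]ratr p.2.1, ratr p.2.2[.
pose F n : set (R * R) := if unpickle n is Some p then
  if `[< rect p `<=` f @^-1` `]x, +oo[ >] then rect p else set0 else set0.
suff -> : f @^-1` `]x, +oo[ = \bigcup_n F n.
  apply: bigcup_measurable => n _; rewrite /F; case: unpickle => // p.
  by case: ifP => // _; exact: measurableX.
apply/seteqP; split => [[a b] fab|ab [n _]]; last first.
  rewrite /F; case: unpickle => // p.
  by case: ifP => // /asboolP; exact.
have : nbhs (a, b) (f @^-1` `]x, +oo[).
  apply: cf; apply: open_nbhs_nbhs; split => //; exact: itv_open.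
move=> /nbhs_ballP[e /= e0 be].
have /rat_in_itvoo[p1 /itvP p1a] : a - e < a by rewrite ltrBlDr ltrDl.
have /rat_in_itvoo[p2 /itvP p2a] : a < a + e by rewrite ltrDl.
have /rat_in_itvoo[q1 /itvP q1a] : b - e < b by rewrite ltrBlDr ltrDl.
have /rat_in_itvoo[q2 /itvP q2a] : b < b + e by rewrite ltrDl.
pose p := ((p1, p2), (q1, q2)).
have FE n : unpickle n = Some p -> rect p `<=` f @^-1` `]x, +oo[ -> F n = rect p.
  by rewrite /F => -> /asboolP ->.
apply: (@bigcup_sup _ _ (pickle p) setT F Logic.I); rewrite (FE _ (pickleK p)).
  by split; rewrite /= in_itv/= ?p1a ?p2a ?q1a ?q2a.
move=> [a' b'] [/=]; rewrite !in_itv/= => /andP[pa ap] /andP[qb bq].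
apply: be; split; rewrite /ball/= ltr_distlC.
  by rewrite (lt_trans _ pa) ?p1a// (lt_trans ap) ?p2a.
by rewrite (lt_trans _ qb) ?q1a// (lt_trans bq) ?q2a.
Qed.

(** Turns continuity on a closed domain into plain continuity after clamping the argument into the
    domain. *)
Lemma continuous_within_comp {T U V : topologicalType} (A : set U) (f : U -> V)
    (g : T -> U) : {within A, continuous f} -> continuous g ->
  (forall x, A (g x)) -> continuous (f \o g).
Proof.
move=> /subspace_continuousP cf cg gA x B /= fB.
have := cf _ (gA x) _ fB; rewrite /within/= /nbhs/= => H.
have gH : \forall y \near x, A (g y) -> B (f (g y)) by exact: (cg x _ H).
by apply: (filterS _ gH) => y /=; apply.
Qed.

End continuity.

Section intensity.
Context {R : realType} {N : nat} (Q : probability (R * 'cV[R]_N)%type R).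
Hypothesis hQ : Q stateS = 1%E.
Variables (alpha : R -> R -> R) (alpha_inf : R -> R) (M beta : R).
Hypothesis alpha_gt0 :
  forall t th, 0 <= t -> -1 <= th -> th <= 0 -> 0 < alpha t th.
Hypothesis alpha_bounded : exists C : R,
  forall t th, 0 <= t -> -1 <= th -> th <= 0 -> alpha t th <= C.
Hypothesis alpha_continuous : {within [set t | 0 <= t] `*` `[-1, 0],
     continuous (fun y : R * R => alpha y.1 y.2)}.
Hypothesis alpha_inf_gt0 : forall th, -1 <= th -> th <= 0 -> 0 < alpha_inf th.
Hypothesis alpha_inf_continuous : {within `[-1, 0], continuous alpha_inf}.
Hypotheses (M_gt0 : 0 < M) (beta_gt0 : 0 < beta).
Hypothesis alpha_cvg : forall t th, 0 <= t -> -1 <= th -> th <= 0 ->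
     `|alpha t th - alpha_inf th| <= M * expR (- beta * t).

Definition clamp (x : R) : R := Num.min (Num.max x (- 1)) 0.

Lemma clamp_range x : -1 <= clamp x <= 0.
Proof. by rewrite /clamp le_min ge_min lexx orbT le_max lexx orbT lerN10. Qed.

Lemma clamp_id x : -1 <= x <= 0 -> clamp x = x.
Proof. by move=> /andP[x1 x0]; rewrite /clamp max_l// min_l. Qed.

Lemma measurable_stateS : measurable (stateS : set (R * 'cV[R]_N)).
Proof. exact: measurableX. Qed.

Lemma stateS_range (y : R * 'cV[R]_N) : stateS y -> -1 <= y.1 <= 0.
Proof. by move=> [/=]; rewrite in_itv. Qed.

(* Extension of [alpha] by clamping, to have it measurable everywhere. *)
Definition alpha_ext (y : R * R) : R := alpha (Num.max y.1 0) (clamp y.2).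

Lemma alpha_ext_gt0 y : 0 < alpha_ext y.
Proof.
have /andP[? ?] := clamp_range y.2.
by apply: alpha_gt0; rewrite // le_max lexx orbT.
Qed.

Lemma measurable_alpha_ext : measurable_fun setT alpha_ext.
Proof.
apply: continuous_measurable_fun2.
pose g (y : R * R) : R * R := (Num.max y.1 0, clamp y.2).
have cg : continuous g.
  have c1 : continuous (fun y : R * R => Num.max y.1 0 : R^o).
    by move=> y; apply: continuous_max; [exact: cvg_fst|exact: cvg_cst].
  have c2 : continuous (fun y : R * R => clamp y.2 : R^o).
    move=> y.
    apply: (@continuous_min _ _ (fun y : R * R => Num.max y.2 (- 1) : R^o) (cst 0));
      last exact: cvg_cst.
    by apply: continuous_max; [exact: cvg_snd|exact: cvg_cst].
  move=> y; exact: (@cvg_pair _ _ _ _ (nbhs (g y).1) (nbhs (g y).2) _ _ _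
    _ _ (c1 y) (c2 y)).
have gA y : ([set t : R | 0 <= t] `*` `[-1, 0]) (g y).
  split => /=; first by rewrite le_max lexx orbT.
  by rewrite in_itv/= clamp_range.
exact: (continuous_within_comp _ _ _ alpha_continuous cg gA).
Qed.

(** The lower bound comes from the positive minimum of [alpha_inf] for large times and from
    compactness for the others. It keeps the arrival rate away from 0 and the laws of the marks
    comparable to [Q]. *)
Lemma alpha_bounds : exists c C : R, [/\ 0 < c, 0 < C &
  forall t th, 0 <= t -> -1 <= th <= 0 -> c <= alpha t th <= C].
Proof.
have N10 : (-1 : R) <= 0 by rewrite lerN10.
have [C hC] := alpha_bounded.
have [th1 /itvP th1_range th1_min] := EVT_min N10 alpha_inf_continuous.
have c1_gt0 : 0 < alpha_inf th1 by apply: alpha_inf_gt0; rewrite th1_range.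
(* From e^x >= x, M e^(-beta t) <= M / (beta t), which for t >= t1 is at most half the minimum of
   [alpha_inf]. *)
pose t1 := 2 * M / (alpha_inf th1 * beta).
have t1_gt0 : 0 < t1 by rewrite divr_gt0// mulr_gt0.
have alpha_large t th : t1 <= t -> -1 <= th <= 0 -> alpha_inf th1 / 2 <= alpha t th.
  move=> tt1 /andP[th0 th2].
  have tpos : 0 < t by exact: lt_le_trans tt1.
  have := alpha_cvg t th (ltW tpos) th0 th2.
  rewrite ler_norml => /andP[+ _].
  have : alpha_inf th1 <= alpha_inf th by apply: th1_min; rewrite in_itv/= th0.
  suff : M * expR (- beta * t) <= alpha_inf th1 / 2 by lra.
  rewrite mulNr expRN ler_pdivrMr ?expR_gt0//.
  have : beta * t <= expR (beta * t).
    by have := expR_ge1Dx (beta * t); lra.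
  have : 2 * M <= alpha_inf th1 * (beta * t).
    rewrite mulrA -ler_pdivrMl ?mulr_gt0//.
    by rewrite mulrC.
  have := ltW c1_gt0.
  by nra.
have cpt : compact (`[0, t1] `*` `[-1, 0] : set (R * R)).
  by apply: compact_setX; exact: segment_compact.
have ne : (`[0, t1] `*` `[-1, 0] : set (R * R)) !=set0.
  by exists (0, 0); split; rewrite /= in_itv/= ?lexx ?(ltW t1_gt0)//= N10.
have cont : {within `[0, t1] `*` `[-1, 0],
    continuous (fun y : R * R => alpha y.1 y.2)}.
  apply: continuous_subspaceW alpha_continuous => -[t th] [/=].
  by rewrite !in_itv/= => /andP[].
have [[t2 th2]] := compact_EVT_min ne cpt cont.
rewrite inE => -[/=]; rewrite !in_itv/= => /andP[t20 _] /andP[th20 th21] min2.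
have c2_gt0 := alpha_gt0 t2 th2 t20 th20 th21.
exists (Num.min (alpha_inf th1 / 2) (alpha t2 th2)), (Num.max C 1); split.
- by rewrite lt_min divr_gt0.
- by rewrite lt_max ltr01 orbT.
move=> t th t0 /[dup] thS /andP[th_ge th_le]; apply/andP; split; last first.
  by rewrite le_max hC.
have [tt1|t1t] := leP t t1; last by rewrite ge_min alpha_large// ltW.
rewrite ge_min; apply/orP; right.
by apply: (min2 (t, th)); rewrite inE; split => /=; rewrite in_itv/= ?t0 ?th_ge.
Qed.

Let f_ B (t : R) (y : R * 'cV[R]_N) := alpha_ext (t, y.1) * \1_(stateS `&` B) y.

Lemma mark_integralE t B : 0 <= t -> measurable B ->
  (\int[Q]_(y in stateS `&` B) (alpha t y.1)%:E = \int[Q]_y (f_ B t y)%:E)%E.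
Proof.
move=> t0 mB; rewrite integral_mkcond; apply: eq_integral => y _.
rewrite patchE /f_ indicE; case: ifPn; last by rewrite mulr0.
rewrite inE => -[/stateS_range y1 _].
by rewrite mulr1 /alpha_ext/= clamp_id// max_l.
Qed.

Let measurable_f_ t B : measurable B ->
  measurable_fun setT (fun y => (f_ B t y)%:E).
Proof.
move=> mB; apply/measurable_EFinP; apply: measurable_funM.
  apply: (measurableT_comp measurable_alpha_ext).
  exact: measurable_fun_pair.
apply: measurable_indic; apply: measurableI => //; exact: measurable_stateS.
Qed.

(** Tonelli: joint measurability of the clamped integrand passes to the integral as a function of
    [t]. *)
Lemma measurable_mark_integral B : measurable B ->
  measurable_fun setT (fun t => \int[Q]_y (f_ B t y)%:E)%E.
Proof.
move=> mB.
apply: (@measurable_fun_fubini_tonelli_F _ _ _ _ _ Q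
  (fun z : R * (R * 'cV[R]_N) => (f_ B z.1 z.2)%:E)); last first.
  by move=> z; rewrite lee_fin mulr_ge0// ltW// alpha_ext_gt0.
apply/measurable_EFinP; apply: measurable_funM.
  apply: (measurableT_comp measurable_alpha_ext).
  apply: measurable_fun_pair; first exact: measurable_fst.
  exact: measurableT_comp.
apply: measurableT_comp => //; apply: measurable_indic.
by apply: measurableI => //; exact: measurable_stateS.
Qed.

Variables (c C : R).
Hypotheses (c_gt0 : 0 < c) (C_gt0 : 0 < C).
Hypothesis cC : forall t th, 0 <= t -> -1 <= th <= 0 -> c <= alpha t th <= C.

Lemma mark_integral_bounds t B : 0 <= t -> measurable B ->
  (c%:E * Q (stateS `&` B) <= \int[Q]_(y in stateS `&` B) (alpha t y.1)%:E
     <= C%:E * Q (stateS `&` B))%E.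
Proof.
move=> t0 mB.
have mSB : measurable (stateS `&` B).
  by apply: measurableI => //; exact: measurable_stateS.
have mint : measurable_fun (stateS `&` B) (fun y => (alpha t y.1)%:E).
  apply/measurable_EFinP.
  apply: (eq_measurable_fun (fun y => alpha_ext (t, y.1))).
    move=> y; rewrite inE => -[/stateS_range y1 _].
    by rewrite /alpha_ext/= clamp_id// max_l.
  apply: measurable_funTS; apply: (measurableT_comp measurable_alpha_ext).
  by apply: measurable_fun_pair.
rewrite -!integral_cst//; apply/andP; split; apply: ge0_le_integral => //.
- by move=> y _; rewrite lee_fin ltW.
- by move=> y [/stateS_range y1 _]; rewrite lee_fin; have /andP[] := cC t y.1 t0 y1.
- by move=> y [/stateS_range/andP[y1 y2] _]; rewrite lee_fin ltW// alpha_gt0.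
- by move=> y [/stateS_range y1 _]; rewrite lee_fin; have /andP[] := cC t y.1 t0 y1.
Qed.

Lemma mark_integral_fin_num t B : 0 <= t -> measurable B ->
  (\int[Q]_(y in stateS `&` B) (alpha t y.1)%:E \is a fin_num)%E.
Proof.
move=> t0 mB; have /andP[lb ub] := mark_integral_bounds t B t0 mB.
have mSB : measurable (stateS `&` B).
  by apply: measurableI => //; exact: measurable_stateS.
have fQ : Q (stateS `&` B) \is a fin_num by exact: fin_num_measure.
apply/fin_numP; split; apply/eqP => E; rewrite E in lb ub.
  by move: lb; rewrite leeNy_eq -(fineK fQ).
by move: ub; rewrite leye_eq -(fineK fQ).
Qed.

Lemma lambdaE t : lambda Q alpha t =
  fine (\int[Q]_(y in stateS `&` setT) (alpha t y.1)%:E)%E.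
Proof. by rewrite setIT. Qed.

Lemma lambda_bounds t : 0 <= t -> c <= lambda Q alpha t <= C.
Proof.
move=> t0; have /andP[lb ub] := mark_integral_bounds t setT t0 measurableT.
have fin := mark_integral_fin_num t setT t0 measurableT.
have QS : Q (stateS `&` setT) = 1%E by rewrite setIT.
rewrite QS !mule1 in lb ub.
by rewrite lambdaE -!lee_fin fineK// lb.
Qed.

Lemma lambda_gt0 t : 0 <= t -> 0 < lambda Q alpha t.
Proof.
by move=> t0; have /andP[+ _] := lambda_bounds t t0; exact: lt_le_trans.
Qed.

Lemma measurable_lambda : measurable_fun (`[0, +oo[ : set R) (lambda Q alpha).
Proof.
apply: (eq_measurable_fun (fun t => fine (\int[Q]_y (f_ setT t y)%:E)%E)).
  move=> t; rewrite inE/= in_itv/= andbT => t0.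
  by rewrite lambdaE mark_integralE.
apply: measurable_funTS; apply: measurableT_comp; first exact: fine_measurable.
exact: measurable_mark_integral.
Qed.

Lemma qlawT t : 0 <= t -> qlaw Q alpha t setT = 1.
Proof.
by move=> t0; rewrite /qlaw setIT mulVf// gt_eqF// lambda_gt0.
Qed.

Lemma qlaw_ge0 t B : 0 <= t -> 0 <= qlaw Q alpha t B.
Proof.
move=> t0; rewrite mulr_ge0// ?invr_ge0; first by rewrite ltW// lambda_gt0.
apply: fine_ge0; apply: integral_ge0 => y [/stateS_range/andP[y1 y2] _].
by rewrite lee_fin ltW// alpha_gt0.
Qed.

(** Origin of kappa = C / c: the numerator has density at most C with respect to [Q], and [lambda]
    is at least c because [Q] gives mass 1 to S. *)
Lemma qlaw_le t B : 0 <= t -> measurable B ->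
  qlaw Q alpha t B <= C / c * fine (Q B).
Proof.
move=> t0 mB.
have mSB : measurable (stateS `&` B).
  by apply: measurableI => //; exact: measurable_stateS.
have /andP[_ ub] := mark_integral_bounds t B t0 mB.
have /andP[lc lC] := lambda_bounds t t0.
have I0 : 0 <= fine (\int[Q]_(y in stateS `&` B) (alpha t y.1)%:E)%E.
  apply: fine_ge0; apply: integral_ge0 => y [/stateS_range/andP[y1 y2] _].
  by rewrite lee_fin ltW// alpha_gt0.
have IC : fine (\int[Q]_(y in stateS `&` B) (alpha t y.1)%:E)%E <= C * fine (Q B).
  rewrite -lee_fin EFinM !fineK ?fin_num_measure ?mark_integral_fin_num//.
  apply: le_trans ub _; rewrite lee_wpmul2l ?lee_fin ?(ltW C_gt0)//.
  by rewrite le_measure ?inE.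
rewrite [leRHS]mulrAC mulrC /qlaw mulrC.
apply: le_trans (_ : C * fine (Q B) * (lambda Q alpha t)^-1 <= _).
  by rewrite mulrC ler_wpM2r// invr_ge0 ltW// lambda_gt0.
by rewrite ler_wpM2l ?(le_trans I0)// lef_pV2 ?posrE// lambda_gt0.
Qed.

Lemma qlaw_le1 t B : 0 <= t -> measurable B -> qlaw Q alpha t B <= 1.
Proof.
move=> t0 mB; have l0 := lambda_gt0 t t0.
rewrite /qlaw ler_pdivrMl// mulr1 lambdaE.
rewrite -lee_fin /Rintegral !fineK ?mark_integral_fin_num//.
rewrite mark_integralE// mark_integralE//; apply: ge0_le_integral => //.
- by move=> y _; rewrite lee_fin mulr_ge0// ltW// alpha_ext_gt0.
- exact: measurable_f_.
- exact: measurable_f_.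
- move=> y _; rewrite lee_fin ler_wpM2l ?(ltW (alpha_ext_gt0 _))// !indicE setIT.
  by rewrite in_setI; case: (y \in stateS); case: (y \in B).
Qed.

Lemma measurable_qlaw B : measurable B ->
  measurable_fun (`[0, +oo[ : set R) (fun t => qlaw Q alpha t B).
Proof.
move=> mB; apply: measurable_funM.
  apply: (eq_measurable_fun (fun t => lambda Q alpha t `^ (-1))).
    move=> t; rewrite inE/= in_itv/= andbT => t0.
    by rewrite powR_inv1// ltW// lambda_gt0.
  exact: (measurableT_comp (measurable_powR (- 1)) measurable_lambda).
apply: (eq_measurable_fun (fun t => fine (\int[Q]_y (f_ B t y)%:E)%E)).
  move=> t; rewrite inE/= in_itv/= andbT => t0.
  by rewrite -mark_integralE.
apply: measurable_funTS; apply: measurableT_comp; first exact: fine_measurable.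
exact: measurable_mark_integral.
Qed.

Lemma integral_lambda_bounds s t : 0 <= s -> s <= t ->
  c * (t - s) <= \int[lebesgue_measure]_(r in `[s, t]) lambda Q alpha r
    <= C * (t - s).
Proof.
move=> s0 st; set I := `[s, t]%classic.
have lenE : lebesgue_measure I = (t - s)%:E.
  rewrite lebesgue_measure_itv/= lte_fin.
  by case: ltP => // ts; rewrite (le_anti (_ : t <= s <= t)) ?subrr ?ts.
have mI : measurable (I : set R) by exact: measurable_itv.
have I0 r : I r -> 0 <= r by rewrite /I/= in_itv/= => /andP[sr _]; exact: le_trans sr.
have ml : measurable_fun I (fun r => (lambda Q alpha r)%:E).
  apply/measurable_EFinP; apply: (measurable_funS _ _ measurable_lambda) => //.
  by move=> r /I0 r0; rewrite /= in_itv/= r0.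
have lb : (c%:E * (t - s)%:E <=
    \int[lebesgue_measure]_(r in I) (lambda Q alpha r)%:E)%E.
  rewrite -lenE -integral_cst//; apply: ge0_le_integral => //.
  - by move=> r _; rewrite lee_fin ltW.
  - by move=> r /I0 r0; rewrite lee_fin; have /andP[] := lambda_bounds r r0.
have ub : (\int[lebesgue_measure]_(r in I) (lambda Q alpha r)%:E <=
    C%:E * (t - s)%:E)%E.
  rewrite -lenE -integral_cst//; apply: ge0_le_integral => //.
  - by move=> r /I0 r0; rewrite lee_fin ltW// lambda_gt0.
  - by move=> r /I0 r0; rewrite lee_fin; have /andP[] := lambda_bounds r r0.
have fin : (\int[lebesgue_measure]_(r in I) (lambda Q alpha r)%:E)%E \is a fin_num.
  rewrite ge0_fin_numE; first exact: le_lt_trans ub (ltry _).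
  by apply: integral_ge0 => r /I0 r0; rewrite lee_fin ltW// lambda_gt0.
by rewrite -!lee_fin fineK// !EFinM lb ub.
Qed.

End intensity.

(** * Convergence in probability and the limit of the centring *)

Section convergence_in_probability.
Context {R : realType}.

(* The integral of [capped (x - y)] metrizes convergence in probability. *)
Definition capped (x : R) : R := Num.min 1 `|x|.

Lemma capped_ge0 x : 0 <= capped x.
Proof. by rewrite /capped le_min ler01 normr_ge0. Qed.

Lemma capped_le1 x : capped x <= 1.
Proof. by rewrite /capped ge_min lexx. Qed.

Lemma capped_le x y : `|x| <= `|y| -> capped x <= capped y.
Proof. by move=> xy; rewrite /capped le_min !ge_min lexx xy orbT. Qed.

Lemma cappedD x y : capped (x + y) <= capped x + capped y.
Proof.
have := ler_normD x y; have := normr_ge0 x; have := normr_ge0 y.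
rewrite /capped /Num.min; case: (ltP 1 `|x + y|) => a; case: (ltP 1 `|x|) => b;
  by case: (ltP 1 `|y|) => c; lra.
Qed.

Lemma continuous_capped : continuous capped.
Proof.
move=> x; apply: continuous_min; first exact: cvg_cst.
exact: norm_continuous.
Qed.

Lemma measurable_capped {d} {T : measurableType d} (f : T -> R) :
  measurable_fun setT f -> measurable_fun setT (fun w => capped (f w)).
Proof.
move=> mf; apply: (measurableT_comp _ mf).
exact: continuous_measurable_fun continuous_capped.
Qed.

Context {d} {Om : measurableType d} (P : probability Om R).

Lemma integrable_unit_bounded (f : Om -> R) : measurable_fun setT f ->
  (forall w, 0 <= f w <= 1) -> P.-integrable setT (EFin \o f).
Proof.
move=> mf f01; apply: (@le_integrable _ _ _ P setT measurableT _ (EFin \o cst 1)).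
- exact/measurable_EFinP.
- move=> w _; rewrite /= lee_fin normr1 ger0_norm; by case/andP: (f01 w).
- exact: finite_measure_integrable_cst.
Qed.

Lemma integrable_capped (f : Om -> R) : measurable_fun setT f ->
  P.-integrable setT (EFin \o (fun w => capped (f w))).
Proof.
move=> mf; apply: integrable_unit_bounded; first exact: measurable_capped.
by move=> w; rewrite capped_ge0 capped_le1.
Qed.

Lemma capped_ae_cvg0 (f : nat -> Om -> R) : (forall n, measurable_fun setT (f n)) ->
  {ae P, forall w, f n w @[n --> \oo] --> 0} ->
  \int[P]_w capped (f n w) @[n --> \oo] --> 0.
Proof.
move=> mf f0.
have ae_f : {ae P, forall w, setT w ->
    (fun n => (capped (f n w))%:E) n @[n --> \oo] --> 0%E}.
  apply: filterS f0 => w f0 _.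
  have := @continuous_cvg _ _ _ _ _ _ capped 0 (continuous_capped 0) f0.
  rewrite /capped normr0 min_r// => H.
  by apply/fine_cvgP; split; [exact: nearW|exact: H].
have dom : {ae P, forall w n, setT w ->
    (`|(capped (f n w))%:E| <= (EFin \o cst (1%R : R)) w)%E}.
  by apply: aeW => w n _; rewrite lee_fin ger0_norm ?capped_ge0// capped_le1.
have [_ _] := dominated_convergence measurableT
  (fun n => proj2 (measurable_EFinP _ _) (measurable_capped _ (mf n)))
  (measurable_cst 0%E) ae_f (finite_measure_integrable_cst P 1 measurableT) dom.
by rewrite integral0 => /fine_cvgP[_].
Qed.

Lemma cvg_capped (u : nat -> R) :
  capped (u n) @[n --> \oo] --> 0 -> u n @[n --> \oo] --> 0.
Proof.
move=> /cvgrPdist_lt H; apply/cvgrPdist_lt => e e0.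
have m0 : 0 < Num.min 1 e by rewrite lt_min ltr01.
apply: filterS (H _ m0) => n; rewrite !sub0r !normrN ger0_norm ?capped_ge0//.
rewrite /capped lt_min => /andP[]; rewrite !gt_min ltxx/= => u1.
by case/orP => // e1; rewrite (lt_trans u1).
Qed.

(** As [m n] is deterministic, capped (m_n - K) is its own expectation, at most E capped (x_n - m_n)
    + E capped (x_n - K), and both terms tend to 0. *)
Lemma cvg_mean_of_cvg_in_probability (x : nat -> Om -> R) (m : nat -> R) (K : R) :
  (forall n, measurable_fun setT (x n)) ->
  {ae P, forall w, x n w - m n @[n --> \oo] --> 0} ->
  \int[P]_w capped (x n w - K) @[n --> \oo] --> 0 ->
  m n @[n --> \oo] --> K.
Proof.
move=> mx xm xK.
have mxB (c : R) n : measurable_fun setT (fun w => x n w - c).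
  by apply: measurable_funB => //; exact: measurable_cst.
apply/subr_cvg0; apply: cvg_capped.
have xm0 := capped_ae_cvg0 (fun n w => x n w - m n) (fun n => mxB _ n) xm.
have H : \int[P]_w capped (x n w - m n) + \int[P]_w capped (x n w - K)
    @[n --> \oo] --> 0.
  by rewrite -[X in _ --> X](addr0 0); exact: cvgD.
apply: (squeeze_cvgr _ (cvg_cst (0 : R)) H).
apply: nearW => n; rewrite capped_ge0/=.
have -> : capped (m n - K) = \int[P]_w capped (m n - K).
  by rewrite expectation_cst_R.
rewrite -RintegralD//; try exact: integrable_capped.
apply: le_Rintegral => //.
- exact: finite_measure_integrable_cst.
- have i1 := integrable_capped _ (mxB (m n) n).
  have i2 := integrable_capped _ (mxB K n).
  exact: (integrableD measurableT i1 i2).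
- move=> w _; have -> : m n - K = - (x n w - m n) + (x n w - K) by ring.
  apply: le_trans (cappedD _ _) _; rewrite lerD2r; apply: capped_le.
  by rewrite normrN.
Qed.

End convergence_in_probability.

(** The deviation is the normalized one divided by sqrt t. Convergence in law needs a fixed test
    function, so sqrt t is replaced by a constant k + 1 <= sqrt t for which the limit law gives the
    test function an integral below e / 2. *)
Lemma clt_cvg_in_probability {d} {Om : measurableType d} {R : realType} {N : nat}
    (P : probability Om R) (X : R -> {RV P >-> 'cV[R]_N})
    (v : 'cV[R]_N) (G : probability 'cV[R]_N R) (i : 'I_N) :
  cvg_in_law P (fun t w => Num.sqrt t *: (t^-1 *: X t w - v)) G ->
  \int[P]_w capped (X t w i 0 / t - v i 0) @[t --> +oo] --> 0.
Proof.
move=> clt.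
have mcoord : measurable_fun setT (fun x : 'cV[R]_N => x i 0).
  exact: measurable_coord.
have tail : \int[G]_x capped (x i 0 / k.+1%:R) @[k --> \oo] --> 0.
  apply: (capped_ae_cvg0 G (fun k (x : 'cV[R]_N) => x i 0 / k.+1%:R)) => [k|].
    by apply: measurable_funM => //; exact: measurable_cst.
  apply: aeW => x; rewrite -[X in _ --> X](mulr0 (x i 0)).
  by apply: cvgMr; exact: cvg_harmonic.
apply/cvgrPdist_lt => e e0; have e2 : 0 < e / 2 by rewrite divr_gt0.
move/cvgrPdist_lt : tail => /(_ _ e2)[k _ /(_ k (leqnn _))].
pose f (x : 'cV[R]_N) := capped (x i 0 / k.+1%:R).
have fbc : bounded_continuous f.
  split; last by exists 1 => x; rewrite ger0_norm ?capped_ge0// capped_le1.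
  move=> x; apply: (@continuous_comp _ _ _ (fun x : 'cV[R]_N => x i 0 / k.+1%:R)
    capped); last exact: continuous_capped.
  have cx := @coord_continuous R N 1 i 0 x.
  exact: (cvgM cx (cvg_cst (k.+1%:R^-1 : R))).
rewrite /= sub0r normrN ger0_norm; last first.
  by apply: Rintegral_ge0 => x _; exact: capped_ge0.
move=> Ge; have /cvgrPdist_lt /(_ _ e2) := clt f fbc.
(* From (k + 1)^2 <= t on, dividing by k + 1 overestimates dividing by sqrt t. *)
have t1 : \forall t \near +oo, (k.+1%:R ^+ 2 : R) <= t by exact: nbhs_pinfty_ge.
apply: filterS2 t1 => t kt cl.
have t0 : 0 < t by apply: lt_le_trans kt; rewrite exprn_gt0.
have kst : k.+1%:R <= Num.sqrt t.
  by rewrite -[leLHS](ger0_norm (ler0n R k.+1)) -sqrtr_sqr ler_sqrt// ltW.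
rewrite sub0r normrN ger0_norm; last first.
  by apply: Rintegral_ge0 => w _; exact: capped_ge0.
have mX : measurable_fun setT (fun w => X t w i 0).
  by apply: (measurableT_comp mcoord); exact: measurable_funP.
pose Z w := Num.sqrt t * (t^-1 * X t w i 0 - v i 0) / k.+1%:R.
have fE w : f (Num.sqrt t *: (t^-1 *: X t w - v)) = capped (Z w).
  by rewrite /f !mxE.
apply: le_lt_trans (_ : \int[P]_w capped (Z w) < _).
  apply: le_Rintegral => //.
  - apply: integrable_capped; apply: measurable_funB; last exact: measurable_cst.
    by apply: measurable_funM => //; exact: measurable_cst.
  - apply: integrable_capped; apply: measurable_funM; last exact: measurable_cst.
    apply: measurable_funM; first exact: measurable_cst.
    apply: measurable_funB; last exact: measurable_cst.
    by apply: measurable_funM => //; exact: measurable_cst.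
  - move=> w _; apply: capped_le; rewrite /Z [t^-1 * _]mulrC mulrAC normrM.
    rewrite -[leLHS]mul1r ler_wpM2r//.
    by rewrite ger0_norm ?divr_ge0 ?sqrtr_ge0// ler_pdivlMr ?mul1r.
under eq_Rintegral do rewrite -fE.
have := ler_norm (\int[P]_w f (Num.sqrt t *: (t^-1 *: X t w - v)) - \int[G]_x f x).
by rewrite distrC; move: Ge cl; rewrite -/f; lra.
Qed.

(** * The limit law of the marks and the formula for the speed *)

Lemma expectation_distribution {d d'} {T : measurableType d} {S : measurableType d'}
    {R : realType} (P : probability T R) (X : {RV P >-> S}) (f : S -> R) :
  measurable_fun setT f ->
  ('E_P[fun w => f (X w)] = \int[distribution P X]_y (f y)%:E)%E.
Proof.
move=> /measurable_EFinP mf; rewrite unlock.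
have mX : measurable_fun setT X by exact: measurable_funP.
rewrite [LHS]integralE [RHS]integralE; congr (_ - _)%E.
- rewrite [RHS]ge0_integral_pushforward//; last exact: measurable_funepos.
  by rewrite preimage_setT; apply: eq_integral => x _; rewrite /= !funeposE.
- rewrite [RHS]ge0_integral_pushforward//; last exact: measurable_funeneg.
  by rewrite preimage_setT; apply: eq_integral => x _; rewrite /= !funenegE.
Qed.

Section limit_law.
Context {R : realType} {N : nat} (Q : probability (R * 'cV[R]_N)%type R).
Hypothesis hQ : Q stateS = 1%E.
Variable alpha_inf : R -> R.
Hypothesis alpha_inf_gt0 : forall th, -1 <= th -> th <= 0 -> 0 < alpha_inf th.
Hypothesis alpha_inf_continuous : {within `[-1, 0], continuous alpha_inf}.
Hypothesis Q_moment2 : (\int[Q]_(y in stateS) (\sum_i (y.2 i 0) ^+ 2)%:E < +oo)%E.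

Let S : set (R * 'cV[R]_N) := stateS.
Let a (y : R * 'cV[R]_N) : R := alpha_inf y.1.

Let mS : measurable S. Proof. exact: measurable_stateS. Qed.

Let alpha_inf_bounds : exists c C : R, 0 < c /\ 0 < C /\
  forall y, S y -> c <= a y <= C.
Proof.
have N10 : (-1 : R) <= 0 by rewrite lerN10.
have [th1 /itvP th1_range th1_min] := EVT_min N10 alpha_inf_continuous.
have [th2 /itvP th2_range th2_max] := EVT_max N10 alpha_inf_continuous.
exists (alpha_inf th1), (alpha_inf th2).
split; first by apply: alpha_inf_gt0; rewrite th1_range.
split; first by apply: alpha_inf_gt0; rewrite th2_range.
by move=> y /stateS_range yr; rewrite th1_min ?th2_max// in_itv.
Qed.

Let ma : measurable_fun S a.
Proof.
have mc : measurable_fun setT (fun x : R => alpha_inf (clamp x)).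
  apply: continuous_measurable_fun.
  apply: (continuous_within_comp _ _ _ alpha_inf_continuous).
    move=> x; apply: (@continuous_min _ _ (fun x : R => Num.max x (- 1) : R^o) (cst 0));
      last exact: cvg_cst.
    by apply: continuous_max; [exact: cvg_id|exact: cvg_cst].
  by move=> x; rewrite /= in_itv/= clamp_range.
apply: (eq_measurable_fun (fun y : R * 'cV[R]_N => alpha_inf (clamp y.1))).
  by move=> y; rewrite inE => /stateS_range yr; rewrite /a clamp_id.
by apply: measurable_funTS; exact: (measurableT_comp mc measurable_fst).
Qed.

(** The growth bound is wide enough for both the delay and each coordinate of the mark, and is
    integrable by the second moment assumption. *)
Let integrable_mark (g : R * 'cV[R]_N -> R) : measurable_fun setT g ->
  (forall y, S y -> `|g y| <= 1 + \sum_i (y.2 i 0) ^+ 2) ->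
  Q.-integrable S (fun y => (a y * g y)%:E).
Proof.
move=> mg gle; have [c [C [c0 [C0 aC]]]] := alpha_inf_bounds.
have sum0 (y : R * 'cV[R]_N) : 0 <= \sum_i (y.2 i 0) ^+ 2.
  by apply: sumr_ge0 => i _; exact: sqr_ge0.
have i2 : Q.-integrable S (fun y => (\sum_i (y.2 i 0) ^+ 2)%:E).
  apply/integrableP; split.
    apply/measurable_EFinP; apply: measurable_funTS; apply: measurable_sum => i.
    apply: measurable_funX; apply: (measurableT_comp (measurable_coord i)).
    exact: measurable_snd.
  by under eq_integral do rewrite gee0_abs ?lee_fin//.
have i1 := finite_measure_integrable_cst Q 1 mS.
apply: (@le_integrable _ _ _ Q S mS _
    (fun y => C%:E * (1%:E + (\sum_i (y.2 i 0) ^+ 2)%:E)))%E.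
- by apply/measurable_EFinP; apply: measurable_funM => //; exact: measurable_funTS.
- move=> y Sy; rewrite -EFinD -EFinM !abse_EFin lee_fin !normrM.
  have /andP[ca aCy] := aC y Sy.
  have s0 : 0 <= 1 + \sum_i (y.2 i 0) ^+ 2 by rewrite addr_ge0.
  rewrite (ger0_norm (ltW C0)) (ger0_norm s0); apply: ler_pM => //; last exact: gle.
  by rewrite ger0_norm// (le_trans (ltW c0)).
- by apply: integrableZl => //; exact: (integrableD mS i1 i2).
Qed.

Let integrable_mark0 : Q.-integrable S (fun y => (a y)%:E).
Proof.
have := integrable_mark (cst 1) (measurable_cst _).
under [X in Q.-integrable S X]eq_fun do rewrite mulr1.
apply => y _; rewrite normr1 lerDl; apply: sumr_ge0 => i _; exact: sqr_ge0.
Qed.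

Let lam_gt0 : 0 < lambda_inf Q alpha_inf.
Proof.
have [c [C [c0 [_ aC]]]] := alpha_inf_bounds.
apply: (lt_le_trans c0); rewrite -lee_fin fineK; last exact: integrable_fin_num.
have -> : c%:E = (\int[Q]_(y in S) (cst c%:E) y)%E.
  by rewrite integral_cst// [X in (_ * X)%E]hQ mule1.
apply: ge0_le_integral => //.
- by move=> y _; rewrite /= lee_fin ltW.
- exact/measurable_EFinP.
- by move=> y Sy; rewrite lee_fin; have /andP[] := aC y Sy.
Qed.

(** The limit law has density [alpha_inf] / [lambda_inf] on S with respect to [Q], so the factor
    [lambda_inf] cancels its normalization. *)
Lemma expectation_limit_law d' (Om' : measurableType d') (P' : probability Om' R)
    (Yinf : {RV P' >-> (R * 'cV[R]_N)%type}) (g : R * 'cV[R]_N -> R) :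
  (forall B, measurable B ->
     distribution P' Yinf B = (qlaw_inf Q alpha_inf B)%:E) ->
  measurable_fun setT g ->
  (forall y, S y -> `|g y| <= 1 + \sum_i (y.2 i 0) ^+ 2) ->
  lambda_inf Q alpha_inf * fine ('E_P'[fun w => g (Yinf w)]) =
    \int[Q]_(y in stateS) (alpha_inf y.1 * g y).
Proof.
move=> lawY mg gle; set li := lambda_inf Q alpha_inf.
have a_ge0 y : S y -> 0 <= a y.
  by move=> /stateS_range/andP[y1 y2]; rewrite ltW// alpha_inf_gt0.
pose w y : R := li^-1 * (a \_ S) y.
have maS : measurable_fun setT (a \_ S) by exact/(measurable_restrictT _ mS).
have mw : measurable_fun setT w by apply: measurable_funM => //; exact: measurable_cst.
have aS0 y : 0 <= (a \_ S) y.
  by rewrite patchE; case: ifPn => //; rewrite inE; exact: a_ge0.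
have w0 y : 0 <= w y by rewrite mulr_ge0// invr_ge0 ltW.
have nuE A : measurable A ->
    (distribution P' Yinf A = \int[Q]_(y in A) (w y)%:E)%E.
  move=> mA; rewrite lawY//.
  under [RHS]eq_integral do rewrite EFinM.
  rewrite ge0_integralZl//; last 3 first.
  - by apply: measurable_funTS; exact/measurable_EFinP.
  - by move=> y _; rewrite lee_fin.
  - by rewrite lee_fin invr_ge0 ltW.
  have -> : (\int[Q]_(y in A) ((a \_ S) y)%:E = \int[Q]_(y in S `&` A) (a y)%:E)%E.
    rewrite [LHS]integral_mkcond [RHS]integral_mkcond; apply: eq_integral => y _.
    rewrite [LHS]patchE [RHS]patchE in_setI patchE.
    by case: (y \in S); case: (y \in A).
  rewrite /qlaw_inf EFinM fineK//; apply: integrable_fin_num.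
    by apply: measurableI.
  by apply: (integrableS mS _ _ integrable_mark0) => //; apply: measurableI.
rewrite expectation_distribution// (integral_density Q _ w mw w0 nuE g mg).
have -> : (\int[Q]_y (g y * w y)%:E = \int[Q]_(y in S) (li^-1 * (a y * g y))%:E)%E.
  rewrite [RHS]integral_mkcond; apply: eq_integral => y _.
  rewrite /w !patchE; case: ifPn => _; last by rewrite !mulr0.
  by rewrite mulrCA [a y * _]mulrC.
rewrite -[fine _]/(Rintegral Q S (fun y => li^-1 * (a y * g y))) RintegralZl//.
  by rewrite mulrA divff ?mul1r// gt_eqF.
exact: integrable_mark.
Qed.

(** Expectations of the delay and of each coordinate of the mark: the former gives Gamma = -
    lambda_inf E(Theta_inf), the latter the integral in the definition of K. *)
Lemma Kvec_limit_law d' (Om' : measurableType d') (P' : probability Om' R)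
    (Yinf : {RV P' >-> (R * 'cV[R]_N)%type}) :
  (forall B, measurable B ->
     distribution P' Yinf B = (qlaw_inf Q alpha_inf B)%:E) ->
  Kvec Q alpha_inf =
    (1 - lambda_inf Q alpha_inf * fine ('E_P'[fun w => (Yinf w).1]))^-1 *:
      (lambda_inf Q alpha_inf *:
         \col_i fine ('E_P'[fun w => (Yinf w).2 i 0])).
Proof.
move=> lawY.
have sum0 (y : R * 'cV[R]_N) : 0 <= \sum_i (y.2 i 0) ^+ 2.
  by apply: sumr_ge0 => i _; exact: sqr_ge0.
have fst_le (y : R * 'cV[R]_N) : S y -> `|y.1| <= 1 + \sum_i (y.2 i 0) ^+ 2.
  move=> /stateS_range/andP[y1 y2]; rewrite ler0_norm//.
  by rewrite (le_trans (_ : - y.1 <= 1)) ?lerDl// lerNl.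
rewrite (expectation_limit_law _ _ _ Yinf (fun y => y.1) lawY _ fst_le); last first.
  exact: measurable_fst.
rewrite /Kvec; congr ((_)^-1 *: _).
  congr (1 + _); rewrite /Gamma -mulN1r -RintegralZl//.
    by apply: eq_Rintegral => y _; rewrite mulrC mulrN mulN1r.
  exact: (integrable_mark (fun y => y.1) measurable_fst fst_le).
apply/matrixP => i j; rewrite !mxE.
rewrite (expectation_limit_law _ _ _ Yinf (fun y => y.2 i 0) lawY)//.
  by apply: (measurableT_comp (measurable_coord i)); exact: measurable_snd.
move=> y _; apply: le_trans (_ : 1 + y.2 i 0 ^+ 2 <= _).
  rewrite -[y.2 i 0 ^+ 2]real_normK ?num_real//.
  by have := sqr_ge0 (`|y.2 i 0| - 1); have := normr_ge0 (y.2 i 0); nra.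
rewrite lerD2l (bigD1 i)//= lerDl; apply: sumr_ge0 => k _; exact: sqr_ge0.
Qed.

End limit_law.

(** * From coordinates to vectors *)

Lemma cvg_col {T : Type} {F : set_system T} {FF : Filter F} {R : realType} {N : nat}
    (f : T -> 'cV[R]_N) (v : 'cV[R]_N) :
  (forall i, f x i 0 @[x --> F] --> v i 0) -> f x @[x --> F] --> v.
Proof.
move=> fv; apply/cvgrPdist_lt => e e0.
have : \forall x \near F, forall i, `|v i 0 - f x i 0| < e.
  by apply: filter_forall => i; move/cvgrPdist_lt : (fv i); exact.
apply: filterS => x fx; rewrite [ltLHS]mx_normrE; apply: bigmax_lt => // -[i j] _.
by rewrite ord1 !mxE; exact: fx.
Qed.

(** The complement of S is [Q]-null, so the moment over S bounds the integral over the whole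
    space. *)
Lemma coordinate_second_moment {R : realType} {N : nat}
    (Q : probability (R * 'cV[R]_N)%type R) (i : 'I_N) : Q stateS = 1%E ->
  (\int[Q]_(y in stateS) (\sum_i (y.2 i 0) ^+ 2)%:E < +oo)%E ->
  exists V : R, (\int[Q]_y ((y.2 i 0) ^+ 2)%:E <= V%:E)%E.
Proof.
move=> QS moment.
have mS : measurable (stateS : set (R * 'cV[R]_N)) by exact: measurable_stateS.
have mi j : measurable_fun setT (fun y : R * 'cV[R]_N => y.2 j 0).
  by apply: (measurableT_comp (measurable_coord j)); exact: measurable_snd.
have sum0 (y : R * 'cV[R]_N) : 0 <= \sum_i (y.2 i 0) ^+ 2.
  by apply: sumr_ge0 => j _; exact: sqr_ge0.
exists (fine (\int[Q]_(y in stateS) (\sum_i (y.2 i 0) ^+ 2)%:E)%E).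
rewrite fineK; last first.
  by rewrite ge0_fin_numE//; apply: integral_ge0 => y _; rewrite lee_fin.
have QS0 : Q (~` stateS) = 0%E by rewrite probability_setC// QS subee.
rewrite (ge0_negligible_integral _ _ _ _ QS0)//; last 3 first.
- exact: measurableC.
- by apply/measurable_EFinP; exact: measurable_funX.
- by move=> y _; rewrite lee_fin sqr_ge0.
rewrite setTD setCK; apply: ge0_le_integral => //.
- by move=> y _; rewrite lee_fin sqr_ge0.
- by apply/measurable_EFinP; apply: measurable_funTS; exact: measurable_funX.
- apply/measurable_EFinP; apply: measurable_funTS; apply: measurable_sum => j.
  exact: measurable_funX.
- move=> y _; rewrite lee_fin (bigD1 i)//= lerDl.
  by apply: sumr_ge0 => j _; exact: sqr_ge0.
Qed.

Theorem theorem5 (R : realType) (N : nat) (hN : (1 <= N)%N)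
  (Q : probability (R * 'cV[R]_N)%type R) (hQ : Q stateS = 1%E)
  (alpha : R -> R -> R) (alpha_inf : R -> R) (M beta : R)
  (alpha_gt0 : forall t th, 0 <= t -> -1 <= th -> th <= 0 -> 0 < alpha t th)
  (alpha_bounded : exists C : R, forall t th, 0 <= t -> -1 <= th -> th <= 0 ->
     alpha t th <= C)
  (alpha_continuous : {within [set t | 0 <= t] `*` `[-1, 0],
     continuous (fun y : R * R => alpha y.1 y.2)})
  (alpha_inf_gt0 : forall th, -1 <= th -> th <= 0 -> 0 < alpha_inf th)
  (alpha_inf_continuous : {within `[-1, 0], continuous alpha_inf})
  (M_gt0 : 0 < M) (beta_gt0 : 0 < beta)
  (alpha_cvg : forall t th, 0 <= t -> -1 <= th -> th <= 0 ->
     `|alpha t th - alpha_inf th| <= M * expR (- beta * t))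
  (Q_moment2 : (\int[Q]_(y in stateS) (\sum_i (y.2 i 0) ^+ 2)%:E < +oo)%E)
  (u0 : R -> probability 'cV[R]_N R) (u0_continuous : narrow_continuous u0)
  (d : measure_display) (Om : measurableType d) (P : probability Om R)
  (Nt : R -> {RV P >-> nat}) (Y : nat -> {RV P >-> (R * 'cV[R]_N)%type})
  (U X : R -> {RV P >-> 'cV[R]_N})
  (hX : delayed_process Q alpha u0 Nt Y U X)
  (G : probability 'cV[R]_N R)
  (hG : centred_gaussian ((1 + Gamma Q alpha_inf)^-1 *: D0 Q alpha_inf) G)
  (hCLT : cvg_in_law P
     (fun t w => Num.sqrt t *: (t^-1 *: X t w - Kvec Q alpha_inf)) G) :
  {ae P, forall w, (t^-1 *: X t w) @[t --> +oo] --> Kvec Q alpha_inf} /\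
  (forall (d' : measure_display) (Om' : measurableType d')
     (P' : probability Om' R) (Yinf : {RV P' >-> (R * 'cV[R]_N)%type}),
     (forall B, measurable B ->
        distribution P' Yinf B = (qlaw_inf Q alpha_inf B)%:E) ->
     Kvec Q alpha_inf =
       (1 - lambda_inf Q alpha_inf * fine ('E_P'[fun w => (Yinf w).1]))^-1 *:
         (lambda_inf Q alpha_inf *:
            \col_i fine ('E_P'[fun w => (Yinf w).2 i 0]))).
Proof.
split; last first.
  move=> d' Om' P' Yinf lawY.
  exact: Kvec_limit_law lawY.
case: hX => HN [Y_state HY] _ _ X_path.
have [c [C [c0 C0 cC]]] := alpha_bounds alpha alpha_inf M beta alpha_gt0
  alpha_bounded alpha_continuous alpha_inf_gt0 alpha_inf_continuous M_gt0 beta_gt0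
  alpha_cvg.
have lamI := integral_lambda_bounds Q hQ alpha alpha_gt0 alpha_continuous c C c0 cC.
have infN := ae_infinitely_many_arrivals P _ Nt HN c C c0 lamI.
have Y_range n w : (0 < n)%N -> -1 <= (Y n w).1 <= 0.
  by move=> n0; apply: stateS_range; exact: Y_state.
have coord i : {ae P, forall w, X t w i 0 / t @[t --> +oo] --> Kvec Q alpha_inf i 0}.
  have [V2 V2_ge] := coordinate_second_moment Q i hQ Q_moment2.
  have C_ge0 := ltW C0; have kappa_ge0 : 0 <= C / c by rewrite divr_ge0// ltW.
  have mq := measurable_qlaw Q hQ alpha alpha_gt0 alpha_continuous c C c0 cC.
  have qT := qlawT Q hQ alpha alpha_gt0 alpha_continuous c C c0 cC.
  have q0 := qlaw_ge0 Q hQ alpha alpha_gt0 alpha_continuous c C c0 cC.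
  have q1 := qlaw_le1 Q hQ alpha alpha_gt0 alpha_continuous c C c0 cC.
  have qQ := qlaw_le Q hQ alpha alpha_gt0 alpha_continuous c C c0 C0 cC.
  have incr := probability_increment_eq P _ Nt HN c C c0 lamI.
  have no_arr := probability_no_arrival P _ Nt HN c C c0 lamI.
  have at_cubes := ae_coordinate_at_cubes P _ Nt HN infN _ Y HY mq qT q0 q1 Q
    (C / c) C V2 kappa_ge0 C_ge0 qQ incr i V2_ge no_arr U X Y_range X_path.
  apply: (ae_coordinate_cvg P _ Nt HN infN _ Y HY mq qT q0 q1 Q
    (C / c) C V2 kappa_ge0 C_ge0 qQ incr i V2_ge no_arr U X Y_range X_path).
  (* Along the cubes the quotient is almost surely close to the centring and in probability close to
     K, which identifies the limit of the centring. *)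
  apply: (cvg_mean_of_cvg_in_probability P _ _ _ _ at_cubes).
    move=> n; apply: measurable_funM; last exact: measurable_cst.
    by apply: (measurableT_comp (measurable_coord i)); exact: measurable_funP.
  have cubes_pinfty : (n ^ 3)%:R @[n --> \oo] --> (+oo : set_system R).
    apply/cvgryPge => A; apply: filterS (nbhs_infty_ger A) => n.
    move/le_trans; apply; rewrite ler_nat; case: n => // n.
    exact: (@leq_pexp2l n.+1 1 3).
  exact: (cvg_comp _ _ cubes_pinfty (clt_cvg_in_probability P X _ G i hCLT)).
(* The exceptional null sets of the finitely many coordinates are united. *)
have allcoord : {ae P, forall w, forall i,
    X t w i 0 / t @[t --> +oo] --> Kvec Q alpha_inf i 0}.
  by apply: filter_forall => i; exact: coord.
apply: filterS allcoord => w Xw; apply: cvg_col => i.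
by under eq_fun do rewrite mxE mulrC; exact: Xw.
Qed.
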